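(* Let $\lambda,\lambda',\epsilon>0$ with $\lambda'<\lambda$, let $\ell>0$, and let $\alpha\colon[0,\ell]\to\mathbb{H}$ be a smooth unit-vertical-speed $\lambda$-vertical curve. Suppose that $\alpha$ has $\mathfrak{h}$-slope at least $m$ for some $m>0$. Then there are smooth $\lambda'$-vertical curves $\gamma_1,\gamma_2\colon[0,\ell]\to\mathbb{H}$ connecting $\alpha(0)$ to $\alpha(\ell)$ such that $\hat{\mathcal{H}}^2(\gamma_1)<\epsilon$, $\hat{\mathcal{H}}^2(\gamma_2)>\epsilon^{-1}$, and $d_{\mathrm{Haus}}(\alpha,\gamma_i)<\epsilon$ for each $i\in\{1,2\}$. Furthermore, there are $\lambda'$-vertical curves $\tau_1,\tau_2\colon[0,1]\to\mathbb{H}$ connecting $\alpha(0)$ to $\alpha(\ell)$ such that $d_{\mathrm{Haus}}(\alpha,\tau_i)<\epsilon$ for each $i\in\{1,2\}$ and $\dim_H(\tau_1)<2<\dim_H(\tau_2)$.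
   Context: $\mathbb{H}$ is the first Heisenberg group, identified with $\mathbb{R}^3$ with the group law $(x,y,z)(x',y',z')=\left(x+x',y+y',z+z'+\tfrac12(xy'-x'y)\right)$ and identity $\mathbf{0}$; $z(\cdot)$ denotes the third coordinate and $\pi(x,y,z)=(x,y)$. The Kor\'anyi norm is $|(x,y,z)|_{\mathrm{Kor}}=\sqrt[4]{(x^2+y^2)^2+16z^2}$ and the distance is $d(a,b)=|b^{-1}a|_{\mathrm{Kor}}$. Hausdorff measure $\mathcal{H}^2$, Hausdorff dimension $\dim_H$, and Hausdorff distance $d_{\mathrm{Haus}}$ are with respect to $d$; applied to a parametrized curve they refer to its image. $\hat{\mathcal{H}}^2=c^{-1}\mathcal{H}^2$ is the rescaled measure normalized so that the segment $\{(0,0,t):0\le t\le 1\}$ has measure $1$. For $\lambda>0$, $\mathrm{VCone}_\lambda=\{(x,y,z)\in\mathbb{H}: |z|\ge\lambda(x^2+y^2)\}$. A set $E\subset\mathbb{H}$ is a $\lambda$-vertical curve if $E\subset p\,\mathrm{VCone}_\lambda$ for all $p\in E$; a parametrized curve (continuous injective map from an interval to $\mathbb{H}$) is a $\lambda$-vertical curve if its image is. A curve $[a,b]\to\mathbb{H}$ connects its value at $a$ to its value at $b$. For a smooth curve $\alpha\colon I\to\mathbb{H}$, $\alpha'(\tau)=\frac{\mathrm{d}}{\mathrm{d}t}\left[\alpha(\tau)^{-1}\alpha(t)\right]_{t=\tau}\in\mathfrak{h}\cong\mathbb{R}^3$ is the left-translated velocity. The curve has unit vertical speed if $|z(\alpha'(t))|=1$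 for all $t$; it is positively oriented if $z(\alpha'(t))>0$ for all $t$. For $m\ge0$, $\alpha$ has $\mathfrak{h}$-slope at least $m$ if $\alpha$ is positively oriented and $z(\alpha'(t))\ge m|\pi(\alpha'(t))|$ for all $t$. *)

(* Defs.v *)
From HB Require Import structures.
From mathcomp Require Import all_boot all_order all_algebra.
From mathcomp Require Import all_classical all_reals all_analysis.
From mathcomp Require Import ring.

Set Implicit Arguments.
Unset Strict Implicit.
Unset Printing Implicit Defensive.

Import Order.TTheory GRing.Theory Num.Theory.
Import numFieldNormedType.Exports.

Local Open Scope classical_set_scope.
Local Open Scope ring_scope.

(* The manifold topology of the Heisenberg group is the product topology of
   R^3; it is also the topology of the Koranyi distance [hdist]. *)
Definition heis (R : realType) : normedModType R := (R * R * R)%type.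

Definition xc (R : realType) (p : heis R) : R := p.1.1.
Definition yc (R : realType) (p : heis R) : R := p.1.2.
Definition zc (R : realType) (p : heis R) : R := p.2.

Definition hid (R : realType) : heis R := (0, 0, 0).

Definition hmul (R : realType) (p q : heis R) : heis R :=
  (xc p + xc q, yc p + yc q,
   zc p + zc q + 2^-1 * (xc p * yc q - xc q * yc p)).

Definition hinv (R : realType) (p : heis R) : heis R :=
  (- xc p, - yc p, - zc p).

Lemma hmulVp (R : realType) (p : heis R) : hmul (hinv p) p = hid R.
Proof.
case: p => [[x y] z]; rewrite /hmul /hinv /hid /xc /yc /zc /=.
by congr (_, _, _); ring.
Qed.

Lemma hmulpV (R : realType) (p : heis R) : hmul p (hinv p) = hid R.
Proof.
case: p => [[x y] z]; rewrite /hmul /hinv /hid /xc /yc /zc /=.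
by congr (_, _, _); ring.
Qed.

Definition koranyi (R : realType) (p : heis R) : R :=
  ((xc p ^+ 2 + yc p ^+ 2) ^+ 2 + 16 * zc p ^+ 2) `^ 4^-1.

Definition hdist (R : realType) (a b : heis R) : R :=
  koranyi (hmul (hinv b) a).

(* The [0] makes the diameter of the empty set 0 rather than -oo. *)
Definition diam (R : realType) (T : Type) (d : T -> T -> R) (E : set T)
  : \bar R :=
  ereal_sup ([set 0%E] `|` [set (d a b)%:E | a in E & b in E]).

(* The empty set has weight 0 also when s = 0, where 0 `^ 0 = 1. *)
Definition hausdorff_weight (R : realType) (T : Type) (d : T -> T -> R)
    (s : R) (E : set T) : \bar R :=
  if `[< E = set0 >] then 0%E else (diam d E `^ s)%E.

Definition hausdorff_content (R : realType) (T : Type) (d : T -> T -> R)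
    (s delta : R) (E : set T) : \bar R :=
  ereal_inf [set (\sum_(0 <= i <oo) hausdorff_weight d s (U i))%E
    | U in [set U : nat -> set T |
        E `<=` \bigcup_i U i /\ forall i, (diam d (U i) <= delta%:E)%E]].

(* The content is nonincreasing in delta, so this supremum is the limit as
   delta tends to 0. *)
Definition hausdorff_measure (R : realType) (T : Type) (d : T -> T -> R)
    (s : R) (E : set T) : \bar R :=
  ereal_sup [set hausdorff_content d s delta E
    | delta in [set delta : R | 0 < delta]].

Definition hausdorff_dim (R : realType) (T : Type) (d : T -> T -> R)
    (E : set T) : \bar R :=
  ereal_inf [set s%:E
    | s in [set s : R | 0 <= s /\ hausdorff_measure d s E = 0%E]].

Definition dist_to_set (R : realType) (T : Type) (d : T -> T -> R)
    (a : T) (B : set T) : \bar R :=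
  ereal_inf [set (d a b)%:E | b in B].

Definition hausdorff_dist (R : realType) (T : Type) (d : T -> T -> R)
    (A B : set T) : \bar R :=
  maxe (ereal_sup [set dist_to_set d a B | a in A])
       (ereal_sup [set dist_to_set d b A | b in B]).

Definition vertical_segment (R : realType) : set (heis R) :=
  [set ((0, 0, t) : heis R) | t in `[0, 1]].

(* The measure of the vertical segment is finite and positive, so [fine] only
   moves it to the type R. *)
Definition H2hat (R : realType) (E : set (heis R)) : \bar R :=
  (((fine (hausdorff_measure (@hdist R) 2 (@vertical_segment R)))^-1)%:E
    * hausdorff_measure (@hdist R) 2 E)%E.

Definition VCone (R : realType) (lam : R) : set (heis R) :=
  [set p | lam * (xc p ^+ 2 + yc p ^+ 2) <= `|zc p| ].

Definition vertical_set (R : realType) (lam : R) (E : set (heis R)) : Prop :=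
  forall p, E p -> E `<=` [set hmul p v | v in VCone lam].

(* Curves are total functions of which only the values on the interval I
   matter. *)
Definition param_curve (R : realType) (I : set R) (g : R -> heis R) : Prop :=
  {within I, continuous g} /\ set_inj I g.

Definition vertical_curve (R : realType) (lam : R) (I : set R)
    (g : R -> heis R) : Prop :=
  param_curve I g /\ vertical_set lam (g @` I).

Definition connects (R : realType) (a b : R) (g : R -> heis R)
    (p q : heis R) : Prop :=
  g a = p /\ g b = q.

Definition diff_quotient (R : realType) (V : normedModType R) (f : R -> V)
    (t u : R) : V :=
  (u - t)^-1 *: (f u - f t).

(* Limits are taken within I, hence one-sided at the endpoints of I. *)
Definition derivable_within (R : realType) (V : normedModType R) (I : set R)
    (f : R -> V) (t : R) : Prop :=
  cvg (diff_quotient f t u @[u --> within I t^']).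

Definition derive_within (R : realType) (V : normedModType R) (I : set R)
    (f : R -> V) (t : R) : V :=
  lim (diff_quotient f t u @[u --> within I t^']).

Definition smooth_on (R : realType) (V : normedModType R) (I : set R)
    (f : R -> V) : Prop :=
  forall (n : nat) (t : R), I t ->
    derivable_within I (iter n (derive_within I) f) t.

Definition left_velocity (R : realType) (I : set R) (g : R -> heis R)
    (t : R) : heis R :=
  derive_within I (fun u => hmul (hinv (g t)) (g u)) t.

Definition unit_vertical_speed (R : realType) (I : set R) (g : R -> heis R)
  : Prop :=
  forall t, I t -> `|zc (left_velocity I g t)| = 1.

Definition positively_oriented (R : realType) (I : set R) (g : R -> heis R)
  : Prop :=
  forall t, I t -> 0 < zc (left_velocity I g t).

Definition slope_at_least (R : realType) (m : R) (I : set R)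
    (g : R -> heis R) : Prop :=
  positively_oriented I g /\
  forall t, I t ->
    m * Num.sqrt (xc (left_velocity I g t) ^+ 2 +
                  yc (left_velocity I g t) ^+ 2)
      <= zc (left_velocity I g t).

(* Main.v *)
Require Import Defs.
From mathcomp Require Import all_boot all_order all_algebra.
From mathcomp Require Import all_classical all_reals all_analysis.
From mathcomp Require Import ring lra.

(* A helix of radius [r] and angular frequency [w], added to the projection of a
   curve, sweeps area at rate [r^2 w / 2]; lifting the perturbed projection so that
   the vertical speed stays constant therefore changes that speed from [v] to
   [v - r^2 w / 2].  At scale [1 / w] a curve of bounded slope looks like a vertical
   line, so if [r^2 |w| = 2 c v] with [c] small (depending only on lam') the result
   is lam'-vertical at that scale, while at much larger scales the curve has hardly
   moved.  Iterating with frequencies [W0 q^(2n)], [q] large, gives curves of speed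
   [(1 - c)^n] or [(1 + c)^n] according to the orientation of the helices.  The
   Hausdorff 2-measure is proportional to the speed, which gives gamma_1 and gamma_2.
   In the limit the vertical displacement over a time [1 / (W0 q^(2n))] is comparable
   to [((1 -+ c) / q^2)^n], so the limit curve has dimension different from 2. *)

Set Implicit Arguments.
Unset Strict Implicit.
Unset Printing Implicit Defensive.

Import Order.TTheory GRing.Theory Num.Theory.
Import numFieldNormedType.Exports.

Local Open Scope classical_set_scope.
Local Open Scope ring_scope.

(** * Derivatives within an interval *)

(** Let tau be a time difference with [wfreq k * tau] between 1/q and q. Only helix k matters there:
    the given curve and the slower helices have total planar speed O(1/q) times that of helix k, and
    the later helices have radius O(1/q) times [rad k]. With theta = [wfreq k * tau] and r =
    [rad k], the vertical displacement is about speed * tau = r^2 theta / (2c), while the squared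
    planar displacement is O(r^2 theta). As consecutive frequencies have ratio q^2, these windows
    leave no gap. The margin lam - lam' is spent only at times above q / W0, where the perturbation
    is compared with a linear lower bound kap * tau for the vertical displacement of the given
    curve; q must be large in terms of kap.

    Endpoints are kept exactly. An integer q and a suitable W0 let every helix make a whole number
    of turns, which closes its projection; the one free parameter left, the phase, cancels the
    vertical defect.

    All estimates concern the coordinates of the group increment between two points of a stage.
    Those that decide verticality have constants independent of the stage, so they survive in the
    limit. *)

Section wderiv.
Context {R : realType}.
Variable l : R.
Hypothesis l0 : 0 < l.

Definition wderiv (V : normedModType R) (f : R -> V) (t : R) (d : V) : Prop :=
  diff_quotient f t u @[u --> within `[0, l] t^'] --> d.

(** This is what makes limits within the interval unique. As l > 0, points of the interval other
    than t lie arbitrarily close to t, on its right if t < l and on its left otherwise. *)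
Lemma within_itv_proper (t : R) : t \in `[0, l] -> ProperFilter (within `[0, l] t^').
Proof.
rewrite in_itv /= => /andP[t0 tl]; apply: Build_ProperFilter_ex => A.
rewrite /within /= => -[e /= e0 eA].
have [tl'|tl'] := ltP t l.
- pose u : R := Num.min (t + e / 2) l.
  have ut : t < u by rewrite lt_min tl' andbT ltrDl divr_gt0.
  have ue : u <= t + e / 2 by rewrite ge_min lexx.
  have ul : u <= l by rewrite ge_min lexx orbT.
  move: u ut ue ul => u ut ue ul.
  exists u; apply: eA => /=.
  + by rewrite ltr0_norm ?subr_lt0 // opprB; lra.
  + by rewrite gt_eqF.
  + by rewrite in_itv /=; lra.
- pose u : R := Num.max (t - e / 2) 0.
  have ut : u < t.
    rewrite gt_max; apply/andP; split.
      by rewrite ltrBlDr ltrDl divr_gt0.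
    exact: lt_le_trans tl'.
  have ue : t - e / 2 <= u by rewrite le_max lexx.
  have ul : 0 <= u by rewrite le_max lexx orbT.
  move: u ut ue ul => u ut ue ul.
  exists u; apply: eA => /=.
  + by rewrite gtr0_norm ?subr_gt0 //; lra.
  + by rewrite lt_eqF.
  + by rewrite in_itv /=; lra.
Qed.

Lemma wderiv_derivable (V : normedModType R) (f : R -> V) (t : R) d : t \in `[0, l] ->
  wderiv f t d -> derivable_within `[0, l] f t /\ derive_within `[0, l] f t = d.
Proof.
move=> tI fd; have ? := within_itv_proper tI; split.
- by apply/cvg_ex; exists d.
- exact: (@cvg_lim _ (@norm_hausdorff _ V)).
Qed.

Lemma derivable_wderiv (V : normedModType R) (f : R -> V) (t : R) :
  derivable_within `[0, l] f t -> wderiv f t (derive_within `[0, l] f t).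
Proof. by move=> /cvg_ex [d]; exact: cvgP. Qed.

Lemma wderiv_ext (V : normedModType R) (f g : R -> V) (t : R) d : t \in `[0, l] ->
  {in `[0, l], f =1 g} -> wderiv f t d -> wderiv g t d.
Proof.
move=> tI fg; apply: cvg_trans; apply: fmap_within_eq => u uI.
by rewrite inE in uI; rewrite /diff_quotient fg // fg.
Qed.

Lemma near_within_itv (t : R) (P : set R) :
  (forall u : R, u \in `[0, l] -> u != t -> P u) ->
  \forall u \near within `[0, l] t^', P u.
Proof.
move=> H; rewrite near_withinE.
by apply: filterS (nbhs_dnbhs_neq t) => u ut uI; exact: H.
Qed.

Lemma wderiv_cst (V : normedModType R) (a : V) t : wderiv (fun=> a) t 0.
Proof.
rewrite /wderiv (_ : diff_quotient _ _ = fun=> 0); first exact: cvg_cst.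
by apply/funext => u; rewrite /diff_quotient subrr scaler0.
Qed.

Lemma diff_quotientE (f : R -> R) (t u : R) :
  diff_quotient f t u = (u - t)^-1 * (f u - f t).
Proof. by []. Qed.

Lemma wderiv_id t : wderiv id t (1 : R).
Proof.
apply: (@cvg_trans _ ((fun=> 1) @ within `[0, l] t^')); last exact: cvg_cst.
apply: near_eq_cvg; apply: near_within_itv => u _ ut.
by rewrite diff_quotientE mulVf // subr_eq0.
Qed.

Lemma wderivD (V : normedModType R) (f g : R -> V) t a b :
  wderiv f t a -> wderiv g t b -> wderiv (fun u => f u + g u) t (a + b).
Proof.
move=> fa gb; rewrite /wderiv (_ : diff_quotient _ _ =
  (fun u => diff_quotient f t u + diff_quotient g t u)); first exact: cvgD.
by apply/funext => u; rewrite /diff_quotient -scalerDr opprD addrACA.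
Qed.

Lemma wderivN (V : normedModType R) (f : R -> V) t a :
  wderiv f t a -> wderiv (fun u => - f u) t (- a).
Proof.
move=> fa; rewrite /wderiv (_ : diff_quotient _ _ =
  (fun u => - diff_quotient f t u)); first exact: cvgN.
by apply/funext => u; rewrite /diff_quotient -scalerN opprB opprK [- f u + _]addrC.
Qed.

Lemma wderiv_cvg (f : R -> R) (t d : R) : wderiv f t d ->
  f u @[u --> within `[0, l] t^'] --> f t.
Proof.
move=> fd; apply: (@cvg_trans _
  ((fun u => f t + (u - t) * diff_quotient f t u) @ within `[0, l] t^')).
  apply: near_eq_cvg; apply: near_within_itv => u _ ut.
  rewrite diff_quotientE mulVKf ?subr_eq0 // addrC subrK.
  by [].
suff H : u - t @[u --> within `[0, l] t^'] --> t - t.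
  by have := cvgD (cvg_cst (f t)) (cvgM H fd); rewrite subrr mul0r addr0; exact.
apply: cvgB; last exact: cvg_cst.
by apply: cvg_within_filter; exact: nbhs_dnbhs.
Qed.

Lemma wderivM (f g : R -> R) t a b : wderiv f t a -> wderiv g t b ->
  wderiv (fun u => f u * g u) t (a * g t + f t * b).
Proof.
move=> fa gb; rewrite /wderiv (_ : diff_quotient _ _ =
  (fun u => diff_quotient f t u * g u + f t * diff_quotient g t u)).
  apply: cvgD; apply: cvgM => //; first exact: wderiv_cvg gb.
  exact: cvg_cst.
by apply/funext => u; rewrite !diff_quotientE; ring.
Qed.

Lemma wderivZ (k : R) (f : R -> R) t a : wderiv f t a ->
  wderiv (fun u => k * f u) t (k * a).
Proof.
by move=> fa; have := wderivM (wderiv_cst k t) fa; rewrite mul0r add0r.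
Qed.

Lemma is_derive_wderiv (f : R -> R) (t d : R) : is_derive t 1 f d -> wderiv f t d.
Proof.
move=> [df fd]; rewrite /wderiv.
apply: cvg_within_filter.
have : (fun h => h^-1 *: (f (h *: 1 + t) - f t)) @ 0^' --> d by rewrite -fd.
move=> /cvgrPdist_le H; apply/cvgrPdist_le => e e0.
have [a /= a0 aH] := H _ e0; exists a => //= u ua ut.
have := aH (u - t); rewrite /= sub0r normrN.
move: ua; rewrite /ball_ /= distrC => ua; rewrite subr_eq0 => /(_ ua ut).
by rewrite /diff_quotient scaler1 subrK.
Qed.

Lemma wderiv_is_derive (f : R -> R) (t d : R) : t \in `]0, l[ -> wderiv f t d ->
  is_derive t 1 f d.
Proof.
rewrite in_itv /= => /andP[t0 tl] /cvgrPdist_le H.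
suff K : (fun h => h^-1 *: (f (h *: 1 + t) - f t)) @ 0^' --> d.
  apply: DeriveDef; first by apply/cvg_ex; exists d.
  by apply: cvg_lim => //; exact: norm_hausdorff.
apply/cvgrPdist_le => e e0.
have [a /= a0 aH] := H _ e0.
exists (Num.min a (Num.min t (l - t))) => /=.
  by rewrite !lt_min a0 t0 subr_gt0.
move=> h /=; rewrite sub0r normrN !lt_min => /and3P[ha ht hl] h0.
have := aH (h + t); rewrite /= /diff_quotient scaler1 addrK.
rewrite opprD addrCA subrr addr0 normrN => /(_ ha); apply.
  by rewrite -subr_eq0 addrK.
by rewrite in_itv /=; move: ht hl; rewrite !ltr_norml => /andP[? ?] /andP[? ?]; lra.
Qed.

Lemma wderiv_continuous (f df : R -> R) :
  {in `[0, l], forall t, wderiv f t (df t)} -> {within `[0, l], continuous f}.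
Proof.
move=> fd; apply/subspace_continuousP => t tI.
have /wderiv_cvg/cvgrPdist_le H := fd _ tI.
apply/cvgrPdist_le => e e0; have [a /= a0 aH] := H _ e0.
exists a => //= u ua uI; have [->|ut] := eqVneq u t.
  by rewrite subrr normr0 ltW.
exact: aH.
Qed.

Lemma wderiv_MVT (f df : R -> R) s t : 0 <= s -> s < t -> t <= l ->
  {in `[0, l], forall t, wderiv f t (df t)} ->
  exists2 c : R, s < c < t & f t - f s = df c * (t - s).
Proof.
move=> s0 st tl fd.
have [||c] := @MVT R f df s t st.
- move=> u; rewrite in_itv /= => /andP[su ut].
  apply: wderiv_is_derive; first by rewrite in_itv /=; lra.
  by apply: fd; rewrite in_itv /=; lra.
- apply: (continuous_subspaceW _ (wderiv_continuous fd)) => u /=.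
  by rewrite !in_itv /=; lra.
- by rewrite in_itv /= => cst E; exists c.
Qed.

Lemma wderiv_lip (f df : R -> R) (M s t : R) : 0 <= s -> s <= t -> t <= l ->
  {in `[0, l], forall t, wderiv f t (df t)} ->
  (forall u : R, s <= u <= t -> `|df u| <= M) -> `|f t - f s| <= M * (t - s).
Proof.
move=> s0; rewrite le_eqVlt => /predU1P[->|st] tl fd dM.
  by rewrite !subrr mulr0 normr0.
have [c cst ->] := wderiv_MVT s0 st tl fd.
rewrite normrM (gtr0_norm (_ : 0 < t - s)) ?subr_gt0 //.
by rewrite ler_wpM2r ?subr_ge0 ?(ltW st) // dM; lra.
Qed.

Lemma wderiv_cos (w p t : R) :
  wderiv (fun u => cos (w * u + p)) t (- w * sin (w * t + p)).
Proof.
apply: is_derive_wderiv.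
have H : is_derive t 1 (fun u : R => w * u + p) w.
  by apply: is_derive_eq; rewrite /GRing.scale /= ; ring.
by apply: is_derive_eq; rewrite /GRing.scale /=; ring.
Qed.

Lemma wderiv_sin (w p t : R) :
  wderiv (fun u => sin (w * u + p)) t (w * cos (w * t + p)).
Proof.
apply: is_derive_wderiv.
have H : is_derive t 1 (fun u : R => w * u + p) w.
  by apply: is_derive_eq; rewrite /GRing.scale /= ; ring.
by apply: is_derive_eq; rewrite /GRing.scale /=; ring.
Qed.

Lemma wderiv_sum (f df : nat -> R -> R) n t :
  (forall i, (i < n)%N -> wderiv (f i) t (df i t)) ->
  wderiv (fun u => \sum_(i < n) f i u) t (\sum_(i < n) df i t).
Proof.
elim: n => [_|n IH H].
  by under eq_fun do rewrite big_ord0; rewrite big_ord0; exact: wderiv_cst.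
under eq_fun do rewrite big_ord_recr /=.
rewrite big_ord_recr /=; apply: wderivD; last exact: H.
by apply: IH => i ilt; apply: H; exact: ltnW.
Qed.

(** The function is only controlled on [0, l]; precomposing with the clamp onto that interval
    extends it to a continuous function on the line without changing it there. *)
Lemma wderiv_primitive (f : R -> R) : {within `[0, l], continuous f} ->
  exists F : R -> R, {in `[0, l], forall t, wderiv F t (f t)}.
Proof.
move=> cf.
pose clamp (u : R) := Num.max 0 (Num.min u l).
have clI u : clamp u \in `[0, l].
  by rewrite in_itv /= /clamp le_max lexx /= ge_max (ltW l0) /= ge_min lexx orbT.
have clE u : u \in `[0, l] -> clamp u = u.
  by rewrite in_itv /= /clamp => /andP[u0 ul]; rewrite min_l // max_r.
have clc : continuous clamp.
  have c0 (a : R) : continuous ((fun=> a) : R -> R^o) by move=> u; exact: cvg_cst.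
  have cid : continuous (id : R -> R^o) by move=> u; exact: cvg_id.
  move=> u; have h1 := continuous_min (cid u) (c0 l u).
  exact: (continuous_max (c0 0 u) h1).
pose g u := f (clamp u).
have cg : continuous g.
  move=> u; move/subspace_continuousP : cf => /(_ _ (clI u)) /cvgrPdist_le H.
  apply/cvgrPdist_le => e e0; have [d /= d0 dH] := H _ e0.
  have /cvgrPdist_lt /(_ _ d0) := clc u.
  by apply: filterS => v vd; apply: dH => //; exact: clI.
have ig : (@lebesgue_measure R).-integrable `[-1, l + 1] (EFin \o g).
  apply: continuous_compact_integrable; first exact: segment_compact.
  by apply: continuous_subspaceT => u; exact: cg.
(* Integrating from -1, with l + 1 as upper end, puts 0 and l in the interior, so a two-sided
   derivative is available at the endpoints too. *)
exists (fun x => (\int[@lebesgue_measure R]_(t in `[-1, x]) g t)%R).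
move=> t tI; apply: is_derive_wderiv.
have tI' := tI; move: tI'; rewrite in_itv /= => /andP[t0 tl].
have [|||D E] := @continuous_FTC1_closed _ g (-1) t (l + 1) _ ig.
- lra.
- lra.
- exact: cg.
apply: DeriveDef => //.
by rewrite -derive1E E /g clE.
Qed.

End wderiv.

(** * Smoothness within an interval *)

Section wsmooth.
Context {R : realType}.
Variable l : R.
Hypothesis l0 : 0 < l.

(** The successive derivatives are existential witnesses, constrained only on [0, l]. This form is
    closed under sums and products by induction, whereas iterating [derive_within] would require
    rewriting limits at every order. *)
Fixpoint wCn (V : normedModType R) (n : nat) (f : R -> V) : Prop :=
  if n is n'.+1 then
    exists2 g : R -> V, {in `[0, l], forall t, wderiv l f t (g t)} & wCn n' g
  else True.

Definition wsmooth (V : normedModType R) (f : R -> V) : Prop :=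
  forall n, wCn n f.

Lemma wCn_ext (V : normedModType R) n (f g : R -> V) :
  {in `[0, l], f =1 g} -> wCn n f -> wCn n g.
Proof.
case: n => //= n fg [d fd dn]; exists d => // t tI.
by apply: wderiv_ext (fd _ tI).
Qed.

Lemma wCnW (V : normedModType R) n (f : R -> V) : wCn n.+1 f -> wCn n f.
Proof.
elim: n f => //= n IH f [g fg gn]; exists g => //; exact: IH.
Qed.

Lemma wsmooth_deriv (V : normedModType R) (f df : R -> V) :
  {in `[0, l], forall t, wderiv l f t (df t)} -> wsmooth df -> wsmooth f.
Proof. by move=> fd dfs [|n] //=; exists df. Qed.

Lemma smooth_wsmooth (V : normedModType R) (f : R -> V) :
  smooth_on `[0, l] f ->
  {in `[0, l], forall t, wderiv l f t (derive_within `[0, l] f t)} /\ wsmooth f.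
Proof.
move=> fs.
have D (g : R -> V) : smooth_on `[0, l] g ->
  {in `[0, l], forall t, wderiv l g t (derive_within `[0, l] g t)}.
  by move=> gs t tI; apply: derivable_wderiv; exact: (gs 0%N).
split; first exact: D.
move=> n; elim: n f fs => //= n IH f fs.
exists (derive_within `[0, l] f); first exact: D.
by apply: IH => k t tI; rewrite -iterSr; exact: fs.
Qed.

Lemma wsmooth_smooth (V : normedModType R) (f : R -> V) :
  wsmooth f -> smooth_on `[0, l] f.
Proof.
move=> fs n; move: (fs n.+1) => {fs}.
elim: n f => [|n IH] f [g fg gn] t tI; first exact: (wderiv_derivable l0 tI (fg _ tI)).1.
rewrite iterSr; apply: IH => //; apply: (@wCn_ext _ n.+1 g) => // u uI.
by rewrite (wderiv_derivable l0 uI (fg _ uI)).2.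
Qed.

Lemma wsmooth_cst (V : normedModType R) (a : V) : wsmooth (fun=> a).
Proof.
move=> n; elim: n a => //= n IH a; exists (fun=> 0) => // t _.
exact: wderiv_cst.
Qed.

Lemma wCnD (V : normedModType R) n (f g : R -> V) : wCn n f -> wCn n g ->
  wCn n (fun u => f u + g u).
Proof.
elim: n f g => //= n IH f g [df fd dfn] [dg gd dgn].
exists (fun u => df u + dg u); last exact: IH.
by move=> t tI; apply: wderivD; [exact: fd|exact: gd].
Qed.

Lemma wsmoothD (V : normedModType R) (f g : R -> V) : wsmooth f -> wsmooth g ->
  wsmooth (fun u => f u + g u).
Proof. by move=> fs gs n; exact: wCnD. Qed.

Lemma wsmoothM (f g : R -> R) : wsmooth f -> wsmooth g ->
  wsmooth (fun u => f u * g u).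
Proof.
move=> fs gs n; move: (fs n) (gs n) => {fs gs}.
elim: n f g => // n IH f g fn gn.
have fn' := wCnW fn; have gn' := wCnW gn.
move: fn gn => [df fd dfn] [dg gd dgn].
exists (fun u => df u * g u + f u * dg u).
  by move=> t tI; apply: wderivM; [exact: fd|exact: gd].
by apply: wCnD; exact: IH.
Qed.

Lemma wsmoothZ (k : R) (f : R -> R) : wsmooth f -> wsmooth (fun u => k * f u).
Proof. by move=> fs; apply: wsmoothM => //; exact: wsmooth_cst. Qed.

Lemma wsmoothN (f : R -> R) : wsmooth f -> wsmooth (fun u => - f u).
Proof.
move=> /(wsmoothZ (-1)) H; rewrite (_ : (fun _ => _) = fun u => -1 * f u) //.
by apply/funext => u; rewrite mulN1r.
Qed.

Lemma wsmoothB (f g : R -> R) : wsmooth f -> wsmooth g ->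
  wsmooth (fun u => f u - g u).
Proof. by move=> fs gs; apply: wsmoothD => //; exact: wsmoothN. Qed.

Lemma wsmooth_sum n (f : nat -> R -> R) :
  (forall i, (i < n)%N -> wsmooth (f i)) ->
  wsmooth (fun u => \sum_(i < n) f i u).
Proof.
elim: n => [_|n IH H].
  by under eq_fun do rewrite big_ord0; exact: wsmooth_cst.
under eq_fun do rewrite big_ord_recr /=.
by apply: wsmoothD; [apply: IH => i ilt; apply: H; exact: ltnW|exact: H].
Qed.

(** The linear combinations of the cosine and the sine are closed under differentiation, so the
    induction runs over all of them at once. *)
Lemma wsmooth_trig (w p : R) :
  wsmooth (fun u => cos (w * u + p)) /\ wsmooth (fun u => sin (w * u + p)).
Proof.
suff H n (a b : R) : wCn n (fun u => a * cos (w * u + p) + b * sin (w * u + p)).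
  split=> n.
    apply: wCn_ext (H n 1 0) => u _; by rewrite mul1r mul0r addr0.
  apply: wCn_ext (H n 0 1) => u _; by rewrite mul1r mul0r add0r.
elim: n a b => //= n IH a b.
exists (fun u => (b * w) * cos (w * u + p) + (- a * w) * sin (w * u + p)) => // t _.
suff : wderiv l (fun u => a * cos (w * u + p) + b * sin (w * u + p)) t
    (a * (- w * sin (w * t + p)) + b * (w * cos (w * t + p))).
  by congr wderiv; ring.
by apply: wderivD; apply: wderivZ; [exact: wderiv_cos|exact: wderiv_sin].
Qed.

Lemma wderiv_pair (U V : normedModType R) (f : R -> U * V) (t : R) (a : U) (b : V) :
  wderiv l f t (a, b) <->
  wderiv l (fun u => (f u).1) t a /\ wderiv l (fun u => (f u).2) t b.
Proof.
split=> [H|[Ha Hb]].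
  split=> P nP.
    have h : nbhs (a, b) (fst @^-1` P) by exact: (@cvg_fst _ _ (nbhs a) (nbhs b) _ P nP).
    exact: (H _ h).
  have h : nbhs (a, b) (snd @^-1` P) by exact: (@cvg_snd _ _ (nbhs a) (nbhs b) _ P nP).
  exact: (H _ h).
exact: (cvg_pair Ha Hb).
Qed.

Lemma wderiv_heis (g : R -> heis R) (t : R) (a b c : R) :
  wderiv l g t ((a, b, c) : heis R) <->
  [/\ wderiv l (fun u => xc (g u)) t a, wderiv l (fun u => yc (g u)) t b
    & wderiv l (fun u => zc (g u)) t c].
Proof.
split=> [/wderiv_pair [/wderiv_pair [Ha Hb] Hc]//|[Ha Hb Hc]].
by apply/wderiv_pair; split => //; apply/wderiv_pair.
Qed.

Lemma wsmooth_heis (g : R -> heis R) :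
  wsmooth g <->
  [/\ wsmooth (fun u => xc (g u)), wsmooth (fun u => yc (g u))
    & wsmooth (fun u => zc (g u))].
Proof.
suff H n : wCn n g <-> [/\ wCn n (fun u => xc (g u)), wCn n (fun u => yc (g u))
    & wCn n (fun u => zc (g u))].
  split=> [gs|[xs ys zs] n]; last by apply/H.
  by split=> n; have /H[] := gs n.
elim: n g => //= n IH g; split=> [[d gd /IH [dx dy dz]]|[[a xa an] [b yb bn] [c zc cn]]].
  have gd3 t : t \in `[0, l] -> wderiv l g t ((xc (d t), yc (d t), zc (d t)) : heis R).
    by move=> tI; have := gd t tI; rewrite /xc /yc /zc; case: (d t) => [[? ?] ?].
  split; [exists (fun u => xc (d u))|exists (fun u => yc (d u))|exists (fun u => zc (d u))] => //;
    by move=> t /gd3/wderiv_heis [].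
exists (fun u => (a u, b u, c u) : heis R).
  by move=> t tI; apply/wderiv_heis; split; [exact: xa|exact: yb|exact: zc].
by apply/IH.
Qed.

End wsmooth.

(** * Hausdorff measure of images of intervals *)

Section hausdorff.
Context {R : realType} {T : Type}.
Variable d : T -> T -> R.
Hypothesis d_ge0 : forall a b, 0 <= d a b.

Lemma diam_ge0 (E : set T) : (0 <= diam d E)%E.
Proof. by apply: ereal_sup_ubound; left. Qed.

Lemma diam_le (E : set T) (D : R) : 0 <= D ->
  (forall a b, E a -> E b -> d a b <= D) -> (diam d E <= D%:E)%E.
Proof.
move=> D0 H; apply: ge_ereal_sup => _ [->|[a Ea [b Eb <-]]]; rewrite lee_fin //.
exact: H.
Qed.

Lemma diam_fin (E : set T) (D : R) : (diam d E <= D%:E)%E ->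
  exists2 e : R, 0 <= e /\ diam d E = e%:E & forall a b, E a -> E b -> d a b <= e.
Proof.
move=> ED; have E0 := diam_ge0 E.
have Ef : diam d E \is a fin_num.
  rewrite ge0_fin_numE //; exact: le_lt_trans ED (ltry _).
exists (fine (diam d E)); first by rewrite fine_ge0 // fineK.
move=> a b Ea Eb; rewrite -lee_fin fineK //; apply: ereal_sup_ubound; right.
by exists a => //; exists b.
Qed.

Lemma hausdorff_weight_ge0 (s : R) (E : set T) : (0 <= hausdorff_weight d s E)%E.
Proof.
by rewrite /hausdorff_weight; case: ifP => // _; exact: poweR_ge0.
Qed.

(** Cover by the images of n consecutive closed subintervals of equal length. *)
Lemma hausdorff_content_image_le (g : R -> T) (l p delta D : R) (n : nat) :
  (0 < n)%N -> 0 < l -> 0 <= p -> 0 <= D -> D <= delta ->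
  {in `[0, l] &, forall s t, `|s - t| <= l / n%:R -> d (g s) (g t) <= D} ->
  (hausdorff_content d p delta (g @` `[0%R, l]) <= (n%:R * D `^ p)%:E)%E.
Proof.
move=> n0 l0 p0 D0 Dd H.
have n0' : 0 < n%:R :> R by rewrite ltr0n.
have ln0 : 0 < l / n%:R by rewrite divr_gt0.
pose U i : set T := if (i < n)%N then
  g @` [set t | t \in `[0, l] /\ i%:R * (l / n%:R) <= t <= i.+1%:R * (l / n%:R)] else set0.
have UD i : (diam d (U i) <= D%:E)%E.
  rewrite /U; case: ifP => _; apply: diam_le => // _ _ [s [sI /andP[s1 s2]] <-] [t [tI /andP[t1 t2]] <-].
  apply: H => //; move: s2 t2; rewrite -natr1 mulrDl mul1r => s2 t2.
  by rewrite ler_norml; apply/andP; split; lra.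
apply: (@le_trans _ _ (\sum_(0 <= i <oo) hausdorff_weight d p (U i))%E).
  apply: ereal_inf_lbound; exists U => //; split; last first.
    by move=> i; apply: le_trans (UD i) _; rewrite lee_fin.
  move=> _ [t tI <-]; move: (tI); rewrite /= in_itv /= => /andP[t0 tl].
  pose k := Num.truncn (t / (l / n%:R)).
  have /andP[k1 k2] : k%:R <= t / (l / n%:R) < k.+1%:R.
    by apply: truncn_itv; rewrite divr_ge0 // ltW.
  move: k1 k2; rewrite ler_pdivlMr // ltr_pdivrMr // => k1 k2.
  have [kn|nk] := ltnP k n.
    exists k => //; rewrite /U kn; exists t => //; split => //.
    by rewrite k1 ltW.
  (* The truncated quotient reaches n only at the right endpoint, which belongs to the closed last
     piece, of index n - 1. *)
  have tl' : t = l.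
    apply/eqP; rewrite eq_le tl /=; apply: le_trans k1.
    rewrite mulrCA ler_peMr ?(ltW l0) // ler_pdivlMr // mul1r ler_nat //.
  exists n.-1 => //; rewrite /U prednK // leqnn; exists t => //; split => //.
  rewrite tl' [n%:R * _]mulrC divfK ?gt_eqF // lexx andbT.
  rewrite mulrCA ger_pMr // ler_pdivrMr // mul1r ler_nat.
  exact: leq_pred.
rewrite (@nneseries_split _ _ 0 n); last by move=> k _; exact: hausdorff_weight_ge0.
rewrite add0n (@eseries0 _ _ n) ?adde0; last first.
  by move=> i ni _; rewrite /hausdorff_weight /U ltnNge ni /=; case: asboolP.
apply: (@le_trans _ _ (\sum_(0 <= i < n) (D `^ p)%:E)%E); last first.
  by rewrite sumEFin big_const_nat subn0 iter_addr addr0 mulr_natl.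
apply: lee_sum => i _; rewrite /hausdorff_weight; case: ifP => _.
  by rewrite lee_fin powR_ge0.
rewrite -poweR_EFin; apply: gt0_ler_poweR => //.
- by rewrite in_itv /= diam_ge0 leey.
- by rewrite in_itv /= lee_fin D0 leey.
Qed.

(** Mass distribution principle for Lebesgue measure on the parameter interval: a cover of the image
    pulls back to a cover of [0, l], and each preimage has length at most c^-1 times the p-th power
    of the diameter. Only covers of mesh delta are needed, so the hypothesis concerns only pairs at
    distance at most delta. *)
Lemma hausdorff_measure_image_ge (g : R -> T) (l p c delta : R) :
  0 < l -> 0 <= p -> 0 < c -> 0 < delta ->
  {in `[0, l] &, forall s t, d (g s) (g t) <= delta -> c * `|s - t| <= d (g s) (g t) `^ p} ->
  ((c * l)%:E <= hausdorff_measure d p (g @` `[0%R, l]))%E.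
Proof.
move=> l0 p0 c0 delta0 H.
apply: (@le_trans _ _ (hausdorff_content d p delta (g @` `[0%R, l]))); last first.
  by apply: ereal_sup_ubound; exists delta.
apply: le_ereal_inf_tmp => _ [U [EU Ud] <-].
pose J i : set R := [set t | t \in `[0, l] /\ U i (g t)].
(* The preimage [J i] need not be measurable; its interval hull is, and has the same extent. *)
pose K i : set R := if `[< J i = set0 >] then set0 else `[inf (J i), sup (J i)]%classic.
have hsJ i : J i !=set0 -> has_sup (J i) /\ has_inf (J i).
  move=> J0; split; split=> //; [exists l|exists 0] => t [];
    by rewrite in_itv /= => /andP[].
have JK i : J i `<=` K i.
  move=> t Jt; rewrite /K; case: asboolP => [J0|_]; first by rewrite -J0.
  have [hs hi] := hsJ i (ex_intro _ t Jt).
  rewrite /= in_itv /=; apply/andP; split.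
    by apply: ge_inf => //; exact: hi.2.
  by apply: ub_le_sup => //; exact: hs.2.
have mK i : measurable (K i).
  by rewrite /K; case: ifP => _; [exact: measurable0|exact: measurable_itv].
have muK i : (lebesgue_measure (K i) <= (c^-1)%:E * hausdorff_weight d p (U i))%E.
  rewrite /K; case: asboolP => [_|J0].
    by rewrite measure0 mule_ge0 ?hausdorff_weight_ge0 // lee_fin invr_ge0 ltW.
  have [t0 Jt0] : J i !=set0 by apply/set0P/eqP.
  have [hs hi] := hsJ i (ex_intro _ t0 Jt0).
  have [e [e0 De] eU] := diam_fin (Ud i).
  rewrite /hausdorff_weight; case: asboolP => [U0|_].
    by case: Jt0 => _; rewrite U0.
  have ed : e <= delta by have := Ud i; rewrite De lee_fin.
  rewrite De poweR_EFin -EFinM lebesgue_measure_itv /=.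
  case: ifP => _; last by rewrite lee_fin mulr_ge0 ?powR_ge0 // invr_ge0 ltW.
  rewrite -EFinB lee_fin.
  have JJ s t : J i s -> J i t -> t - s <= c^-1 * e `^ p.
    move=> [sI Us] [tI Ut]; rewrite ler_pdivlMl //.
    have ? : d (g t) (g s) <= e by exact: eU.
    apply: le_trans (le_trans (H _ _ tI sI _) _); last 2 first.
    - exact: le_trans ed.
    - by apply: ge0_ler_powR => //; rewrite nnegrE.
    - by rewrite ler_wpM2l ?(ltW c0) // ler_norm.
  rewrite lerBlDr; apply: ge_sup; first by exists t0.
  move=> t Jt; rewrite -lerBlDl; apply: lb_le_inf; first by exists t0.
  by move=> s Js; rewrite lerBlDr -lerBlDl; exact: JJ.
have lK : (l%:E <= \sum_(0 <= i <oo) lebesgue_measure (K i))%E.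
  have <- : lebesgue_measure `[0, l]%classic = l%:E.
    by rewrite lebesgue_measure_itv /= lte_fin l0 oppr0 adde0.
  apply: (measure_sigma_subadditive (@lebesgue_measure R) mK (measurable_itv _)).
  move=> t tI; have [i _ Ui] : (\bigcup_i U i) (g t) by apply: EU; exists t.
  by exists i => //; apply: JK; split.
rewrite EFinM.
apply: (@le_trans _ _ (c%:E * \sum_(0 <= i <oo) ((c^-1)%:E * hausdorff_weight d p (U i)))%E).
  apply: lee_wpmul2l; first by rewrite lee_fin ltW.
  apply: le_trans lK _; apply: lee_nneseries => // i _; exact: measure_ge0.
rewrite nneseriesZl; last by move=> i _; exact: hausdorff_weight_ge0.
by rewrite muleA -EFinM divff ?gt_eqF // mul1e.
Qed.

End hausdorff.

(** * Helices added to a curve *)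

(* [(wx, wy, wz)] is the curve to be perturbed and [(wdx, wdy)] the derivative of its
   projection f.  The n-th helix has projection h_n = (hx n, hy n), where [freq n] is
   signed, and [prim n] is a primitive of the cross product h_n x f'. *)
Record wiggle (R : realType) := Wiggle {
  wx : R -> R; wy : R -> R; wz : R -> R; wdx : R -> R; wdy : R -> R;
  rad : nat -> R; freq : nat -> R; phase : nat -> R; prim : nat -> R -> R }.

Section stage.
Context {R : realType}.
Variable D : wiggle R.

Definition hx n t := rad D n * cos (freq D n * t + phase D n).
Definition hy n t := rad D n * sin (freq D n * t + phase D n).
Definition dhx n t := - (rad D n * freq D n) * sin (freq D n * t + phase D n).
Definition dhy n t := rad D n * freq D n * cos (freq D n * t + phase D n).

(** Each helix is translated to vanish at time 0, so that all stages start at the same point. *)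
Definition fx n t := wx D t + \sum_(i < n) (hx i t - hx i 0).
Definition fy n t := wy D t + \sum_(i < n) (hy i t - hy i 0).
Definition dfx n t := wdx D t + \sum_(i < n) dhx i t.
Definition dfy n t := wdy D t + \sum_(i < n) dhy i t.

(* [beat i n] is a primitive of h_n x h_i', so that [psweep m n] is one of h_n x f_m',
   where f_m = (fx m, fy m). *)
Definition beat i n t :=
  rad D i * rad D n * freq D i / (freq D i - freq D n) *
  sin ((freq D i - freq D n) * t + (phase D i - phase D n)).
Definition psweep m n t := prim D n t + \sum_(i < m) beat i n t.
Definition sweep n := psweep n n.

(* Integration by parts of the increment of the vertical velocity that gives
   [stage n] the constant vertical speed [speed n]. *)
Definition lift_step k t :=
  2^-1 * (fx k t * (hy k t + hy k 0) - fy k t * (hx k t + hx k 0))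
  - 2^-1 * (hx k 0 * hy k t - hy k 0 * hx k t) + sweep k t.
Definition fz n t := wz D t + \sum_(k < n) (lift_step k t - lift_step k 0).

Definition speed n := 1 - \sum_(i < n) (2^-1 * rad D i ^+ 2 * freq D i).

Definition stage n t : heis R := (fx n t, fy n t, fz n t).

(** The third coordinate of p^-1 q, hence a left-invariant quantity, antisymmetric in p and q. *)
Definition vdisp (p q : heis R) : R :=
  zc q - zc p - 2^-1 * (xc p * yc q - xc q * yc p).

Lemma fxS n t : fx n.+1 t = fx n t + (hx n t - hx n 0).
Proof. by rewrite /fx big_ord_recr addrA. Qed.
Lemma fyS n t : fy n.+1 t = fy n t + (hy n t - hy n 0).
Proof. by rewrite /fy big_ord_recr addrA. Qed.
Lemma fzS n t : fz n.+1 t = fz n t + (lift_step n t - lift_step n 0).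
Proof. by rewrite /fz big_ord_recr addrA. Qed.
Lemma dfxS n t : dfx n.+1 t = dfx n t + dhx n t.
Proof. by rewrite /dfx big_ord_recr addrA. Qed.
Lemma dfyS n t : dfy n.+1 t = dfy n t + dhy n t.
Proof. by rewrite /dfy big_ord_recr addrA. Qed.
Lemma speedS n : speed n.+1 = speed n - 2^-1 * rad D n ^+ 2 * freq D n.
Proof. by rewrite /speed big_ord_recr opprD addrA. Qed.

Lemma h_norm n t : hx n t ^+ 2 + hy n t ^+ 2 = rad D n ^+ 2.
Proof. by rewrite /hx /hy !exprMn -mulrDr cos2Dsin2 mulr1. Qed.

Lemma stage0 n : stage n 0 = (wx D 0, wy D 0, wz D 0).
Proof.
by rewrite /stage /fx /fy /fz !big1 ?addr0 // => i _; rewrite subrr.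
Qed.

Lemma h_cross n s t : hx n s * hy n t - hx n t * hy n s =
  rad D n ^+ 2 * sin (freq D n * (t - s)).
Proof.
rewrite (_ : freq D n * (t - s) = (freq D n * t + phase D n) - (freq D n * s + phase D n)).
  by rewrite sinB /hx /hy; ring.
by ring.
Qed.

Lemma h_chord n s t : (hx n t - hx n s) ^+ 2 + (hy n t - hy n s) ^+ 2 =
  2 * rad D n ^+ 2 * (1 - cos (freq D n * (t - s))).
Proof.
rewrite (_ : freq D n * (t - s) = (freq D n * t + phase D n) - (freq D n * s + phase D n)).
  have -> : (hx n t - hx n s) ^+ 2 + (hy n t - hy n s) ^+ 2 =
    (hx n t ^+ 2 + hy n t ^+ 2) + (hx n s ^+ 2 + hy n s ^+ 2)
    - 2 * (hx n t * hx n s + hy n t * hy n s) by ring.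
  by rewrite !h_norm cosB /hx /hy; ring.
by ring.
Qed.

(** Three contributions: the chord area of the helix itself, the pairing of the increment of f with
    the helix, and the increment of the swept area. By left invariance no absolute position of f
    survives, only increments over [s, t]. *)
Lemma vdisp_stageS n s t :
  vdisp (stage n.+1 s) (stage n.+1 t) = vdisp (stage n s) (stage n t)
  - 2^-1 * rad D n ^+ 2 * sin (freq D n * (t - s))
  + 2^-1 * ((fx n t - fx n s) * (hy n t + hy n s) -
            (fy n t - fy n s) * (hx n t + hx n s))
  + (sweep n t - sweep n s).
Proof.
rewrite -mulrA -h_cross /vdisp /stage /xc /yc /zc /= !fxS !fyS !fzS /lift_step.
by field.
Qed.

Variable l : R.

Record wiggle_deriv : Prop := WiggleDeriv {
  wdxP : {in `[0, l], forall t, wderiv l (wx D) t (wdx D t)};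
  wdyP : {in `[0, l], forall t, wderiv l (wy D) t (wdy D t)};
  wdzP : {in `[0, l], forall t, wderiv l (wz D) t
            (1 + 2^-1 * (wx D t * wdy D t - wy D t * wdx D t))};
  wprimP : forall n, {in `[0, l], forall t, wderiv l (prim D n) t
            (hx n t * wdy D t - hy n t * wdx D t)};
  freq_neq : forall i n, (i < n)%N -> freq D i != freq D n }.

Hypothesis DD : wiggle_deriv.

Lemma wderiv_hx n t : wderiv l (hx n) t (dhx n t).
Proof.
rewrite /hx /dhx mulNr -mulrN -mulrA mulrN -mulNr.
by apply: wderivZ; exact: wderiv_cos.
Qed.

Lemma wderiv_hy n t : wderiv l (hy n) t (dhy n t).
Proof. by rewrite /hy /dhy -mulrA; apply: wderivZ; exact: wderiv_sin. Qed.

Lemma wderiv_fx n t : t \in `[0, l] -> wderiv l (fx n) t (dfx n t).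
Proof.
move=> tI; apply: wderivD; first exact: wdxP.
apply: (@wderiv_sum _ _ (fun i u => hx i u - hx i 0) dhx) => i _.
rewrite -[dhx i t]addr0; apply: wderivD; first exact: wderiv_hx.
rewrite -oppr0; exact/wderivN/wderiv_cst.
Qed.

Lemma wderiv_fy n t : t \in `[0, l] -> wderiv l (fy n) t (dfy n t).
Proof.
move=> tI; apply: wderivD; first exact: wdyP.
apply: (@wderiv_sum _ _ (fun i u => hy i u - hy i 0) dhy) => i _.
rewrite -[dhy i t]addr0; apply: wderivD; first exact: wderiv_hy.
rewrite -oppr0; exact/wderivN/wderiv_cst.
Qed.

(** The cross product of h_n with h_i' is a cosine at the difference of the two frequencies, which
    is nonzero because i < m <= n. *)
Lemma wderiv_psweep m n t : (m <= n)%N -> t \in `[0, l] ->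
  wderiv l (psweep m n) t (hx n t * dfy m t - hy n t * dfx m t).
Proof.
move=> mn tI.
suff : wderiv l (psweep m n) t ((hx n t * wdy D t - hy n t * wdx D t) +
    \sum_(i < m) (hx n t * dhy i t - hy n t * dhx i t)).
  by congr wderiv; rewrite sumrB -!mulr_sumr /dfx /dfy; ring.
apply: wderivD; first exact: wprimP.
apply: (@wderiv_sum _ _ (fun i => beat i n) (fun i t => hx n t * dhy i t - hy n t * dhx i t)) => i ilt.
suff : wderiv l (beat i n) t (rad D i * rad D n * freq D i / (freq D i - freq D n) *
   ((freq D i - freq D n) * cos ((freq D i - freq D n) * t + (phase D i - phase D n)))).
  congr wderiv; rewrite mulrA divfK ?subr_eq0 ?freq_neq ?(leq_trans ilt) //.
  rewrite (_ : _ + _ = (freq D i * t + phase D i) - (freq D n * t + phase D n)).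
    by rewrite cosB /hx /hy /dhx /dhy; ring.
  by ring.
by apply: wderivZ; exact: wderiv_sin.
Qed.

(** The helix has constant self-area rate: h x h' = r^2 w. Everything else in the derivative is the
    change of (f x f') / 2, which is what a horizontal lift would require. *)
Lemma wderiv_lift_step n t : t \in `[0, l] -> wderiv l (lift_step n) t
  (- (2^-1 * rad D n ^+ 2 * freq D n) +
   2^-1 * (fx n.+1 t * dfy n.+1 t - fy n.+1 t * dfx n.+1 t) -
   2^-1 * (fx n t * dfy n t - fy n t * dfx n t)).
Proof.
move=> tI.
have Hx := @wderiv_hx n t; have Hy := @wderiv_hy n t.
have Fx : wderiv l (fx n) t (dfx n t) by exact: wderiv_fx.
have Fy : wderiv l (fy n) t (dfy n t) by exact: wderiv_fy.
have S : wderiv l (sweep n) t (hx n t * dfy n t - hy n t * dfx n t).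
  exact: wderiv_psweep.
have C (a : R) : wderiv l (fun=> a) t (0 : R) by exact: wderiv_cst.
have S1 : wderiv l (fun t => hx n t + hx n 0) t (dhx n t + 0) by exact: wderivD.
have S2 : wderiv l (fun t => hy n t + hy n 0) t (dhy n t + 0) by exact: wderivD.
suff : wderiv l (lift_step n) t
  (2^-1 * ((dfx n t * (hy n t + hy n 0) + fx n t * (dhy n t + 0)) -
           (dfy n t * (hx n t + hx n 0) + fy n t * (dhx n t + 0)))
   - 2^-1 * (hx n 0 * dhy n t - hy n 0 * dhx n t)
   + (hx n t * dfy n t - hy n t * dfx n t)).
  congr wderiv.
  rewrite -(h_norm n t) !fxS !fyS !dfxS !dfyS -mulrA.
  have -> : (hx n t ^+ 2 + hy n t ^+ 2) * freq D n = hx n t * dhy n t - hy n t * dhx n t.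
    by rewrite /hx /hy /dhx /dhy; ring.
  by field.
apply: wderivD S; apply: wderivD; last apply: wderivN; apply: wderivZ.
  by apply: wderivD; [exact: wderivM|exact/wderivN/wderivM].
by apply: wderivD; [exact: wderivZ|exact/wderivN/wderivZ].
Qed.

(** The left-translated vertical velocity is z' minus half of f x f', so this says that it is
    constantly [speed n] along [stage n]. *)
Lemma wderiv_fz n t : t \in `[0, l] -> wderiv l (fz n) t
  (speed n + 2^-1 * (fx n t * dfy n t - fy n t * dfx n t)).
Proof.
move=> tI; elim: n => [|n IH].
  have := wdzP DD tI; rewrite /fz /fx /fy /dfx /dfy /speed.
  rewrite !big_ord0 subr0 !addr0; apply: wderiv_ext => //.
  by move=> u _; rewrite big_ord0 addr0.
apply: (@wderiv_ext _ _ _ (fun t => fz n t + (lift_step n t - lift_step n 0))) => //.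
  by move=> u _; rewrite fzS.
have -> : speed n.+1 + 2^-1 * (fx n.+1 t * dfy n.+1 t - fy n.+1 t * dfx n.+1 t) =
  speed n + 2^-1 * (fx n t * dfy n t - fy n t * dfx n t) +
  ((- (2^-1 * rad D n ^+ 2 * freq D n) +
   2^-1 * (fx n.+1 t * dfy n.+1 t - fy n.+1 t * dfx n.+1 t) -
   2^-1 * (fx n t * dfy n t - fy n t * dfx n t)) + - 0).
  by rewrite speedS; ring.
apply: wderivD => //; apply: wderivD; first exact: wderiv_lift_step.
exact/wderivN/wderiv_cst.
Qed.

End stage.

(** * Estimates for the stages *)

Lemma cross_le (R : realType) (a1 a2 b1 b2 A B : R) :
  `|a1| <= A -> `|a2| <= A -> `|b1| <= B -> `|b2| <= B ->
  `|a1 * b2 - a2 * b1| <= 2 * (A * B).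
Proof.
move=> h1 h2 h3 h4; apply: le_trans (ler_normB _ _) _; rewrite !normrM.
have -> : 2 * (A * B) = A * B + A * B by ring.
by apply: lerD; apply: ler_pM.
Qed.

Section estimates.
Context {R : realType}.
Variables (D : wiggle R) (l L c q : R).

Definition wfreq n := `|freq D n|.

(** [ws_speed] makes helix n change the speed by a fraction c of itself, up or down according to the
    sign of [freq n]. The radii shrink by a factor between 1/(2q) and 2/q, while the frequencies
    grow by q^2. [ws_L] makes the given curve slow compared with the first helix. *)
Record wiggle_scale : Prop := WiggleScale {
  ws_deriv : wiggle_deriv D l;
  ws_l : 0 < l;
  ws_dx : {in `[0, l], forall t, `|wdx D t| <= L};
  ws_dy : {in `[0, l], forall t, `|wdy D t| <= L};
  ws_c : 0 < c;
  ws_q : 200 <= q;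
  ws_rad : forall n, 0 < rad D n;
  ws_freq : forall n, 0 < wfreq n;
  ws_freqS : forall n, wfreq n.+1 = q ^+ 2 * wfreq n;
  ws_speed : forall n, rad D n ^+ 2 * wfreq n = 2 * c * speed D n;
  ws_radS : forall n, rad D n.+1 <= 2 / q * rad D n;
  ws_radSV : forall n, rad D n <= 2 * q * rad D n.+1;
  ws_L : L <= 4 / q * (rad D 0 * wfreq 0) }.

Hypothesis ws : wiggle_scale.

Let c0 := ws_c ws.
Let q200 := ws_q ws.
Let r0 := ws_rad ws.
Let W0 := ws_freq ws.

Let q0 : 0 < q. Proof. by apply: lt_le_trans q200. Qed.

Lemma speed_gt0 n : 0 < speed D n.
Proof.
have := ws_speed ws n => H.
have : 0 < rad D n ^+ 2 * wfreq n by rewrite mulr_gt0 ?exprn_gt0.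
by rewrite H -mulrA !pmulr_rgt0.
Qed.

Lemma rad_half n : rad D n.+1 <= 2^-1 * rad D n.
Proof.
apply: le_trans (ws_radS ws n) _; rewrite ler_wpM2r ?(ltW (r0 n)) //.
by rewrite ler_pdivrMr //; move: q200; lra.
Qed.

Lemma rad_le m n : (m <= n)%N -> rad D n <= rad D m.
Proof.
move=> /subnK <-; elim: (n - m)%N => // k IH; rewrite addSn.
by have := rad_half (k + m); have := r0 (k + m); lra.
Qed.

Definition Lk n := L + \sum_(i < n) rad D i * wfreq i.

Lemma LkS n : Lk n.+1 = Lk n + rad D n * wfreq n.
Proof. by rewrite /Lk big_ord_recr addrA. Qed.

Lemma L_ge0 : 0 <= L.
Proof.
apply: le_trans (normr_ge0 (wdx D 0)) (ws_dx ws _).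
by rewrite in_itv /= lexx (ltW (ws_l ws)).
Qed.

Lemma Lk_ge0 n : 0 <= Lk n.
Proof.
elim: n => [|n IH]; first by rewrite /Lk big_ord0 addr0 L_ge0.
by rewrite LkS addr_ge0 // mulr_ge0 ?ltW.
Qed.

(** The planar speed r_n W_n of a helix grows at least by the factor q/2 at each step, so the sum of
    all earlier speeds is only O(1/q) of the next one. *)
Lemma Lk_le n : Lk n <= 4 / q * (rad D n * wfreq n).
Proof.
elim: n => [|n IH]; first by rewrite /Lk big_ord0 addr0 (ws_L ws).
rewrite LkS (ws_freqS ws).
have rW : 0 < rad D n * wfreq n by rewrite mulr_gt0.
have h4 : 4 / q <= 1 by rewrite ler_pdivrMr //; move: q200; lra.
have h1 : Lk n + rad D n * wfreq n <= 2 * (rad D n * wfreq n).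
  have := ler_wpM2r (ltW rW) h4; lra.
apply: le_trans h1 _.
have -> : 4 / q * (rad D n.+1 * (q ^+ 2 * wfreq n)) = 2 * ((2 * q * rad D n.+1) * wfreq n).
  by field; rewrite gt_eqF.
by rewrite ler_wpM2l // ler_wpM2r ?(ltW (W0 n)) // (ws_radSV ws).
Qed.

Lemma LkS_le n : Lk n.+1 <= 2 * (rad D n * wfreq n).
Proof.
rewrite LkS; have rW : 0 < rad D n * wfreq n by rewrite mulr_gt0.
have h4 : 4 / q <= 1 by rewrite ler_pdivrMr //; move: q200; lra.
have := ler_wpM2r (ltW rW) h4; have := Lk_le n; lra.
Qed.

Lemma h_le n t : `|hx D n t| <= rad D n /\ `|hy D n t| <= rad D n.
Proof.
rewrite /hx /hy !normrM (gtr0_norm (r0 n)).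
by split; rewrite ler_piMr ?(ltW (r0 n)) // ?cos_max ?sin_max.
Qed.

Lemma dh_le n t : `|dhx D n t| <= rad D n * wfreq n /\ `|dhy D n t| <= rad D n * wfreq n.
Proof.
rewrite /dhx /dhy !normrM normrN normrM (gtr0_norm (r0 n)).
by split; rewrite ler_piMr ?(ltW (mulr_gt0 (r0 n) (W0 n))) // ?cos_max ?sin_max.
Qed.

Lemma df_le n t : t \in `[0, l] -> `|dfx D n t| <= Lk n /\ `|dfy D n t| <= Lk n.
Proof.
move=> tI; elim: n => [|n [IH1 IH2]].
  by rewrite /dfx /dfy /Lk !big_ord0 !addr0; split; [exact: ws_dx|exact: ws_dy].
rewrite dfxS dfyS LkS; have [h1 h2] := dh_le n t.
by split; apply: le_trans (ler_normD _ _) _; apply: lerD.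
Qed.

Section pair.
Variables (s t : R).
Hypotheses (s0 : 0 <= s) (st : s <= t) (tl : t <= l).

Let tau := t - s.
Let tau0 : 0 <= tau. Proof. by rewrite subr_ge0. Qed.

Lemma sub_itv (u : R) : s <= u <= t -> u \in `[0, l].
Proof.
by rewrite in_itv /= => /andP[? ?]; apply/andP; split; [exact: le_trans s0 _|exact: le_trans tl].
Qed.

Lemma f_lip n : `|fx D n t - fx D n s| <= Lk n * tau /\
                `|fy D n t - fy D n s| <= Lk n * tau.
Proof.
split; apply: (wderiv_lip s0 st tl).
- by move=> u uI; exact: (wderiv_fx (ws_deriv ws) uI).
- by move=> u /sub_itv/(df_le n) [].
- by move=> u uI; exact: (wderiv_fy (ws_deriv ws) uI).
- by move=> u /sub_itv/(df_le n) [].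
Qed.

Lemma h_diff_le n : `|hx D n t - hx D n s| <= 2 * rad D n /\
                    `|hy D n t - hy D n s| <= 2 * rad D n.
Proof.
have [? ?] := h_le n t; have [? ?] := h_le n s.
by split; apply: le_trans (ler_normB _ _) _; lra.
Qed.

(** Helix j displaces each coordinate by at most 2 r_j, and halving of the radii gives 2 r_j <= 4
    (r_j - r_(j+1)); the bounds telescope. *)
Lemma f_tail m n : (m <= n)%N ->
  `|(fx D n t - fx D n s) - (fx D m t - fx D m s)| <= 4 * (rad D m - rad D n) /\
  `|(fy D n t - fy D n s) - (fy D m t - fy D m s)| <= 4 * (rad D m - rad D n).
Proof.
move=> /subnK <-; elim: (n - m)%N => [|k]; first by rewrite !subrr normr0 mulr0.
rewrite addSn; set j := (k + m)%N => -[IH1 IH2].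
have [h1 h2] := h_diff_le j; have := rad_half j => h3.
rewrite !fxS !fyS; split.
  have -> : fx D j t + (hx D j t - hx D j 0) - (fx D j s + (hx D j s - hx D j 0)) -
    (fx D m t - fx D m s) = (fx D j t - fx D j s - (fx D m t - fx D m s)) +
    (hx D j t - hx D j s) by ring.
  by apply: le_trans (ler_normD _ _) _; lra.
have -> : fy D j t + (hy D j t - hy D j 0) - (fy D j s + (hy D j s - hy D j 0)) -
  (fy D m t - fy D m s) = (fy D j t - fy D j s - (fy D m t - fy D m s)) +
  (hy D j t - hy D j s) by ring.
by apply: le_trans (ler_normD _ _) _; lra.
Qed.

(** The frequencies at least double, so the difference frequency is at least [wfreq i] in absolute
    value; the amplitude of the beat is then at most r_i r_n. *)
Lemma beat_le i n : (i < n)%N ->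
  `|beat D i n t - beat D i n s| <= 2 * (rad D i * rad D n).
Proof.
move=> i_n; rewrite /beat -mulrBr normrM mulrC.
have Win : 2 * wfreq i <= wfreq n.
  move: i_n => /subnK <-; elim: (n - i.+1)%N => [|k IH].
    rewrite add0n (ws_freqS ws) ler_wpM2r ?(ltW (W0 i)) //.
    by move: q200; nra.
  rewrite addSn (ws_freqS ws); apply: le_trans IH _.
  by rewrite ler_peMl ?(ltW (W0 _)) //; move: q200; nra.
have Wd : wfreq i <= `|freq D i - freq D n|.
  have := lerB_dist (freq D n) (freq D i); rewrite distrC -/(wfreq i) -/(wfreq n) => h.
  lra.
apply: ler_pM => //.
  apply: le_trans (ler_normB _ _) _.
  by have := sin_max ((freq D i - freq D n) * t + (phase D i - phase D n));
     have := sin_max ((freq D i - freq D n) * s + (phase D i - phase D n)); lra.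
rewrite !normrM normfV (gtr0_norm (r0 i)) (gtr0_norm (r0 n)) -!mulrA.
rewrite ler_wpM2l ?(ltW (r0 _)) // ler_piMr ?(ltW (r0 _)) //.
by rewrite ler_pdivrMr ?mul1r // (lt_le_trans (W0 i)).
Qed.

(** The motion of stage m is treated as slow and bounded through its derivative; the helices from m
    to k - 1 are treated as oscillating and bounded through their beats, which telescope. *)
Lemma psweep_le m k n : (m <= k)%N -> (k <= n)%N ->
  `|psweep D k n t - psweep D k n s| <=
  2 * rad D n * Lk m * tau + 4 * rad D n * (rad D m - rad D k).
Proof.
move=> /subnK <-; elim: (k - m)%N => [|j IH].
  rewrite add0n => mn; rewrite subrr mulr0 addr0.
  apply: (wderiv_lip s0 st tl).
    by move=> u uI; exact: (wderiv_psweep (ws_deriv ws) mn uI).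
  move=> u /sub_itv uI.
  have [? ?] := h_le n u; have [? ?] := df_le m uI.
  by rewrite -mulrA; exact: cross_le.
rewrite addSn => jn; have {}IH := IH (ltnW jn); set i := (j + m)%N in IH jn *.
have b := beat_le jn.
rewrite /psweep !big_ord_recr /= -/i !addrA.
rewrite -/(psweep D i n t) -/(psweep D i n s).
have -> : psweep D i n t + beat D i n t - (psweep D i n s + beat D i n s) =
  (psweep D i n t - psweep D i n s) + (beat D i n t - beat D i n s) by ring.
apply: le_trans (ler_normD _ _) _.
have := ler_wpM2l (ltW (r0 n)) (rad_half i); lra.
Qed.

(** The index m is free: helices below m enter through their speed, those from m on through their
    radius. It will be adapted to the time difference. *)
Lemma vdisp_step m n : (m <= n)%N ->
  `|vdisp (stage D n.+1 s) (stage D n.+1 t) - vdisp (stage D n s) (stage D n t)| <=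
  2^-1 * rad D n ^+ 2 * `|sin (freq D n * tau)| +
  rad D n * (4 * (Lk m * tau) + 12 * (rad D m - rad D n)).
Proof.
move=> mn; rewrite vdisp_stageS.
have [l1 l2] := f_lip m; have [t1 t2] := f_tail mn.
have [a1 a2] := h_le n s; have [b1 b2] := h_le n t.
have rmn := rad_le mn; have rn := r0 n.
have fxn : `|fx D n t - fx D n s| <= Lk m * tau + 4 * (rad D m - rad D n).
  have -> : fx D n t - fx D n s = (fx D n t - fx D n s - (fx D m t - fx D m s)) +
    (fx D m t - fx D m s) by ring.
  by apply: le_trans (ler_normD _ _) _; lra.
have fyn : `|fy D n t - fy D n s| <= Lk m * tau + 4 * (rad D m - rad D n).
  have -> : fy D n t - fy D n s = (fy D n t - fy D n s - (fy D m t - fy D m s)) +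
    (fy D m t - fy D m s) by ring.
  by apply: le_trans (ler_normD _ _) _; lra.
have hxs : `|hx D n t + hx D n s| <= 2 * rad D n.
  by apply: le_trans (ler_normD _ _) _; lra.
have hys : `|hy D n t + hy D n s| <= 2 * rad D n.
  by apply: le_trans (ler_normD _ _) _; lra.
have C := cross_le fxn fyn hxs hys.
have S := psweep_le mn (leqnn n); rewrite -/(sweep D n) in S.
rewrite -/tau; set X := _ - _ * (hx D n t + _) in C *; set Y := sweep D n t - _ in S *.
set Z := sin _; set z := vdisp _ _.
have -> : z - 2^-1 * rad D n ^+ 2 * Z + 2^-1 * X + Y - z =
  - (2^-1 * rad D n ^+ 2 * Z) + 2^-1 * X + Y by ring.
apply: le_trans (ler_normD _ _) _.
apply: le_trans (lerD (ler_normD _ _) (lexx _)) _.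
have r2 : 0 <= 2^-1 * rad D n ^+ 2 by rewrite mulr_ge0 ?sqr_ge0.
rewrite normrN normrM (ger0_norm r2) [ `|2^-1 * X| ]normrM (ger0_norm (_ : 0 <= 2^-1 :> R)) //.
rewrite -!addrA lerD2l; move: C S; lra.
Qed.

Lemma vdisp_step_le m n : (m <= n)%N ->
  `|vdisp (stage D n.+1 s) (stage D n.+1 t) - vdisp (stage D n s) (stage D n t)| <=
  rad D n * (4 * (Lk m * tau) + 25 / 2 * rad D m).
Proof.
move=> mn; apply: le_trans (vdisp_step mn) _.
have rmn := rad_le mn; have rn := r0 n.
have h : 2^-1 * rad D n ^+ 2 * `|sin (freq D n * tau)| <= 2^-1 * rad D n ^+ 2.
  by rewrite ler_piMr ?sin_max // mulr_ge0 ?sqr_ge0.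
have := ler_wpM2l (ltW rn) rmn; have := mulr_ge0 (ltW rn) (ltW rn).
move: h; rewrite expr2; lra.
Qed.

(* When the speed grows, [rad j * Lk j] does not tend to 0; the bound through an
   earlier stage [m] is the one that makes the stages converge. *)
Lemma vdisp_tail3 m j n : (m <= j)%N -> (j <= n)%N ->
  `|vdisp (stage D n s) (stage D n t) - vdisp (stage D j s) (stage D j t)| <=
  2 * (rad D j - rad D n) * (4 * (Lk m * tau) + 25 / 2 * rad D m).
Proof.
move=> mj /subnK <-; elim: (n - j)%N => [|k].
  by rewrite !subrr normr0 mulr0 mul0r.
rewrite addSn; set i := (k + j)%N => IH.
have S := vdisp_step_le (leq_trans mj (leq_addl k j)); rewrite -/i in S.
set B := 4 * (Lk m * tau) + 25 / 2 * rad D m in IH S *.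
have B0 : 0 <= B by rewrite addr_ge0 ?mulr_ge0 ?Lk_ge0 ?(ltW (r0 _)).
rewrite -(subrKA (vdisp (stage D i s) (stage D i t))).
apply: le_trans (ler_normD _ _) _; apply: le_trans (lerD S IH) _.
have := ler_wpM2r B0 (rad_half i); lra.
Qed.

Lemma vdisp_tail m n : (m <= n)%N ->
  `|vdisp (stage D n s) (stage D n t) - vdisp (stage D m s) (stage D m t)| <=
  2 * (rad D m - rad D n) * (4 * (Lk m * tau) + 25 / 2 * rad D m).
Proof. exact: vdisp_tail3. Qed.

(** As a function of the second time u, the vertical displacement from time s has derivative
    [speed n] plus half of (f(u) - f(s)) x f'(u), and the latter is at most L^2 tau. *)
Lemma vdisp_taylor n :
  `|vdisp (stage D n s) (stage D n t) - speed D n * tau| <= Lk n ^+ 2 * tau ^+ 2.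
Proof.
have -> : vdisp (stage D n s) (stage D n t) - speed D n * tau =
  (fz D n t - 2^-1 * (fx D n s * fy D n t - fy D n s * fx D n t) - speed D n * t) -
  (fz D n s - 2^-1 * (fx D n s * fy D n s - fy D n s * fx D n s) - speed D n * s).
  by rewrite /vdisp /stage /tau /xc /yc /zc /=; ring.
pose df u := (speed D n + 2^-1 * (fx D n u * dfy D n u - fy D n u * dfx D n u)) -
  2^-1 * (fx D n s * dfy D n u - fy D n s * dfx D n u) - speed D n * 1.
rewrite expr2 -/tau expr2 mulrA.
apply: (@wderiv_lip _ _ (fun u => fz D n u - 2^-1 * (fx D n s * fy D n u - fy D n s * fx D n u) - speed D n * u) df _ _ _ s0 st tl).
  move=> u uI; rewrite /df.
  have Dx : wderiv l (fx D n) u (dfx D n u) by exact: (wderiv_fx (ws_deriv ws)).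
  have Dy : wderiv l (fy D n) u (dfy D n u) by exact: (wderiv_fy (ws_deriv ws)).
  apply: wderivD; last by apply: wderivN; apply: wderivZ; exact: wderiv_id.
  apply: wderivD; first exact: (wderiv_fz (ws_deriv ws)).
  apply: wderivN; apply: wderivZ; apply: wderivD; first exact: wderivZ.
  by apply: wderivN; apply: wderivZ.
move=> u /[dup] /sub_itv uI /andP[su ut].
have [d1 d2] := df_le n uI.
have ul : u <= l by exact: le_trans tl.
have -> : df u = 2^-1 * ((fx D n u - fx D n s) * dfy D n u - (fy D n u - fy D n s) * dfx D n u).
  by rewrite /df; field.
have lip (f : R -> R) (f' : R -> R) : {in `[0, l], forall v, wderiv l f v (f' v)} ->
  (forall v, v \in `[0, l] -> `|f' v| <= Lk n) -> `|f u - f s| <= Lk n * tau.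
  move=> ff fL; apply: le_trans (wderiv_lip s0 su ul ff _) _.
    by move=> v /andP[sv vu]; apply: fL; apply: sub_itv; rewrite sv; exact: le_trans ut.
  by rewrite ler_wpM2l ?Lk_ge0 // /tau lerD2r.
have X : `|fx D n u - fx D n s| <= Lk n * tau.
  apply: (lip _ (dfx D n)); first by move=> v; exact: (wderiv_fx (ws_deriv ws)).
  by move=> v /(df_le n) [].
have Y : `|fy D n u - fy D n s| <= Lk n * tau.
  apply: (lip _ (dfy D n)); first by move=> v; exact: (wderiv_fy (ws_deriv ws)).
  by move=> v /(df_le n) [].
rewrite normrM ger0_norm //.
have := cross_le X Y d1 d2; lra.
Qed.

End pair.
End estimates.

(** * Time differences compared with the helix frequencies *)

Lemma sin_cos_le (R : realType) (x : R) : `|sin x| <= `|x| /\ 1 - cos x <= `|x|.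
Proof.
wlog x0 : x / 0 <= x.
  move=> H; have [x0|x0] := leP 0 x; first exact: H.
  by have := H (- x); rewrite sinN cosN !normrN; apply; rewrite oppr_ge0 ltW.
rewrite (ger0_norm x0); move: x0; rewrite le_eqVlt => /predU1P[<-|x0].
  by rewrite sin0 cos0 normr0 subrr.
have c1 (u : R) : `|1 * cos (1 * u + 0)| <= 1 by rewrite mul1r cos_max.
have s1 (u : R) : `|- 1 * sin (1 * u + 0)| <= 1.
  by rewrite mulN1r normrN sin_max.
split.
  have := @wderiv_lip R x _ _ 1 0 x (lexx 0) (ltW x0) (lexx x)
    (fun t _ => @wderiv_sin R x 1 0 t) (fun u _ => c1 u).
  by rewrite !addr0 mulr0 sin0 !subr0 !mul1r.
have := @wderiv_lip R x _ _ 1 0 x (lexx 0) (ltW x0) (lexx x)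
  (fun t _ => @wderiv_cos R x 1 0 t) (fun u _ => s1 u).
rewrite !addr0 mulr0 cos0 !subr0 !mul1r ler_norml; lra.
Qed.

Section scales.
Context {R : realType}.
Variables (D : wiggle R) (l L c q : R).
Hypothesis ws : wiggle_scale D l L c q.

Let c0 := ws_c ws.
Let q200 := ws_q ws.
Let r0 := ws_rad ws.
Let W0 := ws_freq ws.
Let q0 : 0 < q. Proof. by apply: lt_le_trans q200. Qed.

Variables (s t : R).
Hypotheses (s0 : 0 <= s) (st : s <= t) (tl : t <= l).
Local Notation tau := (t - s).
Let tau0 : 0 <= tau. Proof. by rewrite subr_ge0. Qed.

Let qi_le : q^-1 <= 200^-1.
Proof. by rewrite lef_pV2 ?posrE. Qed.
Let qi_gt0 : 0 < q^-1. Proof. by rewrite invr_gt0. Qed.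

(** The main term is speed * tau = r^2 theta / (2c). Helix k itself costs at most r^2 theta / 2; the
    later helices, the slower motion and the Taylor error cost 132, 16 and 16 times r^2 theta / q,
    together less than r^2 theta because q >= 200. The lower end of the window turns r^2 / q into at
    most r^2 theta, the upper end turns theta / q into at most 1. *)
Lemma scale_vdisp k n : (k < n)%N -> q^-1 <= wfreq D k * tau <= q ->
  rad D k ^+ 2 * (wfreq D k * tau) * ((2 * c)^-1 - 3 / 2) <=
  vdisp (stage D n s) (stage D n t).
Proof.
move=> kn /andP[th1 th2]; set th := wfreq D k * tau in th1 th2 *.
set r := rad D k; have rk : 0 < r := r0 k.
have th0 : 0 < th by apply: lt_le_trans th1.
have Lt : Lk D L k * tau <= 4 * q^-1 * (r * th).
  by apply: le_trans (ler_wpM2r tau0 (Lk_le ws k)) _; rewrite /th /r !mulrA.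
have Lt1 : Lk D L k.+1 * tau <= 2 * (r * th).
  by apply: le_trans (ler_wpM2r tau0 (LkS_le ws k)) _; rewrite /th /r !mulrA.
have L0 : 0 <= Lk D L k * tau by rewrite mulr_ge0 // (Lk_ge0 ws).
have L1 : 0 <= Lk D L k.+1 * tau by rewrite mulr_ge0 // (Lk_ge0 ws).
have r1 : rad D k.+1 <= 2 * q^-1 * r := ws_radS ws k.
have r1p := r0 k.+1; have rnp := r0 n.
have r1' : rad D k.+1 <= 2^-1 * r := rad_half ws k.
have T1 := vdisp_tail ws s0 st tl kn.
have S := vdisp_step ws s0 st tl (leqnn k).
have T2 := vdisp_taylor ws s0 st tl k.
have E : speed D k * tau = r ^+ 2 * th * (2 * c)^-1.
  have -> : speed D k = r ^+ 2 * wfreq D k * (2 * c)^-1.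
    by rewrite /r (ws_speed ws) mulrC mulKf // gt_eqF // mulr_gt0.
  by rewrite /th; ring.
have uth : q^-1 * th <= 1 by rewrite mulrC ler_pdivrMr ?mul1r.
have [sn _] := sin_cos_le (freq D k * tau).
have {}sn : `|sin (freq D k * tau)| <= th.
  by move: sn; rewrite normrM (ger0_norm tau0).
rewrite subrr mulr0 addr0 in S.
have r2 : 0 <= r ^+ 2 := sqr_ge0 r.
have u0 : 0 <= q^-1 := ltW qi_gt0.
have X0 : 0 <= q^-1 * (r ^+ 2 * th) by rewrite !mulr_ge0 // ltW.
have {T1} B1 : `|vdisp (stage D n s) (stage D n t) -
    vdisp (stage D k.+1 s) (stage D k.+1 t)| <= 132 * (q^-1 * (r ^+ 2 * th)).
  apply: le_trans T1 _.
  have h1 : 2 * (rad D k.+1 - rad D n) <= 4 * q^-1 * r by lra.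
  have h2 : 4 * (Lk D L k.+1 * tau) + 25 / 2 * rad D k.+1 <= 8 * (r * th) + 25 * (q^-1 * r) by lra.
  have h3 : 0 <= rad D k.+1 - rad D n by rewrite subr_ge0 (rad_le ws).
  apply: le_trans (ler_pM _ _ h1 h2) _.
  - by rewrite mulr_ge0.
  - by move: L1 r1p; lra.
  have : q^-1 * r ^+ 2 * q^-1 <= q^-1 * r ^+ 2 * th by rewrite ler_wpM2l // mulr_ge0.
  rewrite !expr2; lra.
have {S} B2 : `|vdisp (stage D k.+1 s) (stage D k.+1 t) -
    vdisp (stage D k s) (stage D k t)| <= 2^-1 * (r ^+ 2 * th) + 16 * (q^-1 * (r ^+ 2 * th)).
  apply: le_trans S _; rewrite -/r.
  have := ler_wpM2l r2 sn; have := ler_wpM2l (ltW rk) Lt.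
  rewrite !expr2; lra.
have {T2} B3 : `|vdisp (stage D k s) (stage D k t) - speed D k * tau| <= 16 * (q^-1 * (r ^+ 2 * th)).
  apply: le_trans T2 _; rewrite -exprMn.
  have : (Lk D L k * tau) ^+ 2 <= (4 * q^-1 * (r * th)) ^+ 2.
    by rewrite ler_sqr ?nnegrE // !mulr_ge0 // ltW.
  have := ler_wpM2r X0 uth.
  rewrite !expr2; lra.
have : q^-1 * (r ^+ 2 * th) <= 200^-1 * (r ^+ 2 * th).
  by rewrite ler_wpM2r // mulr_ge0 // ltW.
have rth : 0 <= r ^+ 2 * th by rewrite mulr_ge0 // ltW.
move: B1 B2 B3; rewrite E !ler_norml; lra.
Qed.

(** The squared chord of helix k is 2 r^2 (1 - cos) <= 2 r^2 theta, doubled when the error A is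
    split off. The error terms add 4 A^2 <= 640 r^2 theta / q, which is below 4 r^2 theta. *)
Lemma scale_planar k n : (k < n)%N -> q^-1 <= wfreq D k * tau <= q ->
  (fx D n t - fx D n s) ^+ 2 + (fy D n t - fy D n s) ^+ 2 <=
  8 * (rad D k ^+ 2 * (wfreq D k * tau)).
Proof.
move=> kn /andP[th1 th2]; set th := wfreq D k * tau in th1 th2 *.
set r := rad D k; have rk : 0 < r := r0 k.
have th0 : 0 < th by apply: lt_le_trans th1.
have Lt : Lk D L k * tau <= 4 * q^-1 * (r * th).
  by apply: le_trans (ler_wpM2r tau0 (Lk_le ws k)) _; rewrite /th /r !mulrA.
have L0 : 0 <= Lk D L k * tau by rewrite mulr_ge0 // (Lk_ge0 ws).
have r1 : rad D k.+1 <= 2 * q^-1 * r := ws_radS ws k.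
have r1p := r0 k.+1; have rnp := r0 n.
have [t1 t2] := f_tail ws s t kn.
have [l1 l2] := f_lip ws s0 st tl k.
have ch := h_chord D k s t.
have [_ cs] := sin_cos_le (freq D k * tau).
rewrite normrM (ger0_norm tau0) -/(wfreq D k) -/th in cs.
pose A := 4 * q^-1 * (r * th) + 8 * q^-1 * r.
have xk : `|fx D n t - fx D n s - (hx D k t - hx D k s)| <= A.
  have -> : fx D n t - fx D n s - (hx D k t - hx D k s) =
    (fx D n t - fx D n s - (fx D k.+1 t - fx D k.+1 s)) + (fx D k t - fx D k s).
    by rewrite !fxS; ring.
  by apply: le_trans (ler_normD _ _) _; rewrite /A; lra.
have yk : `|fy D n t - fy D n s - (hy D k t - hy D k s)| <= A.
  have -> : fy D n t - fy D n s - (hy D k t - hy D k s) =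
    (fy D n t - fy D n s - (fy D k.+1 t - fy D k.+1 s)) + (fy D k t - fy D k s).
    by rewrite !fyS; ring.
  by apply: le_trans (ler_normD _ _) _; rewrite /A; lra.
have sq (a b : R) : `|a - b| <= A -> a ^+ 2 <= 2 * b ^+ 2 + 2 * A ^+ 2.
  move=> h; have : (a - b) ^+ 2 <= A ^+ 2.
    rewrite -[(a - b) ^+ 2]real_normK ?num_real // ler_sqr ?nnegrE //.
    exact: le_trans h.
  by have := sqr_ge0 (a - 2 * b); rewrite !expr2; lra.
have r2 : 0 <= r ^+ 2 := sqr_ge0 r.
have u0 : 0 <= q^-1 := ltW qi_gt0.
have X0 : 0 <= q^-1 * (r ^+ 2 * th) by rewrite !mulr_ge0 // ltW.
have uth : q^-1 * th <= 1 by rewrite mulrC ler_pdivrMr ?mul1r.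
have A2 : A ^+ 2 <= 160 * (q^-1 * (r ^+ 2 * th)).
  have a1 : (4 * q^-1 * (r * th)) ^+ 2 <= 16 * (q^-1 * (r ^+ 2 * th)).
    have := ler_wpM2r X0 uth; rewrite !expr2; lra.
  have a2 : (8 * q^-1 * r) ^+ 2 <= 64 * (q^-1 * (r ^+ 2 * th)).
    have : q^-1 * r ^+ 2 * q^-1 <= q^-1 * r ^+ 2 * th by rewrite ler_wpM2l // mulr_ge0.
    rewrite !expr2; lra.
  have := sqr_ge0 (4 * q^-1 * (r * th) - 8 * q^-1 * r).
  move: a1 a2; rewrite /A !expr2; lra.
have : q^-1 * (r ^+ 2 * th) <= 200^-1 * (r ^+ 2 * th).
  by rewrite ler_wpM2r // mulr_ge0 // ltW.
have := ler_wpM2l r2 cs.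
have := sq _ _ xk; have := sq _ _ yk.
rewrite -/r in ch; move: ch A2; rewrite !expr2; lra.
Qed.

(** Below the last scale the stage is almost a vertical line: its planar motion is at most 4/q times
    that of the current helix, and r^2 W = 2 c speed converts the square into a small multiple of
    the vertical displacement. *)
Lemma final_planar_sq n : wfreq D n * tau <= q ->
  Lk D L n ^+ 2 * tau ^+ 2 <= 32 * c / q * (speed D n * tau).
Proof.
move=> th2; rewrite -exprMn.
have L0 : 0 <= Lk D L n * tau by rewrite mulr_ge0 // (Lk_ge0 ws).
have Lt : Lk D L n * tau <= 4 * q^-1 * (rad D n * (wfreq D n * tau)).
  by apply: le_trans (ler_wpM2r tau0 (Lk_le ws n)) _; rewrite !mulrA.
have th0 : 0 <= wfreq D n * tau by rewrite mulr_ge0 // ltW.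
have h1 : (Lk D L n * tau) ^+ 2 <= (4 * q^-1 * (rad D n * (wfreq D n * tau))) ^+ 2.
  by rewrite ler_sqr ?nnegrE // !mulr_ge0 // ltW.
apply: le_trans h1 _.
have -> : (4 * q^-1 * (rad D n * (wfreq D n * tau))) ^+ 2 =
  32 * c * q^-1 * (q^-1 * (wfreq D n * tau)) * (speed D n * tau).
  have -> : (4 * q^-1 * (rad D n * (wfreq D n * tau))) ^+ 2 =
    16 * q^-1 ^+ 2 * (rad D n ^+ 2 * wfreq D n) * (wfreq D n * tau) * tau by ring.
  by rewrite (ws_speed ws); ring.
have sp : 0 <= speed D n * tau by rewrite mulr_ge0 // ltW // (speed_gt0 ws).
rewrite ler_wpM2r // ler_piMr //; first by rewrite !mulr_ge0 // ltW.
by rewrite mulrC ler_pdivrMr ?mul1r.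
Qed.

Lemma final_vdisp n : wfreq D n * tau <= q ->
  (1 - 32 * c / q) * (speed D n * tau) <= vdisp (stage D n s) (stage D n t).
Proof.
move=> /final_planar_sq h; have := vdisp_taylor ws s0 st tl n.
rewrite ler_norml; lra.
Qed.

Lemma final_planar n : wfreq D n * tau <= q ->
  (fx D n t - fx D n s) ^+ 2 + (fy D n t - fy D n s) ^+ 2 <=
  64 * c / q * (speed D n * tau).
Proof.
move=> /final_planar_sq; rewrite -exprMn => h.
have [l1 l2] := f_lip ws s0 st tl n.
have sq (a : R) : `|a| <= Lk D L n * tau -> a ^+ 2 <= (Lk D L n * tau) ^+ 2.
  move=> ha; rewrite -[a ^+ 2]real_normK ?num_real // ler_sqr ?nnegrE //.
  exact: le_trans ha.
have := sq _ l1; have := sq _ l2; lra.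
Qed.

(** The windows from 1/(q W_k) to q/W_k are adjacent because W_(k+1) = q^2 W_k: leaving one at the
    bottom means entering the next at the top. *)
Lemma scale_cases n :
  [\/ q < wfreq D 0 * tau,
      exists2 k, (k < n)%N & q^-1 <= wfreq D k * tau <= q |
      wfreq D n * tau <= q].
Proof.
elim: n => [|n IH].
  by have [h|h] := leP (wfreq D 0 * tau) q; [constructor 3|constructor 1].
have [h|h] := leP (wfreq D n.+1 * tau) q; first by constructor 3.
have h' : q^-1 <= wfreq D n * tau.
  move: h; rewrite (ws_freqS ws).
  rewrite (_ : q ^+ 2 * _ * _ = q * (q * (wfreq D n * tau))); last by ring.
  rewrite ltr_pMr // => h.
  by rewrite -[_^-1]mulr1 ler_pdivrMl // ltW.
case: IH => [?|[k kn ?]|h2]; first by constructor 1.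
  by constructor 2; exists k => //; exact: ltnW.
by constructor 2; exists n => //; rewrite h'.
Qed.

End scales.

(** * Verticality of the stages *)

Section linear_lower_bound.
Context {R : realType}.
Variables (F : R -> heis R) (l v B lam : R).
Hypotheses (l0 : 0 < l) (v0 : 0 < v) (B0 : 0 <= B) (lam0 : 0 < lam).
Hypothesis taylor : forall s t : R, 0 <= s -> s <= t -> t <= l ->
  `|vdisp (F s) (F t) - v * (t - s)| <= B ^+ 2 * (t - s) ^+ 2.
Hypothesis lip : forall s t : R, 0 <= s -> s <= t -> t <= l ->
  `|xc (F t) - xc (F s)| <= B * (t - s) /\ `|yc (F t) - yc (F s)| <= B * (t - s).
Hypothesis vert : forall s t : R, 0 <= s -> s < t -> t <= l ->
  lam * ((xc (F t) - xc (F s)) ^+ 2 + (yc (F t) - yc (F s)) ^+ 2) <= vdisp (F s) (F t).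
Hypothesis pos : forall s t : R, 0 <= s -> s < t -> t <= l -> 0 < vdisp (F s) (F t).

(* If [vdisp (F s) (F t)] were tiny then so would be the horizontal displacement,
   by verticality, and moving [t] back by a fixed amount would make the vertical
   displacement negative. *)
Lemma vdisp_linear_lower : exists2 kap : R, 0 < kap &
  forall s t : R, 0 <= s -> s <= t -> t <= l -> kap * (t - s) <= vdisp (F s) (F t).
Proof.
(* Over times up to e the quadratic error costs at most an eighth of the speed. *)
pose e := Num.min l (v / (8 * (B ^+ 2 + 1))).
have B2 : 0 < B ^+ 2 + 1 by rewrite ltr_pwDr // sqr_ge0.
have e0 : 0 < e by rewrite lt_min l0 divr_gt0 // mulr_gt0.
have el : e <= l by rewrite ge_min lexx.
have Be : B ^+ 2 * e <= v / 8.
  have : e <= v / (8 * (B ^+ 2 + 1)) by rewrite ge_min lexx orbT.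
  rewrite ler_pdivlMr ?mulr_gt0 // => h; rewrite ler_pdivlMr //.
  by apply: le_trans h; have := ltW e0; have := mulr_ge0 (ltW e0) (sqr_ge0 B); lra.
clearbody e.
(* If the planar displacement is at most M1, the area term caused by a step of length e is at most v
   e / 8. *)
pose M1 := v / (8 * (B + 1)).
have B1 : 0 < B + 1 by rewrite ltr_pwDr.
have M10 : 0 < M1 by rewrite divr_gt0 // mulr_gt0.
have M1B : M1 * B <= v / 8.
  have : M1 * (8 * (B + 1)) = v by rewrite /M1 divfK // gt_eqF // mulr_gt0.
  rewrite ler_pdivlMr //; move: M10; lra.
clearbody M1.
(* The first bound confines the planar displacement to M1. The second is what remains of the last
   step: 7/8 v e minus an area term of at most v e / 8. *)
pose mu := Num.min (lam * M1 ^+ 2) (6 / 8 * v * e).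
have mu0 : 0 < mu by rewrite lt_min !mulr_gt0 // ?divr_gt0 // exprn_gt0.
have mu1 : mu <= lam * M1 ^+ 2 by rewrite ge_min lexx.
have mu2 : mu <= 6 / 8 * v * e by rewrite ge_min lexx orbT.
clearbody mu.
have small (s t : R) : 0 <= s -> s <= t -> t <= l -> t - s <= e ->
    7 / 8 * v * (t - s) <= vdisp (F s) (F t).
  move=> s0 st tl te; have := taylor s0 st tl; rewrite ler_norml.
  have ts : 0 <= t - s by rewrite subr_ge0.
  have : B ^+ 2 * (t - s) ^+ 2 <= v / 8 * (t - s).
    rewrite expr2 mulrA ler_wpM2r //; apply: le_trans Be.
    by rewrite ler_wpM2l // sqr_ge0.
  lra.
have large (s t : R) : 0 <= s -> t <= l -> e < t - s -> mu <= vdisp (F s) (F t).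
  move=> s0 tl te; rewrite leNgt; apply/negP => zmu.
  have st : s < t by lra.
  have te' : t - e <= t by lra.
  have te0 : 0 <= t - e by lra.
  have ste : s < t - e by lra.
  have tel : t - e <= l by lra.
  have ee : t - (t - e) <= e by lra.
  have p := pos s0 ste tel.
  have sm := small _ _ te0 te' tl ee.
  have [lx ly] := lip te0 te' tl.
  have vt := vert s0 st tl.
  have M2 : (xc (F t) - xc (F s)) ^+ 2 + (yc (F t) - yc (F s)) ^+ 2 <= M1 ^+ 2.
    rewrite -(ler_pM2l lam0); apply: le_trans vt _; apply: ltW.
    exact: lt_le_trans mu1.
  have absle (a b : R) : a ^+ 2 + b ^+ 2 <= M1 ^+ 2 -> `|a| <= M1.
    move=> h; rewrite -ler_sqr ?nnegrE ?(ltW M10) // real_normK ?num_real //.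
    by apply: le_trans h; rewrite lerDl sqr_ge0.
  have Mx := absle _ _ M2; rewrite addrC in M2; have My := absle _ _ M2.
  have E : t - (t - e) = e by ring.
  rewrite E in lx ly sm.
  have C := cross_le Mx My lx ly.
  (* Vertical displacements add up along [s, t - e] and [t - e, t] except for the area of the planar
     triangle. *)
  have id : vdisp (F s) (F t) = vdisp (F s) (F (t - e)) + vdisp (F (t - e)) (F t) +
    2^-1 * ((xc (F t) - xc (F s)) * (yc (F t) - yc (F (t - e))) -
            (yc (F t) - yc (F s)) * (xc (F t) - xc (F (t - e)))).
    by rewrite /vdisp; field.
  have : M1 * B * e <= v / 8 * e by rewrite ler_wpM2r // ltW.
  move: C; rewrite ler_norml => /andP[C1 C2].
  have ve : 0 < v * e by rewrite mulr_gt0.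
  lra.
exists (Num.min (7 / 8 * v) (mu / l)).
  by rewrite lt_min !mulr_gt0 // ?invr_gt0.
move=> s t s0 st tl; have ts : 0 <= t - s by rewrite subr_ge0.
have [te|te] := leP (t - s) e.
  apply: le_trans (small _ _ s0 st tl te); rewrite ler_wpM2r //.
  by rewrite ge_min lexx.
apply: le_trans (large _ _ s0 tl te).
apply: (@le_trans _ _ (mu / l * (t - s))).
  by rewrite ler_wpM2r // ge_min lexx orbT.
rewrite -mulrA ler_piMr ?(ltW mu0) // mulrC ler_pdivrMr // mul1r; lra.
Qed.

End linear_lower_bound.

Section base_positive.
Context {R : realType}.
Variables (F : R -> heis R) (l v B : R).
Hypotheses (v0 : 0 < v).
Hypothesis taylor : forall s t : R, 0 <= s -> s <= t -> t <= l ->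
  `|vdisp (F s) (F t) - v * (t - s)| <= B ^+ 2 * (t - s) ^+ 2.
Hypothesis cont : forall s : R, {within `[0, l], continuous (fun u => vdisp (F s) (F u))}.
Hypothesis neq0 : forall s t : R, 0 <= s -> s < t -> t <= l -> vdisp (F s) (F t) != 0.

(** The displacement is positive shortly after s by the Taylor bound and never vanishes, so the
    intermediate value theorem excludes a later change of sign. *)
Lemma vdisp_gt0_of_neq0 (s t : R) : 0 <= s -> s < t -> t <= l -> 0 < vdisp (F s) (F t).
Proof.
move=> s0 st tl.
pose e := Num.min (t - s) (v / (2 * (B ^+ 2 + 1))).
have B2 : 0 < B ^+ 2 + 1 by rewrite ltr_pwDr // sqr_ge0.
have e0 : 0 < e by rewrite lt_min subr_gt0 st divr_gt0 // mulr_gt0.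
have et : e <= t - s by rewrite ge_min lexx.
have Be : B ^+ 2 * e <= v / 2.
  have : e <= v / (2 * (B ^+ 2 + 1)) by rewrite ge_min lexx orbT.
  rewrite ler_pdivlMr ?mulr_gt0 // => h; rewrite ler_pdivlMr //.
  by apply: le_trans h; have := ltW e0; have := mulr_ge0 (ltW e0) (sqr_ge0 B); lra.
clearbody e.
have se : s <= s + e by lra.
have sel : s + e <= l by lra.
have p : 0 < vdisp (F s) (F (s + e)).
  have := taylor s0 se sel; have -> : s + e - s = e by ring.
  rewrite ler_norml; have : B ^+ 2 * e ^+ 2 <= v / 2 * e.
    by rewrite expr2 mulrA ler_wpM2r // ltW.
  have : 0 < v * e by rewrite mulr_gt0.
  lra.
rewrite lt_neqAle eq_sym neq0 //= leNgt; apply/negP => neg.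
have set_ : s + e <= t by lra.
have [||c cI c0] := @IVT R (fun u => vdisp (F s) (F u)) (s + e) t 0 set_.
- apply: (continuous_subspaceW _ (cont (s:=s))) => u /=; rewrite !in_itv /=; lra.
- by apply/andP; split; [rewrite ge_min (ltW neg) orbT|rewrite le_max (ltW p)].
- move: cI; rewrite in_itv /= => /andP[c1 c2].
  have sc : s < c by apply: lt_le_trans c1; lra.
  have cl : c <= l by exact: le_trans tl.
  by have := neq0 s0 sc cl; rewrite c0 eqxx.
Qed.

End base_positive.

Section vertical_stage.
Context {R : realType}.
Variables (D : wiggle R) (l L c q lam lam' kap : R).
Hypothesis ws : wiggle_scale D l L c q.
Hypotheses (lam0 : 0 < lam) (lam'0 : 0 < lam') (lamlt : lam' < lam) (kap0 : 0 < kap).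
Hypothesis vert0 : forall s t : R, 0 <= s -> s <= t -> t <= l ->
  lam * ((wx D t - wx D s) ^+ 2 + (wy D t - wy D s) ^+ 2) <=
  vdisp (stage D 0 s) (stage D 0 t).
Hypothesis lin0 : forall s t : R, 0 <= s -> s <= t -> t <= l ->
  kap * (t - s) <= vdisp (stage D 0 s) (stage D 0 t).
Hypothesis c_lam : 8 * lam' + 1 <= (2 * c)^-1 - 3 / 2.
Hypothesis q_lam : c / (q * kap) * (114 + 64 * lam' * (1 + 2 * lam' / (lam - lam'))) <=
  (lam - lam') / (2 * lam).

Let c0 := ws_c ws.
Let q200 := ws_q ws.
Let r0 := ws_rad ws.
Let W0 := ws_freq ws.
Let q0 : 0 < q. Proof. by apply: lt_le_trans q200. Qed.

Lemma c_le : 2 * c * (8 * lam' + 5 / 2) <= 1.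
Proof.
by rewrite mulrC -ler_pdivlMr ?mulr_gt0 // div1r; move: c_lam; lra.
Qed.

Variables (s t : R).
Hypotheses (s0 : 0 <= s) (st : s <= t) (tl : t <= l).
Local Notation tau := (t - s).
Let tau0 : 0 <= tau. Proof. by rewrite subr_ge0. Qed.

(** The initial speed is 1, so r_0^2 = 2c / W_0, which is below 2 c tau / q at these times. *)
Lemma large_bound : q < wfreq D 0 * tau ->
  rad D 0 ^+ 2 <= 2 * (c / q * tau) /\ rad D 0 * (Lk D L 0 * tau) <= 8 * (c / q * tau).
Proof.
move=> h.
have E := ws_speed ws 0; rewrite /speed big_ord0 subr0 mulr1 in E.
split.
  rewrite -(ler_pM2r (W0 0)) E.
  have -> : 2 * (c / q * tau) * wfreq D 0 = 2 * c * (q^-1 * (wfreq D 0 * tau)) by ring.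
  by rewrite ler_peMr ?mulr_ge0 ?(ltW c0) // ler_pdivlMl // mulr1 ltW.
rewrite mulrA; apply: le_trans (ler_wpM2r tau0 (ler_wpM2l (ltW (r0 0)) (Lk_le ws 0))) _.
have -> : rad D 0 * (4 / q * (rad D 0 * wfreq D 0)) = 4 / q * (rad D 0 ^+ 2 * wfreq D 0) by ring.
by rewrite E le_eqVlt; apply/orP; left; apply/eqP; ring.
Qed.

Lemma vdisp_tail0 n : `|vdisp (stage D n s) (stage D n t) - vdisp (stage D 0 s) (stage D 0 t)| <=
  8 * (rad D 0 * (Lk D L 0 * tau)) + 25 * rad D 0 ^+ 2.
Proof.
apply: le_trans (vdisp_tail ws s0 st tl (leq0n n)) _.
have h := r0 n; have h0 := r0 0.
have L0 : 0 <= Lk D L 0 * tau by rewrite mulr_ge0 // (Lk_ge0 ws).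
have : 0 <= rad D n * (4 * (Lk D L 0 * tau) + 25 / 2 * rad D 0).
  by rewrite mulr_ge0 ?(ltW h) //; lra.
rewrite expr2; lra.
Qed.

(** At these times the stage is a perturbation of the given curve. The tail bound gives the vertical
    error 8 * 8 + 25 * 2 = 114 times c tau / q, and the planar error carries 2 * 16 * 2 = 64; both
    become multiples of the original displacement z0 through tau <= z0 / kap. *)
Lemma stage_vertical_large n : q < wfreq D 0 * tau ->
  lam' * ((fx D n t - fx D n s) ^+ 2 + (fy D n t - fy D n s) ^+ 2) <=
  vdisp (stage D n s) (stage D n t).
Proof.
move=> h; have [h1 h2] := large_bound h.
have T := vdisp_tail0 n.
have [fx1 fy1] := f_tail ws s t (leq0n n).
(* With this eta the factor lam' (1 + eta) is the midpoint of lam and lam'; the other half of the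
   gap absorbs the errors, as [q_lam] states. *)
pose eta := (lam - lam') / (2 * lam').
have ll : 0 < lam - lam' by rewrite subr_gt0.
have eta0 : 0 < eta by rewrite divr_gt0 // mulr_gt0.
have etaV : eta^-1 = 2 * lam' / (lam - lam') by rewrite /eta invf_div.
have sq (a b : R) : `|a - b| <= 4 * (rad D 0 - rad D n) ->
    a ^+ 2 <= (1 + eta) * b ^+ 2 + (1 + eta^-1) * (16 * rad D 0 ^+ 2).
  move=> hab; have hd : (a - b) ^+ 2 <= 16 * rad D 0 ^+ 2.
    have -> : 16 * rad D 0 ^+ 2 = (4 * rad D 0) ^+ 2 by ring.
    rewrite -[(a - b) ^+ 2]real_normK ?num_real // ler_sqr ?nnegrE //.
      by have := r0 n; lra.
    by rewrite mulr_ge0 // ltW.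
  have e1 : 0 <= 1 + eta^-1 by rewrite addr_ge0 // invr_ge0 ltW.
  have := ler_wpM2l e1 hd.
  have := mulr_ge0 (ltW eta0) (sqr_ge0 (b - eta^-1 * (a - b))).
  have -> : eta * (b - eta^-1 * (a - b)) ^+ 2 =
    eta * b ^+ 2 - 2 * (b * (a - b)) + eta^-1 * (a - b) ^+ 2.
    by field; rewrite gt_eqF.
  rewrite !expr2; lra.
have X := sq _ _ fx1; have Y := sq _ _ fy1.
have f0x u : fx D 0 u = wx D u by rewrite /fx big_ord0 addr0.
have f0y u : fy D 0 u = wy D u by rewrite /fy big_ord0 addr0.
rewrite !f0x in X; rewrite !f0y in Y.
have V := vert0 s0 st tl; have K := lin0 s0 st tl.
set z0 := vdisp (stage D 0 s) (stage D 0 t) in T V K *.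
set z := vdisp _ _ in T *.
set N := _ + _ in V *; rewrite -/N in V.
have z00 : 0 <= z0 by apply: le_trans K; rewrite mulr_ge0 // ltW.
have ct : c / q * tau <= c / (q * kap) * z0.
  have := ler_wpM2l (ltW (divr_gt0 c0 (mulr_gt0 q0 kap0))) K.
  by congr (_ <= _); field; rewrite !gt_eqF.
have Q := ler_wpM2r z00 q_lam; rewrite -etaV in Q.
set e1 := c / (q * kap) in Q ct.
have T' : z0 - 114 * (e1 * z0) <= z by move: T; rewrite ler_norml; lra.
have V' : N <= z0 / lam by rewrite ler_pdivlMr // mulrC.
have e1' : 0 <= 1 + eta^-1 by rewrite addr_ge0 // invr_ge0 ltW.
have r2 : (1 + eta^-1) * (32 * rad D 0 ^+ 2) <= (1 + eta^-1) * (64 * (e1 * z0)).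
  by rewrite ler_wpM2l //; lra.
have N' : (1 + eta) * N <= (1 + eta) * (z0 / lam).
  by rewrite ler_wpM2l // addr_ge0 // ltW.
apply: (@le_trans _ _ (lam' * ((1 + eta) * (z0 / lam) + (1 + eta^-1) * (64 * (e1 * z0))))).
  by rewrite ler_wpM2l ?(ltW lam'0) //; move: X Y r2 N'; rewrite /N; lra.
apply: le_trans T'.
have -> : lam' * ((1 + eta) * (z0 / lam) + (1 + eta^-1) * (64 * (e1 * z0))) =
  z0 - (lam - lam') / (2 * lam) * z0 + 64 * lam' * (1 + eta^-1) * (e1 * z0).
  by rewrite /eta; field; rewrite !gt_eqF.
lra.
Qed.

Lemma stage_pos_large n : q < wfreq D 0 * tau ->
  kap / 2 * tau <= vdisp (stage D n s) (stage D n t).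
Proof.
move=> h; have [h1 h2] := large_bound h.
have T := vdisp_tail0 n; have K := lin0 s0 st tl.
have ll : 0 < lam - lam' by rewrite subr_gt0.
have h3 : c / (q * kap) * 114 <= 2^-1.
  apply: (@le_trans _ _ ((lam - lam') / (2 * lam))).
    apply: le_trans q_lam; rewrite ler_wpM2l ?divr_ge0 ?mulr_ge0 ?(ltW c0) ?(ltW q0) ?(ltW kap0) //.
    by rewrite lerDl !mulr_ge0 ?addr_ge0 ?divr_ge0 ?mulr_ge0 // ltW.
  by rewrite ler_pdivrMr ?mulr_gt0 //; move: lam'0; lra.
have : c / q * tau * 114 <= kap / 2 * tau.
  have -> : c / q * tau * 114 = (c / (q * kap) * 114) * (kap * tau).
    by field; rewrite !gt_eqF.
  have := ler_wpM2r (mulr_ge0 (ltW kap0) tau0) h3; lra.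
move: T; rewrite ler_norml; lra.
Qed.

(** Only the largest times use the verticality of the given curve. Inside a window the choice of c
    suffices, since 8 lam' <= (2c)^-1 - 3/2; below the last scale the stage is nearly straight. *)
Lemma stage_vertical n :
  lam' * ((fx D n t - fx D n s) ^+ 2 + (fy D n t - fy D n s) ^+ 2) <=
  vdisp (stage D n s) (stage D n t).
Proof.
case: (scale_cases ws s t n) => [|[k kn h]|h].
- exact: stage_vertical_large.
- have P := scale_planar ws s0 st tl kn h; have V := scale_vdisp ws s0 st tl kn h.
  set X := rad D k ^+ 2 * _ in P V.
  have X0 : 0 <= X by rewrite mulr_ge0 ?sqr_ge0 // mulr_ge0 // ltW.
  apply: le_trans V; apply: le_trans (ler_wpM2l (ltW lam'0) P) _.
  have := ler_wpM2l X0 c_lam; lra.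
- have P := final_planar ws s0 st tl h; have V := final_vdisp ws s0 st tl h.
  apply: le_trans V; apply: le_trans (ler_wpM2l (ltW lam'0) P) _.
  rewrite mulrA ler_wpM2r ?mulr_ge0 ?(ltW (speed_gt0 ws n)) //.
  have cl := c_le.
  have qi : c / q <= c / 200 by rewrite ler_wpM2l ?(ltW c0) // lef_pV2 ?posrE.
  have := ler_wpM2l (ltW lam'0) qi; move: (mulr_gt0 lam'0 c0) c0; lra.
Qed.

Lemma stage_pos n : s < t -> 0 < vdisp (stage D n s) (stage D n t).
Proof.
move=> st'; have ts : 0 < t - s by rewrite subr_gt0.
case: (scale_cases ws s t n) => [h|[k kn h]|h].
- by apply: lt_le_trans (stage_pos_large n h); rewrite mulr_gt0 // divr_gt0.
- apply: lt_le_trans (scale_vdisp ws s0 st tl kn h).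
  rewrite mulr_gt0 ?mulr_gt0 ?exprn_gt0 //.
  by move: c_lam lam'0; lra.
- apply: lt_le_trans (final_vdisp ws s0 st tl h).
  rewrite mulr_gt0 ?mulr_gt0 ?(speed_gt0 ws) // subr_gt0 ltr_pdivrMr //.
  have := c_le; move: (mulr_gt0 lam'0 c0) c0 q200; lra.
Qed.

End vertical_stage.

(** * Choice of radii, frequencies and phases *)

Definition trig_period (R : realType) (a : R) :=
  forall u : R, cos (u + a) = cos u /\ sin (u + a) = sin u.

Lemma trig_periodN (R : realType) (a : R) : trig_period a -> trig_period (- a).
Proof.
by move=> H u; have [] := H (u - a); rewrite subrK => -> ->.
Qed.

Lemma trig_periodD (R : realType) (a b : R) :
  trig_period a -> trig_period b -> trig_period (a + b).
Proof. by move=> Ha Hb u; rewrite addrA !(Hb _).1 !(Hb _).2 !(Ha _).1 !(Ha _).2. Qed.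

Lemma trig_period_2pi (R : realType) (n : nat) : trig_period (2 * pi * n%:R : R).
Proof.
have -> : 2 * pi * n%:R = pi *+ 2 *+ n :> R by rewrite mulr_natr mulr_natl.
by move=> u; rewrite (periodicn (@cosD2pi R)) (periodicn (@sinD2pi R)).
Qed.

Section construction.
Context {R : realType}.
Variables (l : R) (x y z dx dy : R -> R).
Hypothesis l0 : 0 < l.
Hypothesis xP : {in `[0, l], forall t, wderiv l x t (dx t)}.
Hypothesis yP : {in `[0, l], forall t, wderiv l y t (dy t)}.
Hypothesis zP : {in `[0, l], forall t, wderiv l z t
            (1 + 2^-1 * (x t * dy t - y t * dx t))}.
Hypothesis dxS : wsmooth l dx.
Hypothesis dyS : wsmooth l dy.

Lemma wsmooth_primitive (f : R -> R) : wsmooth l f ->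
  exists2 F : R -> R, {in `[0, l], forall t, wderiv l F t (f t)} & wsmooth l F.
Proof.
move=> fs; have [df fd _] := fs 1%N.
have [F FP] := wderiv_primitive l0 (wderiv_continuous fd).
by exists F => //; exact: wsmooth_deriv FP fs.
Qed.

(* The phase makes the area swept between [(x, y)] and the helix vanish, so that
   adding the helix does not move the endpoint. *)
Lemma phase_primitive (r w : R) : exists phP : R * (R -> R),
  [/\ {in `[0, l], forall t, wderiv l phP.2 t
        (r * cos (w * t + phP.1) * dy t - r * sin (w * t + phP.1) * dx t)},
      wsmooth l phP.2 &
      phP.2 l - phP.2 0 + (x l - x 0) * (r * sin phP.1) - (y l - y 0) * (r * cos phP.1) = 0].
Proof.
have [cs ss] := wsmooth_trig l w 0.
have [|P1 P1d P1s] := @wsmooth_primitive (fun t => r * (cos (w * t + 0) * dy t - sin (w * t + 0) * dx t)).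
  by apply: wsmoothZ; apply: wsmoothB; exact: wsmoothM.
have [|P2 P2d P2s] := @wsmooth_primitive (fun t => - r * (sin (w * t + 0) * dy t + cos (w * t + 0) * dx t)).
  by apply: wsmoothZ; apply: wsmoothD; exact: wsmoothM.
(* By the addition formulas the closing condition is a linear form in (cos ph, sin ph) with
   coefficients A1 and A2, and such a form has a zero on the unit circle. *)
pose A1 := P1 l - P1 0 - (y l - y 0) * r.
pose A2 := P2 l - P2 0 + (x l - x 0) * r.
have [ph phE] : exists ph : R, cos ph * A1 + sin ph * A2 = 0.
  have [A20|A20] := eqVneq A2 0.
    by exists (pi / 2); rewrite A20 cos_pihalf mul0r mulr0 addr0.
  exists (atan (- A1 / A2)).
  have cp : cos (atan (- A1 / A2)) != 0.
    by rewrite cos_atan invr_eq0 sqrtr_eq0 -ltNge ltr_pwDl // sqr_ge0.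
  have -> : sin (atan (- A1 / A2)) = tan (atan (- A1 / A2)) * cos (atan (- A1 / A2)).
    by rewrite /tan divfK.
  by rewrite atanK; field.
exists (ph, fun t => cos ph * P1 t + sin ph * P2 t); split => /=.
- move=> t tI.
  suff : wderiv l (fun t => cos ph * P1 t + sin ph * P2 t) t
    (cos ph * (r * (cos (w * t + 0) * dy t - sin (w * t + 0) * dx t)) +
     sin ph * (- r * (sin (w * t + 0) * dy t + cos (w * t + 0) * dx t))).
    by congr wderiv; rewrite !addr0 cosD sinD; ring.
  by apply: wderivD; apply: wderivZ; [exact: P1d|exact: P2d].
- by apply: wsmoothD; exact: wsmoothZ.
- by rewrite -[RHS]phE /A1 /A2; ring.
Qed.

Variables (L c q W0 sg : R) (M N : nat).
Hypothesis dxL : {in `[0, l], forall t, `|dx t| <= L}.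
Hypothesis dyL : {in `[0, l], forall t, `|dy t| <= L}.
Hypotheses (c0 : 0 < c) (c5 : c <= 5^-1) (q200 : 200 <= q) (qN : q = N%:R).
Hypotheses (sgE : sg = 1 \/ sg = -1).
Hypotheses (M0 : (0 < M)%N) (W0E : W0 = 2 * pi * M%:R / l).
Hypothesis LW : L ^+ 2 <= 32 * c / q ^+ 2 * W0.

Let W n := W0 * (q ^+ 2) ^+ n.
Let ka := 1 - sg * c.
Let r n := Num.sqrt (2 * c * ka ^+ n / W n).

Let q0 : 0 < q. Proof. by apply: lt_le_trans q200. Qed.
Let W00 : 0 < W0. Proof. by rewrite W0E divr_gt0 // !mulr_gt0 ?pi_gt0 ?ltr0n. Qed.
Let Wn0 n : 0 < W n. Proof. by rewrite mulr_gt0 // !exprn_gt0. Qed.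
Let ka_bd : 1 / 2 <= ka <= 2.
Proof. by rewrite /ka; case: sgE => ->; move: c0 c5; lra. Qed.
Let ka0 : 0 < ka. Proof. by have /andP[+ _] := ka_bd; lra. Qed.
Let rr0 n : 0 < 2 * c * ka ^+ n / W n.
Proof. by rewrite divr_gt0 // !mulr_gt0 // exprn_gt0. Qed.
Let r_sq n : r n ^+ 2 = 2 * c * ka ^+ n / W n.
Proof. by rewrite /r sqr_sqrtr // ltW. Qed.
Let r_gt0 n : 0 < r n. Proof. by rewrite sqrtr_gt0. Qed.

(** Since W_0 l is a multiple of 2 pi and q is an integer, every helix makes a whole number of turns
    over [0, l]. The radii are fixed by r_n^2 W_n = 2 c ka^n, which makes the speed geometric with
    ratio ka = 1 - sg c. *)
Lemma wiggle_exists : exists D : wiggle R,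
  [/\ [/\ wx D = x, wy D = y & wz D = z], wiggle_scale D l L c q,
      (forall n, [/\ rad D n ^+ 2 = 2 * c * ka ^+ n / W n, wfreq D n = W n &
        speed D n = ka ^+ n]),
      (forall n, stage D n 0 = (x 0, y 0, z 0) /\ stage D n l = (x l, y l, z l)) &
      (forall n, wsmooth l (prim D n))].
Proof.
have [phP phPE] := choice (fun n => phase_primitive (r n) (sg * W n)).
pose D := Wiggle x y z dx dy r (fun n => sg * W n) (fun n => (phP n).1) (fun n => (phP n).2).
have sg1 : `|sg| = 1 by case: sgE => ->; rewrite ?normrN normr1.
have sg0 : sg != 0 by rewrite -normr_eq0 sg1 oner_eq0.
have WE n : wfreq D n = W n by rewrite /wfreq /= normrM sg1 mul1r gtr0_norm.
have sp n : speed D n = ka ^+ n.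
  elim: n => [|n IH]; first by rewrite /speed big_ord0 subr0.
  rewrite speedS IH /= r_sq exprS /ka.
  by field; rewrite gt_eqF.
have WS n : W n.+1 = q ^+ 2 * W n by rewrite /W exprS; ring.
have rS n : r n.+1 ^+ 2 = ka / q ^+ 2 * r n ^+ 2.
  by rewrite !r_sq WS exprS; field; rewrite !gt_eqF.
have Wlt i n : (i < n)%N -> W i < W n.
  move=> /subnK <-; elim: (n - i.+1)%N => [|k IH].
    by rewrite add0n WS ltr_pMl // expr2; move: q200; nra.
  by apply: lt_trans IH _; rewrite addSn WS ltr_pMl // expr2; move: q200; nra.
have DD : wiggle_deriv D l.
  split => //=.
  - by move=> n t tI; have [H _ _] := phPE n; exact: H.
  - move=> i n ilt; apply/eqP => /(mulfI sg0) E.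
    by have := Wlt _ _ ilt; rewrite E ltxx.
have Wper n : trig_period (freq D n * l).
  have P : trig_period (W n * l).
    rewrite /W W0E qN -!natrX.
    have -> : 2 * pi * M%:R / l * ((N ^ 2) ^ n)%N%:R * l = 2 * pi * (M * (N ^ 2) ^ n)%N%:R.
      by rewrite natrM; field; rewrite gt_eqF.
    exact: trig_period_2pi.
  rewrite /=; case: sgE => ->; first by rewrite mul1r.
  by rewrite mulN1r mulNr; exact: trig_periodN.
have hxl n : hx D n l = hx D n 0.
  by rewrite /hx mulr0 add0r addrC (Wper n _).1.
have hyl n : hy D n l = hy D n 0.
  by rewrite /hy mulr0 add0r addrC (Wper n _).2.
have fxl n : fx D n l = x l.
  by rewrite /fx big1 ?addr0 // => i _; rewrite hxl subrr.
have fyl n : fy D n l = y l.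
  by rewrite /fy big1 ?addr0 // => i _; rewrite hyl subrr.
have st0 n : stage D n 0 = (x 0, y 0, z 0) by exact: stage0.
(* Over the whole interval the sine and all beats return to their initial values, so the increment
   given by [vdisp_stageS] reduces to the expression that the phase makes vanish. *)
have vl n : vdisp (stage D n 0) (stage D n l) = vdisp (stage D 0 0) (stage D 0 l).
  elim: n => [//|n IH]; rewrite vdisp_stageS IH.
  rewrite subr0 -[freq D n * l]add0r (Wper n 0).2 sin0 mulr0 subr0.
  rewrite hxl hyl fxl fyl.
  have -> : sweep D n l - sweep D n 0 = (phP n).2 l - (phP n).2 0.
    rewrite /sweep /psweep /=.
    have -> : \sum_(i < n) beat D i n l = \sum_(i < n) beat D i n 0.
      apply: eq_bigr => i _; rewrite /beat mulr0 add0r [_ * l + _]addrC [_ * l]mulrBl.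
      by rewrite (trig_periodD (Wper i) (trig_periodN (Wper n)) _).2.
    by ring.
  have [_ _ E] := phPE n.
  have -> : fx D n 0 = x 0 by have := st0 n; rewrite /stage => -[].
  have -> : fy D n 0 = y 0 by have := st0 n; rewrite /stage => -[].
  rewrite /hx /hy /= mulr0 add0r; apply/eqP.
  by rewrite -subr_eq0 -[X in _ == X]E; apply/eqP; field.
exists D; split => //.
- have q2 : 0 < q ^+ 2 by rewrite exprn_gt0.
  split => //.
  + by move=> n; rewrite WE.
  + by move=> n; rewrite !WE.
  + by move=> n; rewrite WE sp /= r_sq divfK // gt_eqF.
  + move=> n; rewrite /= -ler_sqr ?nnegrE ?(ltW (r_gt0 _)) //; last first.
      by rewrite mulr_ge0 ?divr_ge0 // ltW.
    rewrite rS exprMn ler_wpM2r ?sqr_ge0 // exprMn exprVn ler_wpM2r ?invr_ge0 ?(ltW q2) //.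
    by have /andP[_ h] := ka_bd; apply: le_trans h _; rewrite expr2; lra.
  + move=> n; rewrite /= -ler_sqr ?nnegrE ?(ltW (r_gt0 _)) //; last first.
      by rewrite !mulr_ge0 // ltW.
    rewrite exprMn rS mulrA ler_peMl ?sqr_ge0 //.
    have -> : (2 * q) ^+ 2 * (ka / q ^+ 2) = 4 * ka by field; rewrite gt_eqF.
    by have /andP[h _] := ka_bd; lra.
  + have L0 : 0 <= L.
      by apply: le_trans (normr_ge0 _) (dxL (x:=0) _); rewrite in_itv /= lexx ltW.
    rewrite WE /= -ler_sqr ?nnegrE //; last first.
      by rewrite mulr_ge0 ?divr_ge0 ?mulr_ge0 // ltW.
    apply: le_trans LW _; rewrite !exprMn r_sq expr0 mulr1.
    rewrite (_ : W 0 = W0) ?/W ?expr0 ?mulr1 // le_eqVlt; apply/orP; left; apply/eqP.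
    by field; rewrite !gt_eqF.
- move=> n; split => //.
  have := vl n; rewrite /vdisp /stage /xc /yc /zc /= !fxl !fyl.
  have := st0 n; rewrite /stage => -[-> -> ->].
  have := st0 0%N; rewrite /stage => -[-> -> ->].
  have -> : fz D 0 l = z l by rewrite /fz big_ord0 addr0.
  by move=> /addIr /addIr ->.
- by move=> n; have [] := phPE n.
Qed.

End construction.

Lemma wsmooth_stage (R : realType) (D : wiggle R) (l : R) n :
  wsmooth l (wx D) -> wsmooth l (wy D) -> wsmooth l (wz D) ->
  (forall n, wsmooth l (prim D n)) -> wsmooth l (stage D n).
Proof.
move=> xs ys zs Ps.
have cst (a : R) : wsmooth l (fun=> a) by exact: wsmooth_cst.
have hxs k : wsmooth l (hx D k).
  by apply: wsmoothZ; exact: (wsmooth_trig _ _ _).1.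
have hys k : wsmooth l (hy D k).
  by apply: wsmoothZ; exact: (wsmooth_trig _ _ _).2.
have fxs k : wsmooth l (fx D k).
  apply: wsmoothD => //; apply: (@wsmooth_sum _ _ _ (fun i u => hx D i u - hx D i 0)) => i _.
  exact: wsmoothB.
have fys k : wsmooth l (fy D k).
  apply: wsmoothD => //; apply: (@wsmooth_sum _ _ _ (fun i u => hy D i u - hy D i 0)) => i _.
  exact: wsmoothB.
apply/wsmooth_heis; split => //=; first exact: fxs; first exact: fys.
apply: wsmoothD => //; apply: (@wsmooth_sum _ _ _ (fun k u => lift_step D k u - lift_step D k 0)) => k _.
apply: wsmoothB => //; apply: wsmoothD; last first.
  apply: wsmoothD => //; apply: (@wsmooth_sum _ _ _ (fun i => beat D i k)) => i _.
  by apply: wsmoothZ; exact: (wsmooth_trig _ _ _).2.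
apply: wsmoothB; apply: wsmoothZ; apply: wsmoothB; do ?exact: wsmoothZ.
- by apply: wsmoothM => //; exact: wsmoothD.
- by apply: wsmoothM => //; exact: wsmoothD.
Qed.

(** * The Koranyi distance *)

Section koranyi_distance.
Context {R : realType}.
Implicit Types a b p : heis R.

Lemma hdist4 a b : hdist a b ^+ 4 =
  ((xc a - xc b) ^+ 2 + (yc a - yc b) ^+ 2) ^+ 2 + 16 * vdisp b a ^+ 2.
Proof.
rewrite /hdist /koranyi; set S := (X in X `^ _).
have S0 : 0 <= S by rewrite /S addr_ge0 ?sqr_ge0 // mulr_ge0 ?sqr_ge0.
rewrite -powR_mulrn ?powR_ge0 // -powRrM mulVf ?pnatr_eq0 // powRr1 //.
by rewrite /S /hmul /hinv /vdisp /xc /yc /zc /=; field.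
Qed.

Lemma hdist_ge0 a b : 0 <= hdist a b.
Proof. exact: powR_ge0. Qed.

Lemma vdispC a b : vdisp b a = - vdisp a b.
Proof. by rewrite /vdisp; field. Qed.

Lemma hdistC a b : hdist a b = hdist b a.
Proof.
apply/eqP; rewrite -(@eqrXn2 _ 4) ?hdist_ge0 // !hdist4 (vdispC b a) sqrrN.
by apply/eqP; congr (_ ^+ 2 + _); ring.
Qed.

(** Together with [hdist_sq_ge] this places the squared distance between 4|vdisp| and the same plus
    the squared planar displacement. For points of a stage at small time differences the planar part
    is negligible, so 2-measure counts vertical displacement. *)
Lemma hdist_sq_le a b :
  hdist a b ^+ 2 <= (xc a - xc b) ^+ 2 + (yc a - yc b) ^+ 2 + 4 * `|vdisp b a|.
Proof.
set N := _ ^+ 2 + _ ^+ 2; have N0 : 0 <= N by rewrite addr_ge0 ?sqr_ge0.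
have R0 : 0 <= N + 4 * `|vdisp b a| by apply: addr_ge0 => //; apply: mulr_ge0.
rewrite -(@ler_pXn2r _ 2) ?nnegrE ?sqr_ge0 //.
rewrite -exprM hdist4 -/N -[vdisp b a ^+ 2]real_normK ?num_real //.
by have := mulr_ge0 N0 (normr_ge0 (vdisp b a)); rewrite !expr2; lra.
Qed.

Lemma hdist_sq_ge a b : 4 * `|vdisp b a| <= hdist a b ^+ 2.
Proof.
rewrite -(@ler_pXn2r _ 2) ?nnegrE ?sqr_ge0 ?mulr_ge0 //.
rewrite -exprM hdist4 -[vdisp b a ^+ 2]real_normK ?num_real //.
by have := sqr_ge0 ((xc a - xc b) ^+ 2 + (yc a - yc b) ^+ 2); rewrite !expr2; lra.
Qed.

Lemma hdist_le a b (e : R) : 0 <= e ->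
  (xc a - xc b) ^+ 2 + (yc a - yc b) ^+ 2 + 4 * `|vdisp b a| <= e ^+ 2 -> hdist a b <= e.
Proof.
move=> e0 h; rewrite -(@ler_pXn2r _ 2) ?nnegrE ?hdist_ge0 //.
exact: le_trans (hdist_sq_le _ _) h.
Qed.

Lemma vdisp_hmul p v : [/\ xc (hmul p v) - xc p = xc v, yc (hmul p v) - yc p = yc v
  & vdisp p (hmul p v) = zc v].
Proof. by rewrite /vdisp /hmul /xc /yc /zc /=; split; field. Qed.

Lemma vertical_setP (lam : R) (E : set (heis R)) :
  vertical_set lam E <-> forall a b, E a -> E b ->
    lam * ((xc b - xc a) ^+ 2 + (yc b - yc a) ^+ 2) <= `|vdisp a b|.
Proof.
split=> [H a b Ea Eb|H a Ea b Eb].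
  have [v] := H a Ea b Eb; rewrite /VCone /= => Hv <-.
  by have [-> -> ->] := vdisp_hmul a v.
have E1 : hmul a (hmul (hinv a) b) = b.
  case: a b {H Ea Eb} => [[? ?] ?] [[? ?] ?].
  by rewrite /hmul /hinv /xc /yc /zc /=; congr (_, _, _); field.
move: (hmul (hinv a) b) E1 => v E1; exists v => //; rewrite /VCone /=.
have [<- <- <-] := vdisp_hmul a v.
by rewrite E1; exact: H.
Qed.

Lemma vertical_image (lam l : R) (g : R -> heis R) :
  (forall s t : R, 0 <= s -> s <= t -> t <= l ->
    lam * ((xc (g t) - xc (g s)) ^+ 2 + (yc (g t) - yc (g s)) ^+ 2) <= vdisp (g s) (g t)) ->
  vertical_set lam (g @` `[0, l]).
Proof.
move=> H; apply/vertical_setP => _ _ [s sI <-] [t tI <-].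
move: sI tI; rewrite /= !in_itv /= => /andP[s0 sl] /andP[t0 tl].
have [st|/ltW ts] := leP s t.
  by apply: le_trans (ler_norm _); exact: H.
rewrite vdispC normrN; apply: le_trans (ler_norm _); apply: le_trans (H _ _ t0 ts sl).
by rewrite le_eqVlt; apply/orP; left; apply/eqP; ring.
Qed.

Lemma hausdorff_dist_image_le (I : set R) (f g : R -> heis R) (e : R) :
  (forall t, I t -> hdist (f t) (g t) <= e) ->
  (hausdorff_dist (@hdist R) (f @` I) (g @` I) <= maxe e%:E 0%E)%E.
Proof.
move=> H; rewrite /hausdorff_dist ge_max; apply/andP; split.
  apply: ge_ereal_sup => _ [_ [t It <-] <-]; rewrite le_max; apply/orP; left.
  apply: (@le_trans _ _ (hdist (f t) (g t))%:E); last by rewrite lee_fin H.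
  by apply: ereal_inf_lbound; exists (g t) => //; exists t.
apply: ge_ereal_sup => _ [_ [t It <-] <-]; rewrite le_max; apply/orP; left.
apply: (@le_trans _ _ (hdist (g t) (f t))%:E); last by rewrite lee_fin hdistC H.
by apply: ereal_inf_lbound; exists (f t) => //; exists t.
Qed.

(** On the vertical axis the squared distance is exactly 4|s - t|, so the covering bound and the
    mass distribution bound agree. *)
Lemma hausdorff_measure_segment :
  hausdorff_measure (@hdist R) 2 (@vertical_segment R) = 4%:E.
Proof.
pose g (t : R) : heis R := (0, 0, t).
have dg (s t : R) : hdist (g s) (g t) ^+ 2 = 4 * `|s - t|.
  apply/eqP; rewrite -(@eqrXn2 _ 2) ?sqr_ge0 ?mulr_ge0 // -exprM hdist4.
  have -> : xc (g s) - xc (g t) = 0 by rewrite /g /xc /= subrr.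
  have -> : vdisp (g t) (g s) = s - t.
    by rewrite /vdisp /g /xc /yc /zc /= !mulr0 subrr mulr0 subr0.
  rewrite -[(s - t) ^+ 2]real_normK ?num_real //.
  by apply/eqP; ring.
rewrite /vertical_segment -/(g @` _).
apply/eqP; rewrite eq_le; apply/andP; split; last first.
  have := @hausdorff_measure_image_ge R _ (@hdist R) hdist_ge0 g 1 2 4 1.
  rewrite mulr1; apply => //; move=> s t _ _ _.
  by rewrite -[2]/(2%:R) powR_mulrn ?hdist_ge0 // dg.
apply: ge_ereal_sup => _ [delta /= d0 <-].
pose N := (Num.truncn (4 / delta ^+ 2)).+1.
have NP : 4 / delta ^+ 2 < N%:R by exact: truncnS_gt.
have N0 : 0 < N%:R :> R by rewrite ltr0n.
have D0 : 0 <= Num.sqrt (4 / N%:R) :> R by exact: sqrtr_ge0.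
have DE : Num.sqrt (4 / N%:R) ^+ 2 = 4 / N%:R :> R by rewrite sqr_sqrtr // divr_ge0 // ltW.
apply: le_trans (@hausdorff_content_image_le R _ (@hdist R) g 1 2 delta (Num.sqrt (4 / N%:R)) N _ _ _ _ _ _) _ => //.
- rewrite -(@ler_pXn2r _ 2) ?nnegrE ?(ltW d0) // DE ler_pdivrMr // mulrC -ler_pdivrMr ?exprn_gt0 //.
  exact: ltW.
- move=> s t _ _ st; rewrite -(@ler_pXn2r _ 2) ?nnegrE ?hdist_ge0 // dg DE.
  by rewrite ler_wpM2l // -div1r.
- rewrite -[2]/(2%:R) powR_mulrn // DE lee_fin mulrC divfK // gt_eqF //.
Qed.

End koranyi_distance.

(** * The limit curve *)

Lemma cvg_of_tail (R : realType) (u b : nat -> R) : b n @[n --> \oo] --> (0 : R) ->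
  (forall j n, (j <= n)%N -> `|u n - u j| <= b j) ->
  exists2 a : R, u n @[n --> \oo] --> a & forall j, `|a - u j| <= b j.
Proof.
move=> b0 ub.
have /cvg_ex [a ua] : cvg (u n @[n --> \oo]).
  apply/cauchy_cvgP/cauchy_exP => e e0.
  have /cvgrPdist_lt /(_ _ e0) [N _ NH] := b0.
  exists (u N), N => // n /= Nn; rewrite -ball_normE /= distrC.
  apply: le_lt_trans (ub _ _ Nn) _; have := NH N (leqnn N).
  by rewrite /= sub0r normrN; apply: le_lt_trans; exact: ler_norm.
exists a => // j.
have H : `|u n - u j| @[n --> \oo] --> `|a - u j|.
  by apply: cvg_norm; apply: cvgB => //; exact: cvg_cst.
apply: (ler_cvg_to H (cvg_cst (b j))).
by exists j => // n /= jn; exact: ub.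
Qed.

Lemma uniform_cvg_continuous (R : realType) (I : set R) (f : R -> R)
    (fn : nat -> R -> R) (b : nat -> R) : b n @[n --> \oo] --> (0 : R) ->
  (forall n t, I t -> `|f t - fn n t| <= b n) ->
  (forall n, {within I, continuous (fn n)}) -> {within I, continuous f}.
Proof.
move=> b0 fb fc; apply/subspace_continuousP => t It.
apply/cvgrPdist_le => e e0.
have e3 : 0 < e / 3 by rewrite divr_gt0.
have /cvgrPdist_lt /(_ _ e3) [N _ NH] := b0.
have bN : b N <= e / 3.
  have := NH N (leqnn N); rewrite /= sub0r normrN => /ltW.
  by apply: le_trans; exact: ler_norm.
have /subspace_continuousP /(_ _ It) /cvgrPdist_le /(_ _ e3) [d /= d0 dH] := fc N.
exists d => //= u ud uI.
have h1 := dH u ud uI; have h2 := fb N _ uI; have h3 := fb N _ It.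
have -> : f t - f u = (f t - fn N t) + (fn N t - fn N u) - (f u - fn N u) by ring.
apply: le_trans (ler_normB _ _) _.
by apply: le_trans (lerD (ler_normD _ _) (lexx _)) _; lra.
Qed.

Lemma within_continuous_heis (R : realType) (I : set R) (g : R -> heis R) :
  {within I, continuous (fun u => xc (g u))} ->
  {within I, continuous (fun u => yc (g u))} ->
  {within I, continuous (fun u => zc (g u))} -> {within I, continuous g}.
Proof.
move=> /subspace_continuousP gx /subspace_continuousP gy /subspace_continuousP gz.
apply/subspace_continuousP => t It.
have H := cvg_pair (cvg_pair (gx _ It) (gy _ It)) (gz _ It).
have E : g = fun u => (xc (g u), yc (g u), zc (g u)).
  by apply/funext => u; rewrite /xc /yc /zc -!surjective_pairing.
suff : g @ within I (nbhs t) --> ((xc (g t), yc (g t), zc (g t)) : heis R).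
  by rewrite /xc /yc /zc -!surjective_pairing.
by rewrite {1}E; exact: H.
Qed.

Section limit_curve.
Context {R : realType}.
Variables (D : wiggle R) (l L c q : R).
Hypothesis ws : wiggle_scale D l L c q.

Let r0 := ws_rad ws.

Lemma rad_cvg0 (K : R) : K * rad D n @[n --> \oo] --> (0 : R).
Proof.
suff H : rad D n @[n --> \oo] --> (0 : R).
  by have := cvgM (cvg_cst K) H; rewrite mulr0; exact.
have rn n : rad D n <= geometric (rad D 0) 2^-1 n.
  elim: n => [|n IH]; first by rewrite /= expr0 mulr1.
  apply: le_trans (rad_half ws n) _; rewrite /= exprS mulrCA.
  by rewrite ler_wpM2l.
apply: (@squeeze_cvgr _ _ _ _ (fun=> 0) (geometric (rad D 0) 2^-1)).
- by near=> n; rewrite rn (ltW (r0 n)).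
- exact: cvg_cst.
- by apply: cvg_geometric; rewrite ger0_norm // invf_lt1 // ltr1n.
Unshelve. all: by end_near. Qed.

(** The planar coordinates come from [f_tail]. The height is recovered from the vertical
    displacement from time 0, at the cost of an area term with the fixed starting point; using stage
    0 as the reference in [vdisp_tail3] keeps the bound proportional to [rad j]. *)
Lemma stage_tail : exists K : R, forall j n t, (j <= n)%N -> t \in `[0, l] ->
  [/\ `|fx D n t - fx D j t| <= K * rad D j, `|fy D n t - fy D j t| <= K * rad D j
    & `|fz D n t - fz D j t| <= K * rad D j].
Proof.
pose x0 := wx D 0; pose y0 := wy D 0.
pose K := 4 + 2 * (4 * (Lk D L 0 * l) + 25 / 2 * rad D 0) + 2 * (`|x0| + `|y0|).
have L0 := Lk_ge0 ws 0.
have l0 := ws_l ws.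
exists K => j n t jn; rewrite in_itv /= => /andP[t0 tl].
have st0 k : [/\ fx D k 0 = x0, fy D k 0 = y0 & fz D k 0 = wz D 0].
  by have := stage0 D k; rewrite /stage => -[-> -> ->].
have [xj yj zj] := st0 j; have [xn yn zn] := st0 n.
have [h1 h2] := f_tail ws 0 t jn.
have h3 := vdisp_tail3 ws (lexx 0) t0 tl (leq0n j) jn.
rewrite xj xn in h1; rewrite yj yn in h2; rewrite subr0 in h3.
have rj := r0 j; have rn := r0 n.
have {}h1 : `|fx D n t - fx D j t| <= 4 * rad D j.
  have -> : fx D n t - fx D j t = fx D n t - x0 - (fx D j t - x0) by ring.
  by lra.
have {}h2 : `|fy D n t - fy D j t| <= 4 * rad D j.
  have -> : fy D n t - fy D j t = fy D n t - y0 - (fy D j t - y0) by ring.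
  by lra.
have B0 : 0 <= 4 * (Lk D L 0 * l) + 25 / 2 * rad D 0.
  by rewrite addr_ge0 ?mulr_ge0 ?(ltW l0) ?(ltW (r0 0)).
have {}h3 : `|vdisp (stage D n 0) (stage D n t) - vdisp (stage D j 0) (stage D j t)| <=
    2 * rad D j * (4 * (Lk D L 0 * l) + 25 / 2 * rad D 0).
  apply: le_trans h3 _; apply: ler_pM.
  - by rewrite mulr_ge0 // subr_ge0 (rad_le ws).
  - by rewrite addr_ge0 ?mulr_ge0 ?(ltW (r0 0)).
  - lra.
  - by rewrite lerD2r ler_wpM2l // ler_wpM2l.
have ax := normr_ge0 x0; have ay := normr_ge0 y0.
have M1 := mulr_ge0 (ltW rj) B0; have M2 := mulr_ge0 (ltW rj) ax.
have M3 := mulr_ge0 (ltW rj) ay.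
split; [apply: le_trans h1 _; rewrite /K; lra|apply: le_trans h2 _; rewrite /K; lra|].
have -> : fz D n t - fz D j t =
  (vdisp (stage D n 0) (stage D n t) - vdisp (stage D j 0) (stage D j t)) +
  2^-1 * (x0 * (fy D n t - fy D j t) - (fx D n t - fx D j t) * y0).
  by rewrite /vdisp /stage /xc /yc /zc /= xn xj yn yj zn zj; field.
apply: le_trans (ler_normD _ _) _; rewrite normrM (ger0_norm (_ : 0 <= 2^-1 :> R)) //.
have h4 : `|x0 * (fy D n t - fy D j t) - (fx D n t - fx D j t) * y0| <=
   `|x0| * (4 * rad D j) + (4 * rad D j) * `|y0|.
  apply: le_trans (ler_normB _ _) _; rewrite !normrM.
  by apply: lerD; [exact: ler_wpM2l|exact: ler_wpM2r].
rewrite /K; lra.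
Qed.

Lemma limit_curve : exists F : R -> heis R,
  [/\ {within `[0, l], continuous F},
      {in `[0, l], forall t, [/\ fx D n t @[n --> \oo] --> xc (F t),
        fy D n t @[n --> \oo] --> yc (F t) & fz D n t @[n --> \oo] --> zc (F t)]} &
      (forall t, t \in `[0, l] -> (forall n, stage D n t = stage D 0 t) -> F t = stage D 0 t)].
Proof.
have [K KP] := stage_tail.
have lim (f : nat -> R -> R) : (forall j n t, (j <= n)%N -> t \in `[0, l] ->
    `|f n t - f j t| <= K * rad D j) ->
  (forall n, {within `[0, l], continuous (f n)}) ->
  exists2 g : R -> R, {within `[0, l], continuous g} &
    {in `[0, l], forall t, f n t @[n --> \oo] --> g t}.
  move=> fK fc.
  have ex t : exists a : R, t \in `[0, l] -> f n t @[n --> \oo] --> a /\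
      forall j, `|a - f j t| <= K * rad D j.
    have [tI|tI] := boolP (t \in `[0, l]); last by exists 0.
    have [|a ua aj] := @cvg_of_tail R (fun n => f n t) (fun n => K * rad D n) (rad_cvg0 K).
      by move=> j n jn; exact: fK.
    by exists a.
  have [g gP] := choice ex; exists g.
    apply: (@uniform_cvg_continuous R _ g f (fun n => K * rad D n) (rad_cvg0 K) _ fc).
    by move=> n t tI; have [_] := gP t tI.
  by move=> t tI; have [] := gP t tI.
have [||X Xc XP] := lim (fun n t => fx D n t).
- by move=> j n t jn tI; have [] := KP j n t jn tI.
- by move=> n; apply: wderiv_continuous => t tI; exact: (wderiv_fx (ws_deriv ws) tI).
have [||Y Yc YP] := lim (fun n t => fy D n t).
- by move=> j n t jn tI; have [] := KP j n t jn tI.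
- by move=> n; apply: wderiv_continuous => t tI; exact: (wderiv_fy (ws_deriv ws) tI).
have [||Z Zc ZP] := lim (fun n t => fz D n t).
- by move=> j n t jn tI; have [] := KP j n t jn tI.
- by move=> n; apply: wderiv_continuous => t tI; exact: (wderiv_fz (ws_deriv ws) tI).
exists (fun t => (X t, Y t, Z t)); split.
- exact: within_continuous_heis.
- by move=> t tI; split; [exact: XP|exact: YP|exact: ZP].
- move=> t tI H; rewrite /stage.
  have u (f : nat -> R) a : f n @[n --> \oo] --> a -> (forall n, f n = f 0%N) -> a = f 0%N.
    move=> fa fE; have f0 : f n @[n --> \oo] --> f 0%N.
      by apply: cvg_near_cst; exists 0%N => // n _; exact: fE.
    exact: (cvg_unique _ fa f0).
  congr (_, _, _); [apply: u (XP t tI) _|apply: u (YP t tI) _|apply: u (ZP t tI) _] => n;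
    by have := H n; rewrite /stage => -[].
Qed.

End limit_curve.

Section limit_facts.
Context {R : realType}.
Variables (D : wiggle R) (F : R -> heis R) (s t : R).
Hypothesis Fs : [/\ fx D n s @[n --> \oo] --> xc (F s),
        fy D n s @[n --> \oo] --> yc (F s) & fz D n s @[n --> \oo] --> zc (F s)].
Hypothesis Ft : [/\ fx D n t @[n --> \oo] --> xc (F t),
        fy D n t @[n --> \oo] --> yc (F t) & fz D n t @[n --> \oo] --> zc (F t)].

Lemma vdisp_cvg :
  vdisp (stage D n s) (stage D n t) @[n --> \oo] --> vdisp (F s) (F t).
Proof.
move: Fs Ft => [xs ys zs] [xt yt zt]; rewrite /vdisp /stage /=.
apply: cvgB; first exact: cvgB.
by apply: cvgM; [exact: cvg_cst|apply: cvgB; exact: cvgM].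
Qed.

Lemma planar_cvg :
  (fx D n t - fx D n s) ^+ 2 + (fy D n t - fy D n s) ^+ 2 @[n --> \oo] -->
  (xc (F t) - xc (F s)) ^+ 2 + (yc (F t) - yc (F s)) ^+ 2.
Proof.
move: Fs Ft => [xs ys zs] [xt yt zt].
by apply: cvgD; apply: cvgM; exact: cvgB.
Qed.

End limit_facts.

(** * Hausdorff measure of the stages *)

(** What both conclusions need from the construction. The constants in the verticality, positivity
    and closeness bounds do not depend on n. [gf_c] makes the factor in [scale_vdisp] at least 1. *)
Record good_family (R : realType) (alpha : R -> heis R) (D : wiggle R)
    (l L c q W0 sg lam' kap eps : R) : Prop := GoodFamily {
  gf_ws : wiggle_scale D l L c q;
  gf_kap : 0 < kap;
  gf_W0 : 0 < W0;
  gf_c : 1 <= (2 * c)^-1 - 3 / 2;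
  gf_vert : forall n (s t : R), 0 <= s -> s <= t -> t <= l ->
    lam' * ((fx D n t - fx D n s) ^+ 2 + (fy D n t - fy D n s) ^+ 2) <=
    vdisp (stage D n s) (stage D n t);
  gf_pos : forall n (s t : R), 0 <= s -> s < t -> t <= l ->
    0 < vdisp (stage D n s) (stage D n t);
  gf_large : forall n (s t : R), 0 <= s -> s <= t -> t <= l -> q < wfreq D 0 * (t - s) ->
    kap * (t - s) <= vdisp (stage D n s) (stage D n t);
  gf_formula : forall n,
    [/\ rad D n ^+ 2 = 2 * c * (1 - sg * c) ^+ n / (W0 * (q ^+ 2) ^+ n),
        wfreq D n = W0 * (q ^+ 2) ^+ n & speed D n = (1 - sg * c) ^+ n];
  gf_end : forall n, stage D n 0 = alpha 0 /\ stage D n l = alpha l;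
  gf_close : forall n t, t \in `[0, l] -> hdist (alpha t) (stage D n t) <= eps;
  gf_smooth : forall n, smooth_on `[0, l] (stage D n) }.

Lemma H2hatE (R : realType) (E : set (heis R)) :
  H2hat E = ((4^-1)%:E * hausdorff_measure (@hdist R) 2 E)%E.
Proof. by rewrite /H2hat hausdorff_measure_segment. Qed.

Lemma hausdorff_measure_ge0 (R : realType) (T : Type) (d : T -> T -> R) (s : R) (E : set T) :
  (0 <= hausdorff_measure d s E)%E.
Proof.
apply: (@le_trans _ _ (hausdorff_content d s 1 E)).
  apply: le_ereal_inf_tmp => _ [U _ <-]; apply: nneseries_ge0 => i _ _.
  exact: hausdorff_weight_ge0.
by apply: ereal_sup_ubound; exists 1 => /=.
Qed.

Section stage_curves.
Context {R : realType}.
Variables (alpha : R -> heis R) (D : wiggle R) (l L c q W0 sg lam' kap eps : R).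
Hypothesis gf : good_family alpha D l L c q W0 sg lam' kap eps.
Hypothesis lam'0 : 0 < lam'.

Let ws := gf_ws gf.
Let l0 := ws_l ws.

Lemma stage_within_continuous n : {within `[0, l], continuous (stage D n)}.
Proof.
apply: within_continuous_heis; apply: wderiv_continuous => t tI.
- exact: (wderiv_fx (ws_deriv ws) tI).
- exact: (wderiv_fy (ws_deriv ws) tI).
- exact: (wderiv_fz (ws_deriv ws) tI).
Qed.

Lemma vertical_curve_of_vdisp (g : R -> heis R) : {within `[0, l], continuous g} ->
  (forall s t : R, 0 <= s -> s <= t -> t <= l ->
    lam' * ((xc (g t) - xc (g s)) ^+ 2 + (yc (g t) - yc (g s)) ^+ 2) <= vdisp (g s) (g t)) ->
  (forall s t : R, 0 <= s -> s < t -> t <= l -> 0 < vdisp (g s) (g t)) ->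
  vertical_curve lam' `[0, l] g.
Proof.
move=> gc gv gp; split; last exact: vertical_image.
split=> // s t; rewrite !inE /= !in_itv /= => /andP[s0 sl] /andP[t0 tl] E.
have v0 (p : heis R) : vdisp p p = 0 by rewrite /vdisp; ring.
have [st|st|//] := ltgtP s t.
- by have := gp _ _ s0 st tl; rewrite E v0 ltxx.
- by have := gp _ _ t0 st sl; rewrite E v0 ltxx.
Qed.

Lemma stage_vertical_curve n : vertical_curve lam' `[0, l] (stage D n).
Proof.
apply: vertical_curve_of_vdisp; first exact: stage_within_continuous.
- by move=> s t s0 st tl; exact: (gf_vert gf n s0 st tl).
- by move=> s t s0 st tl; exact: (gf_pos gf n s0 st tl).
Qed.

Lemma stage_hdist_sq n (s t : R) : 0 <= s -> s <= t -> t <= l ->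
  hdist (stage D n s) (stage D n t) ^+ 2 <=
  4 * speed D n * (t - s) + 6 * Lk D L n ^+ 2 * (t - s) ^+ 2.
Proof.
move=> s0 st tl; rewrite hdistC; apply: le_trans (hdist_sq_le _ _) _.
have [h1 h2] := f_lip ws s0 st tl n; have h3 := vdisp_taylor ws s0 st tl n.
have ts : 0 <= t - s by rewrite subr_ge0.
have LT : 0 <= Lk D L n * (t - s) by rewrite mulr_ge0 // (Lk_ge0 ws).
have sq (a : R) : `|a| <= Lk D L n * (t - s) -> a ^+ 2 <= Lk D L n ^+ 2 * (t - s) ^+ 2.
  by move=> ha; rewrite -exprMn -[a ^+ 2]real_normK ?num_real // ler_sqr ?nnegrE.
have {}h1 := sq _ h1; have {}h2 := sq _ h2.
have h4 : `|vdisp (stage D n s) (stage D n t)| <=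
   speed D n * (t - s) + Lk D L n ^+ 2 * (t - s) ^+ 2.
  rewrite -[vdisp _ _](subrK (speed D n * (t - s))).
  apply: le_trans (ler_normD _ _) _.
  by rewrite [X in _ + X]ger0_norm ?mulr_ge0 ?(ltW (speed_gt0 ws n)) //; lra.
rewrite /stage /xc /yc /= in h1 h2 *; rewrite /stage in h4; lra.
Qed.

(** In a partition into N pieces the linear parts of the squared diameters sum to 4 v l and the
    quadratic parts are O(1/N). Accepting 8 v l instead loses a factor 2, which is harmless since
    the speed can be made arbitrarily small. *)
Lemma stage_H2hat_le n : (H2hat (stage D n @` `[0%R, l]) <= (2 * speed D n * l)%:E)%E.
Proof.
rewrite H2hatE; have v0 := speed_gt0 ws n.
suff H : (hausdorff_measure (@hdist R) 2 (stage D n @` `[0%R, l]) <= (8 * speed D n * l)%:E)%E.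
  apply: le_trans (lee_wpmul2l _ H) _; first by rewrite lee_fin invr_ge0.
  by rewrite -EFinM lee_fin le_eqVlt; apply/orP; left; apply/eqP; field.
apply: ge_ereal_sup => _ [delta /= d0 <-].
set v := speed D n in v0 *; set B := Lk D L n.
pose A := 4 * v * l + 6 * B ^+ 2 * l ^+ 2.
have B0 : 0 <= B by exact: (Lk_ge0 ws).
have B2 : 0 <= 6 * B ^+ 2 by apply: mulr_ge0 => //; exact: sqr_ge0.
have A0 : 0 < A.
  apply: ltr_pwDl; first by rewrite !mulr_gt0.
  by apply: mulr_ge0 => //; exact: sqr_ge0.
(* The first summand makes the pieces finer than delta, the second makes the quadratic parts smaller
   than 4 v l. *)
pose N := (Num.truncn (A / delta ^+ 2 + 2 * B ^+ 2 * l / v)).+1.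
have NP : A / delta ^+ 2 + 2 * B ^+ 2 * l / v < N%:R by exact: truncnS_gt.
have p1 : 0 <= A / delta ^+ 2 by rewrite divr_ge0 ?(ltW A0) // sqr_ge0.
have p2 : 0 <= 2 * B ^+ 2 * l / v.
  apply: divr_ge0; last exact: ltW.
  by apply: mulr_ge0; [move: B2; lra|exact: ltW].
have N0 : 0 < N%:R :> R by rewrite ltr0n.
have N1 : 1 <= N%:R :> R by rewrite ler1n.
pose h := l / N%:R.
have h0 : 0 < h by rewrite divr_gt0.
have hN : h * N%:R = l by rewrite /h divfK // gt_eqF.
pose E := 4 * v * h + 6 * B ^+ 2 * h ^+ 2.
have E0 : 0 <= E.
  by apply: addr_ge0; apply: mulr_ge0; rewrite ?sqr_ge0 ?(ltW h0) // mulr_ge0 // ltW.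
have EN : N%:R * E = 4 * v * l + 6 * B ^+ 2 * l * h by rewrite -hN /E; ring.
have hl : h <= l by rewrite -hN ler_peMr // ltW.
have EA : N%:R * E <= A.
  have := ler_wpM2l (mulr_ge0 B2 (ltW l0)) hl; rewrite EN /A !expr2; lra.
have Ed : E <= delta ^+ 2.
  rewrite -(ler_pM2l N0); apply: le_trans EA _.
  by rewrite -ler_pdivrMr ?exprn_gt0 //; lra.
have EB : N%:R * E <= 8 * v * l.
  have : 2 * B ^+ 2 * l <= v * N%:R by rewrite [v * _]mulrC -ler_pdivrMr //; lra.
  move=> /(ler_wpM2r (ltW h0)); rewrite -(mulrA v) [N%:R * h]mulrC hN.
  have : 0 <= v * l by rewrite mulr_ge0 // ltW.
  rewrite EN; lra.
have S2 : Num.sqrt E ^+ 2 = E by rewrite sqr_sqrtr.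
apply: le_trans (@hausdorff_content_image_le R _ (@hdist R) (stage D n) l 2 delta (Num.sqrt E) N _ _ _ _ _ _) _ => //.
- by rewrite -(@ler_pXn2r _ 2) ?nnegrE ?(ltW d0) ?sqrtr_ge0 // S2.
- move=> s t; rewrite !in_itv /= => /andP[s0 sl] /andP[t0 tl] st.
  rewrite -(@ler_pXn2r _ 2) ?nnegrE ?hdist_ge0 ?sqrtr_ge0 // S2.
  wlog le_st : s t s0 sl t0 tl st / s <= t.
    move=> H; have [/H|/ltW ts] := leP s t; first exact.
    by rewrite hdistC; apply: H => //; rewrite distrC.
  apply: le_trans (stage_hdist_sq n s0 le_st tl) _.
  have ts : 0 <= t - s by rewrite subr_ge0.
  have th : t - s <= h by move: st; rewrite distrC ger0_norm.
  rewrite /E lerD //; first by rewrite ler_wpM2l // mulr_ge0 // ltW.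
  by rewrite ler_wpM2l ?mulr_ge0 ?sqr_ge0 // ler_sqr ?nnegrE // ltW.
- by rewrite -[2]/(2%:R) powR_mulrn ?sqrtr_ge0 // S2 lee_fin.
Qed.

(** The linear lower bound shows that points close in distance are close in time; there the Taylor
    bound gives vdisp >= v tau / 2, so the squared distance is at least 2 v tau. Dividing by the
    measure 4 of the unit segment gives v l / 2. *)
Lemma stage_H2hat_ge n : ((speed D n * l / 2)%:E <= H2hat (stage D n @` `[0%R, l]))%E.
Proof.
rewrite H2hatE; have v0 := speed_gt0 ws n.
have [ka ka0 kaP] := @vdisp_linear_lower R (stage D n) l (speed D n) (Lk D L n) lam'
  l0 v0 (Lk_ge0 ws n) lam'0 (fun s t s0 st tl => vdisp_taylor ws s0 st tl n)
  (fun s t s0 st tl => f_lip ws s0 st tl n)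
  (fun s t s0 st tl => gf_vert gf n s0 (ltW st) tl) 
  (fun s t s0 st tl => gf_pos gf n s0 st tl).
set v := speed D n in v0 *; set B := Lk D L n.
have B2 : 0 < B ^+ 2 + 1 by rewrite ltr_pwDr // sqr_ge0.
pose eta := v / (2 * (B ^+ 2 + 1)).
have eta0 : 0 < eta by rewrite divr_gt0 // mulr_gt0.
have etaE : B ^+ 2 * eta <= v / 2.
  have : eta * (2 * (B ^+ 2 + 1)) = v by rewrite /eta divfK // gt_eqF // mulr_gt0.
  by move: (ltW eta0); lra.
clearbody eta; pose delta := Num.sqrt (4 * ka * eta).
have de0 : 0 < delta by rewrite sqrtr_gt0 !mulr_gt0.
have deE : delta ^+ 2 = 4 * ka * eta by rewrite sqr_sqrtr // !mulr_ge0 // ltW.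
apply: (@le_trans _ _ ((4^-1)%:E * (2 * v * l)%:E)%E).
  by rewrite -EFinM lee_fin le_eqVlt; apply/orP; left; apply/eqP; field.
apply: lee_wpmul2l; first by rewrite lee_fin invr_ge0.
apply: (@hausdorff_measure_image_ge R _ (@hdist R) (@hdist_ge0 R) (stage D n) l 2 (2 * v) delta) => //.
  by rewrite mulr_gt0.
move=> s t; rewrite !in_itv /= => /andP[s0 sl] /andP[t0 tl].
rewrite -[2]/(2%:R) powR_mulrn ?hdist_ge0 //.
wlog st : s t s0 sl t0 tl / s <= t.
  move=> H; have [/H|/ltW ts] := leP s t; first exact.
  by rewrite hdistC distrC; exact: H.
rewrite distrC hdistC (ger0_norm (_ : 0 <= t - s)) ?subr_ge0 // => dd.
have ts : 0 <= t - s by rewrite subr_ge0.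
have d4 := hdist_sq_ge (stage D n t) (stage D n s).
have d2 : hdist (stage D n t) (stage D n s) ^+ 2 <= delta ^+ 2.
  by rewrite ler_sqr ?nnegrE ?hdist_ge0 // ltW.
have K := kaP _ _ s0 st tl.
have vn := ler_norm (vdisp (stage D n s) (stage D n t)).
have te : t - s <= eta.
  by rewrite -(ler_pM2l ka0); move: d2; rewrite deE; lra.
have := vdisp_taylor ws s0 st tl n; rewrite -/v -/B ler_norml.
have : B ^+ 2 * (t - s) ^+ 2 <= v / 2 * (t - s).
  rewrite expr2 mulrA ler_wpM2r //; apply: le_trans etaE.
  by rewrite ler_wpM2l // sqr_ge0.
lra.
Qed.

End stage_curves.

(** * Hausdorff dimension of the limit curve *)

Lemma powR_exprn (R : realType) (x b : R) n : 0 <= x -> (x ^+ n) `^ b = (x `^ b) ^+ n.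
Proof.
by move=> x0; rewrite -powR_mulrn // powRAC powR_mulrn // powR_ge0.
Qed.

(** The critical exponent ln Q / (ln Q - ln k) is below 1; b is its midpoint with 1, for which the
    logarithm of the product is ln k / 2. *)
Lemma exponent_lt1 (R : realType) (k Q : R) : 0 < k < 1 -> 1 < Q ->
  exists2 b : R, 0 < b < 1 & Q * (k / Q) `^ b < 1.
Proof.
move=> /andP[k0 k1] Q1; have Q0 : 0 < Q by apply: lt_trans Q1.
have a0 : 0 < ln Q by rewrite ln_gt0.
have b0 : ln k < 0 by rewrite ln_lt0 // k0.
pose b := (1 + ln Q / (ln Q - ln k)) / 2.
have ab : 0 < ln Q - ln k by lra.
have r0 : 0 < ln Q / (ln Q - ln k) by rewrite divr_gt0.
have r1 : ln Q / (ln Q - ln k) < 1 by rewrite ltr_pdivrMr //; lra.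
exists b; first by rewrite /b; apply/andP; split; lra.
rewrite /powR gt_eqF ?divr_gt0 // -{1}(lnK Q0) -expRD ln_div ?posrE //.
have -> : ln Q + b * (ln k - ln Q) = ln k / 2.
  by rewrite /b; field; rewrite gt_eqF.
by rewrite -[ltRHS]expR0 ltr_expR pmulr_llt0.
Qed.

(** Here the critical exponent itself serves, because the lower bound for the measure needs no
    decay. *)
Lemma exponent_gt1 (R : realType) (k Q : R) : 1 < k -> k < Q ->
  exists2 b : R, 1 < b & (k / Q) `^ b = Q^-1.
Proof.
move=> k1 kQ; have k0 : 0 < k by apply: lt_trans k1.
have Q0 : 0 < Q by apply: lt_trans kQ.
have b0 : 0 < ln k by rewrite ln_gt0.
have ab : ln k < ln Q by rewrite ltr_ln ?posrE.
exists (ln Q / (ln Q - ln k)); first by rewrite ltr_pdivlMr; lra.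
rewrite /powR gt_eqF ?divr_gt0 // ln_div ?posrE //.
have -> : ln Q / (ln Q - ln k) * (ln k - ln Q) = - ln Q.
  by field; rewrite gt_eqF // subr_gt0.
by rewrite expRN lnK.
Qed.

Lemma natr_le_expr (R : realType) (a : R) n : 2 <= a -> n.+1%:R <= a ^+ n.
Proof.
move=> a2; elim: n => [|n IH]; first by rewrite expr0.
rewrite exprS; have h : 1 <= n.+1%:R :> R by rewrite ler1n.
have : 2 * a ^+ n <= a * a ^+ n by rewrite ler_wpM2r // exprn_ge0 //; lra.
rewrite -natr1; lra.
Qed.

Lemma expr_lt_ex (R : realType) (a e : R) : 0 <= a < 1 -> 0 < e -> exists n, a ^+ n < e.
Proof.
move=> /andP[a0 a1] e0.
have : geometric 1 a n @[n --> \oo] --> (0 : R).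
  by apply: cvg_geometric; rewrite ger0_norm.
move=> /cvgrPdist_lt /(_ _ e0) [N _ NH]; exists N.
have := NH N (leqnn N); rewrite /= sub0r normrN mul1r.
by apply: le_lt_trans; exact: ler_norm.
Qed.

Section limit_dimension.
Context {R : realType}.
Variables (alpha : R -> heis R) (D : wiggle R) (l L c q W0 sg lam' kap eps : R).
Hypothesis gf : good_family alpha D l L c q W0 sg lam' kap eps.
Variable F : R -> heis R.
Hypothesis FP : {in `[0, l], forall t, [/\ fx D n t @[n --> \oo] --> xc (F t),
        fy D n t @[n --> \oo] --> yc (F t) & fz D n t @[n --> \oo] --> zc (F t)]}.

Let ws := gf_ws gf.
Let l0 := ws_l ws.
Let c0 := ws_c ws.
Let q200 := ws_q ws.
Let r0 := ws_rad ws.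
Let Wp := ws_freq ws.
Let q0 : 0 < q. Proof. by apply: lt_le_trans q200. Qed.
Let q2 : 2 <= q ^+ 2. Proof. by rewrite expr2; move: q200; nra. Qed.

Section two_points.
Variables (s t : R).
Hypotheses (s0 : 0 <= s) (st : s <= t) (tl : t <= l).
Local Notation tau := (t - s).

Let Fs : [/\ fx D n s @[n --> \oo] --> xc (F s),
        fy D n s @[n --> \oo] --> yc (F s) & fz D n s @[n --> \oo] --> zc (F s)].
Proof. by apply: FP; rewrite in_itv /= s0 (le_trans st). Qed.
Let Ft : [/\ fx D n t @[n --> \oo] --> xc (F t),
        fy D n t @[n --> \oo] --> yc (F t) & fz D n t @[n --> \oo] --> zc (F t)].
Proof. by apply: FP; rewrite in_itv /= tl (le_trans s0). Qed.

Lemma limit_vdisp_ge (N : nat) (B : R) :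
  (forall n, (N <= n)%N -> B <= vdisp (stage D n s) (stage D n t)) ->
  B <= vdisp (F s) (F t).
Proof.
move=> H; apply: (ler_cvg_to (cvg_cst B) (vdisp_cvg Fs Ft)).
by exists N.
Qed.

Lemma limit_vertical :
  lam' * ((xc (F t) - xc (F s)) ^+ 2 + (yc (F t) - yc (F s)) ^+ 2) <= vdisp (F s) (F t).
Proof.
apply: (ler_cvg_to (cvgM (cvg_cst lam') (planar_cvg Fs Ft)) (vdisp_cvg Fs Ft)).
by exists 0%N => // n _; exact: (gf_vert gf n s0 st tl).
Qed.

Lemma limit_hdist_sq_le (N : nat) (B : R) :
  (forall n, (N <= n)%N -> (fx D n t - fx D n s) ^+ 2 + (fy D n t - fy D n s) ^+ 2 +
     4 * `|vdisp (stage D n s) (stage D n t)| <= B) ->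
  hdist (F s) (F t) ^+ 2 <= B.
Proof.
move=> H; rewrite hdistC; apply: le_trans (hdist_sq_le _ _) _.
have C : (fx D n t - fx D n s) ^+ 2 + (fy D n t - fy D n s) ^+ 2 +
     4 * `|vdisp (stage D n s) (stage D n t)| @[n --> \oo] -->
  (xc (F t) - xc (F s)) ^+ 2 + (yc (F t) - yc (F s)) ^+ 2 + 4 * `|vdisp (F s) (F t)|.
  apply: cvgD; first exact: planar_cvg.
  by apply: cvgM; [exact: cvg_cst|apply: cvg_norm; exact: vdisp_cvg].
by apply: (ler_cvg_to C (cvg_cst B)); exists N.
Qed.

(** For fixed s < t the frequency eventually exceeds q / tau, so only the first two regimes remain,
    and their lower bounds hold for all later stages. *)
Lemma limit_lower : s < t ->
  (q < wfreq D 0 * tau /\ kap * tau <= vdisp (F s) (F t)) \/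
  exists2 k, q^-1 <= wfreq D k * tau <= q &
    rad D k ^+ 2 * (wfreq D k * tau) <= vdisp (F s) (F t).
Proof.
move=> st'; have ts : 0 < tau by rewrite subr_gt0.
(* Since q^2 >= 2, the frequency at index N is at least (N + 1) W0, which rules out the last
   regime. *)
pose N := Num.truncn (q / (W0 * tau)).
have NP : q / (W0 * tau) < N.+1%:R by exact: truncnS_gt.
have WN : q < wfreq D N * tau.
  have [_ -> _] := gf_formula gf N.
  have := natr_le_expr N q2 => h; have := lt_le_trans NP h.
  rewrite ltr_pdivrMr ?mulr_gt0 ?(gf_W0 gf) //.
  by congr (_ < _); ring.
case: (scale_cases ws s t N) => [h|[k kN h]|h].
- left; split => //; apply: (@limit_vdisp_ge 0) => n _.
  exact: (gf_large gf n s0 st tl h).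
- right; exists k => //; apply: (@limit_vdisp_ge N) => n Nn.
  apply: le_trans (scale_vdisp ws s0 st tl (leq_trans kN Nn) h).
  rewrite ler_peMr ?(gf_c gf) // mulr_ge0 ?sqr_ge0 //.
  by rewrite mulr_ge0 // ltW.
- by move: (lt_le_trans WN h); rewrite ltxx.
Qed.

Lemma limit_pos : s < t -> 0 < vdisp (F s) (F t).
Proof.
move=> st'; have ts : 0 < tau by rewrite subr_gt0.
case: (limit_lower st') => [[_]|[k _]]; apply: lt_le_trans.
- by rewrite mulr_gt0 // (gf_kap gf).
- by rewrite !mulr_gt0 // exprn_gt0.
Qed.

(** Within time 1 / W_k the motion of stage k and of all later helices is O(r_k). The planar part
    contributes 2 * 25 r^2 and the vertical part 4 (1/(2c) + 34) r^2, which add up to the stated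
    constant. *)
Lemma limit_upper k : wfreq D k * tau <= 1 ->
  hdist (F s) (F t) ^+ 2 <= (186 + 2 / c) * rad D k ^+ 2.
Proof.
move=> th1; have ts : 0 <= tau by rewrite subr_ge0.
apply: (@limit_hdist_sq_le k) => n kn.
set r := rad D k; have rk : 0 < r := r0 k; have rn := r0 n.
have rkn := rad_le ws kn.
have Lt : Lk D L k * tau <= r.
  apply: le_trans (ler_wpM2r ts (Lk_le ws k)) _.
  have -> : 4 / q * (rad D k * wfreq D k) * tau = r * (4 / q * (wfreq D k * tau)) by rewrite /r; ring.
  rewrite ler_piMr ?(ltW rk) //.
  have h4 : 4 / q <= 1 by rewrite ler_pdivrMr //; move: q200; lra.
  apply: le_trans (ler_pM _ _ h4 th1) _; rewrite ?mulr1 // ?divr_ge0 ?mulr_ge0 ?(ltW (Wp k)) ?(ltW q0) //.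
have L0 : 0 <= Lk D L k * tau by rewrite mulr_ge0 // (Lk_ge0 ws).
have [t1 t2] := f_tail ws s t kn; have [l1 l2] := f_lip ws s0 st tl k.
have T := vdisp_tail ws s0 st tl kn; have Y := vdisp_taylor ws s0 st tl k.
have sq (a b : R) : `|a - b| <= 4 * (rad D k - rad D n) -> `|b| <= Lk D L k * tau ->
    a ^+ 2 <= 25 * r ^+ 2.
  move=> h1 h2; have -> : 25 * r ^+ 2 = (5 * r) ^+ 2 by ring.
  rewrite -[a ^+ 2]real_normK ?num_real // ler_sqr ?nnegrE ?mulr_ge0 ?(ltW rk) //.
  rewrite -(subrK b a); apply: le_trans (ler_normD _ _) _.
  by move: h1 h2 Lt rn; rewrite -/r; lra.
have X1 := sq _ _ t1 l1; have X2 := sq _ _ t2 l2.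
have sp : speed D k * tau <= r ^+ 2 * (2 * c)^-1.
  have -> : speed D k = r ^+ 2 * wfreq D k * (2 * c)^-1.
    by rewrite /r (ws_speed ws) mulrC mulKf // gt_eqF // mulr_gt0.
  have -> : r ^+ 2 * wfreq D k * (2 * c)^-1 * tau = r ^+ 2 * (2 * c)^-1 * (wfreq D k * tau) by ring.
  by rewrite ler_piMr // mulr_ge0 ?sqr_ge0 // invr_ge0 mulr_ge0 // ltW.
have sp0 : 0 <= speed D k * tau by rewrite mulr_ge0 // ltW // (speed_gt0 ws).
have Y2 : Lk D L k ^+ 2 * tau ^+ 2 <= r ^+ 2.
  by rewrite -exprMn ler_sqr ?nnegrE // ltW.
have T2 : `|vdisp (stage D n s) (stage D n t) - vdisp (stage D k s) (stage D k t)| <= 33 * r ^+ 2.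
  apply: le_trans T _.
  have B : 4 * (Lk D L k * tau) + 25 / 2 * rad D k <= 33 / 2 * r by rewrite -/r; lra.
  apply: le_trans (ler_pM _ _ (_ : 2 * (rad D k - rad D n) <= 2 * r) B) _.
  - by rewrite mulr_ge0 // subr_ge0.
  - by move: L0 (r0 k); lra.
  - by rewrite /r; lra.
  - by rewrite expr2; lra.
have V : `|vdisp (stage D n s) (stage D n t)| <= r ^+ 2 * (2 * c)^-1 + 34 * r ^+ 2.
  have -> : vdisp (stage D n s) (stage D n t) =
    (vdisp (stage D n s) (stage D n t) - vdisp (stage D k s) (stage D k t)) +
    (vdisp (stage D k s) (stage D k t) - speed D k * tau) + speed D k * tau by ring.
  apply: le_trans (ler_normD _ _) _.
  apply: le_trans (lerD (ler_normD _ _) (lexx _)) _.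
  by rewrite [X in _ + X]ger0_norm //; lra.
have -> : (186 + 2 / c) * r ^+ 2 = 50 * r ^+ 2 + 4 * (r ^+ 2 * (2 * c)^-1 + 34 * r ^+ 2).
  by field; rewrite gt_eqF.
lra.
Qed.

End two_points.

Lemma gf_c_le : c <= 5^-1.
Proof.
have h : 5 / 2 <= (2 * c)^-1 by have := gf_c gf; lra.
have : 5 / 2 * (2 * c) <= 1.
  by rewrite -ler_pdivlMr ?mulr_gt0 // div1r.
lra.
Qed.

Let Q := q ^+ 2.
Let Q1 : 1 < Q. Proof. by rewrite /Q; move: q2; lra. Qed.
Let Q0 : 0 < Q. Proof. by apply: lt_trans Q1. Qed.
Let W0p : 0 < W0 := gf_W0 gf.

Lemma hdist_powR (a b : heis R) (e : R) : hdist a b `^ (2 * e) = (hdist a b ^+ 2) `^ e.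
Proof. by rewrite powRrM -[2]/(2%:R) powR_mulrn ?hdist_ge0. Qed.

(** About l W_k pieces of squared diameter A (ka / Q)^k cover the curve, so the sum for exponent 2b
    is O((Q (ka / Q)^b)^k), which tends to 0 for the b < 1 of [exponent_lt1]. *)
Lemma limit_dim_lt2 : sg = 1 -> (hausdorff_dim (@hdist R) (F @` `[0%R, l]) < 2%:E)%E.
Proof.
move=> sg1; have c5 := gf_c_le.
pose ka := 1 - sg * c.
have ka01 : 0 < ka < 1 by rewrite /ka sg1; move: c0 c5; lra.
have /andP[ka0 ka1] := ka01.
have [b /andP[b0 b1] bQ] := exponent_lt1 ka01 Q1.
pose C := 186 + 2 / c.
have C0 : 0 < C by rewrite ltr_pwDl // divr_ge0 // ltW.
pose A := 2 * c * C / W0.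
have A0 : 0 < A by rewrite divr_gt0 // !mulr_gt0.
have radE k : C * rad D k ^+ 2 = A * (ka / Q) ^+ k.
  have [-> _ _] := gf_formula gf k; rewrite -/ka -/Q expr_div_n /A.
  by field; rewrite ?gt_eqF ?exprn_gt0.
have kaQ0 : 0 < ka / Q by rewrite divr_gt0.
have kaQ1 : ka / Q < 1 by rewrite ltr_pdivrMr // mul1r; exact: lt_trans ka1 Q1.
suff H : hausdorff_measure (@hdist R) (2 * b) (F @` `[0%R, l]) = 0%E.
  apply: (@le_lt_trans _ _ (2 * b)%:E); last by rewrite lte_fin; lra.
  by apply: ereal_inf_lbound; exists (2 * b) => //; split => //; rewrite mulr_ge0 // ltW.
apply/eqP; rewrite eq_le hausdorff_measure_ge0 andbT.
apply: ge_ereal_sup => _ [delta /= d0 <-].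
apply/lee_addgt0Pr => e e0; rewrite add0e.
pose G := (l + W0^-1) * W0 * A `^ b.
have G0 : 0 < G by rewrite !mulr_gt0 ?powR_gt0 // addr_gt0 // invr_gt0.
pose rho := Q * (ka / Q) `^ b.
have rho0 : 0 <= rho by rewrite mulr_ge0 ?powR_ge0 // ltW.
have [k1 k1P] := @expr_lt_ex R rho (e / G) (introT andP (conj rho0 bQ)) (divr_gt0 e0 G0).
have [k2 k2P] := @expr_lt_ex R (ka / Q) (delta ^+ 2 / A) (introT andP (conj (ltW kaQ0) kaQ1))
  (divr_gt0 (exprn_gt0 2 d0) A0).
(* k1 brings the sum below e and k2 brings the pieces below delta; both ratios are less than 1, so
   k1 + k2 achieves both. *)
pose k := (k1 + k2)%N.
have kP1 : rho ^+ k * G <= e.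
  rewrite -ler_pdivlMr //; apply: le_trans (ltW k1P); rewrite /k exprD.
  by rewrite ler_piMr ?exprn_ge0 // exprn_ile1 // ltW.
have kP2 : A * (ka / Q) ^+ k <= delta ^+ 2.
  rewrite mulrC -ler_pdivlMr //; apply: le_trans (ltW k2P); rewrite /k addnC exprD.
  by rewrite ler_piMr ?exprn_ge0 // ?exprn_ile1 // ltW.
have X0 : 0 <= A * (ka / Q) ^+ k by rewrite mulr_ge0 ?exprn_ge0 // ltW.
pose E := Num.sqrt (A * (ka / Q) ^+ k).
have E2 : E ^+ 2 = A * (ka / Q) ^+ k by rewrite sqr_sqrtr.
have E0 : 0 <= E by exact: sqrtr_ge0.
pose N := (Num.truncn (l * wfreq D k)).+1.
have NP : l * wfreq D k < N%:R by exact: truncnS_gt.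
have N0 : 0 < N%:R :> R by rewrite ltr0n.
have WE : wfreq D k = W0 * Q ^+ k by have [_ -> _] := gf_formula gf k.
have NW : N%:R <= (l + W0^-1) * W0 * Q ^+ k.
  have lW : 0 <= l * wfreq D k by rewrite mulr_ge0 ?ltW.
  have : N%:R <= l * wfreq D k + 1 :> R.
    by rewrite /N -natr1 lerD2r; have /andP[] := truncn_itv lW.
  rewrite WE mulrDl mulVf ?gt_eqF // mulrDl mul1r => h; apply: le_trans h _.
  by rewrite mulrA lerD2l exprn_ege1 // ltW.
apply: le_trans (@hausdorff_content_image_le R _ (@hdist R) F l (2 * b) delta E N _ _ _ _ _ _) _ => //.
- by rewrite mulr_ge0 // ltW.
- by rewrite -(@ler_pXn2r _ 2) ?nnegrE ?(ltW d0) // E2.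
- move=> s t; rewrite !in_itv /= => /andP[s0 sl] /andP[t0 tl] st.
  rewrite -(@ler_pXn2r _ 2) ?nnegrE ?hdist_ge0 // E2 -radE.
  wlog le_st : s t s0 sl t0 tl st / s <= t.
    move=> H; have [/H|/ltW ts] := leP s t; first exact.
    by rewrite hdistC; apply: H => //; rewrite distrC.
  apply: limit_upper => //.
  have ts : 0 <= t - s by rewrite subr_ge0.
  have th : t - s <= l / N%:R by move: st; rewrite distrC ger0_norm.
  rewrite mulrC; apply: le_trans (ler_wpM2r (ltW (Wp k)) th) _.
  by rewrite mulrAC ler_pdivrMr // mul1r ltW.
- rewrite lee_fin; apply: le_trans kP1.
  have -> : E `^ (2 * b) = A `^ b * ((ka / Q) `^ b) ^+ k.
    rewrite powRrM -[2]/(2%:R) powR_mulrn // E2 powRM ?(ltW A0) ?exprn_ge0 ?(ltW kaQ0) //.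
    by rewrite powR_exprn // ltW.
  have -> : rho ^+ k * G = (l + W0^-1) * W0 * Q ^+ k * (A `^ b * ((ka / Q) `^ b) ^+ k).
    by rewrite /rho /G exprMn; ring.
  by rewrite ler_wpM2r // mulr_ge0 ?powR_ge0 // exprn_ge0 // powR_ge0.
Qed.

(** In the window of helix k the squared distance is at least 4 r_k^2 / q = A (ka / Q)^k; its b-th
    power is A^b / Q^k, which dominates a multiple of tau because W_k tau <= q. Hence every exponent
    below 2b has positive measure, and b > 1. *)
Lemma limit_dim_gt2 : sg = -1 -> (2%:E < hausdorff_dim (@hdist R) (F @` `[0%R, l]))%E.
Proof.
move=> sgN; have c5 := gf_c_le.
pose ka := 1 - sg * c.
have kaE : ka = 1 + c by rewrite /ka sgN mulN1r opprK.
have ka1 : 1 < ka by rewrite kaE; move: c0; lra.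
have ka0 : 0 < ka by apply: lt_trans ka1.
have kaQ : ka < Q by rewrite kaE /Q; move: c5 q2; lra.
have [b b1 bQ] := exponent_gt1 ka1 kaQ.
have b0 : 0 < b by apply: lt_trans b1.
pose A := 8 * c / (W0 * q).
have A0 : 0 < A by rewrite divr_gt0 ?mulr_gt0.
have kaQ0 : 0 < ka / Q by rewrite divr_gt0.
pose X := 4 * kap * q / W0.
have X0 : 0 < X by rewrite divr_gt0 // !mulr_gt0 // (gf_kap gf).
(* The bound by sqrt X excludes times above q / W0, where only kap is available; the bound by 1 lets
   the exponent decrease from 2b to s'. *)
pose delta := Num.min 1 (Num.sqrt X).
have de0 : 0 < delta by rewrite lt_min ltr01 sqrtr_gt0.
have de1 : delta <= 1 by rewrite ge_min lexx.
have deX : delta ^+ 2 <= X.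
  rewrite -[leRHS]sqr_sqrtr ?(ltW X0) // ler_sqr ?nnegrE ?sqrtr_ge0 ?(ltW de0) //.
  by rewrite ge_min lexx orbT.
pose c1 := A `^ b * W0 / q.
have c10 : 0 < c1 by rewrite divr_gt0 // mulr_gt0 // powR_gt0.
have lower (s t : R) : 0 <= s -> s <= t -> t <= l -> hdist (F t) (F s) <= delta ->
    c1 * (t - s) <= hdist (F t) (F s) `^ (2 * b).
  move=> s0; rewrite le_eqVlt => /predU1P[<- _ _|st tl hd].
    by rewrite subrr mulr0 powR_ge0.
  have d4 := hdist_sq_ge (F t) (F s).
  have d2 : hdist (F t) (F s) ^+ 2 <= delta ^+ 2.
    by rewrite ler_sqr ?nnegrE ?hdist_ge0 // ltW.
  have vn := ler_norm (vdisp (F s) (F t)).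
  case: (limit_lower s0 (ltW st) tl st) => [[h1 h2]|[k /andP[th1 th2] h]].
    have [_ W0E _] := gf_formula gf 0; rewrite W0E expr0 mulr1 in h1.
    have : X < 4 * (kap * (t - s)).
      rewrite /X ltr_pdivrMr //.
      have : kap * q < kap * (W0 * (t - s)) by rewrite ltr_pM2l ?(gf_kap gf).
      lra.
    lra.
  have [rE WE _] := gf_formula gf k; rewrite -/ka -/Q in rE; rewrite -/Q in WE.
  have Qk : 0 < Q ^+ k by rewrite exprn_gt0.
  rewrite hdist_powR.
  have h3 : A * (ka / Q) ^+ k <= hdist (F t) (F s) ^+ 2.
    have r2 : 0 <= rad D k ^+ 2 by rewrite sqr_ge0.
    have := ler_wpM2l r2 th1.
    have -> : A * (ka / Q) ^+ k = 4 * (rad D k ^+ 2 * q^-1).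
      rewrite rE expr_div_n /A; field.
      by rewrite ?gt_eqF ?exprn_gt0.
    lra.
  apply: (@le_trans _ _ ((A * (ka / Q) ^+ k) `^ b)); last first.
    apply: ge0_ler_powR => //; first exact: ltW.
    - by rewrite nnegrE mulr_ge0 ?exprn_ge0 // ltW.
    - by rewrite nnegrE sqr_ge0.
  rewrite powRM ?(ltW A0) ?exprn_ge0 ?(ltW kaQ0) // powR_exprn ?(ltW kaQ0) // bQ exprVn.
  rewrite ler_pdivlMr //.
  have -> : c1 * (t - s) * Q ^+ k = A `^ b * (q^-1 * (W0 * Q ^+ k * (t - s))).
    by rewrite /c1; ring.
  rewrite ler_piMr ?powR_ge0 // mulrC ler_pdivrMr // mul1r -WE.
  exact: th2.
apply: (@lt_le_trans _ _ (2 * b)%:E); first by rewrite lte_fin; lra.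
apply: le_ereal_inf_tmp => _ [s' [s'0 Hs'] <-]; rewrite lee_fin leNgt; apply/negP => s'b.
suff : ((c1 * l)%:E <= hausdorff_measure (@hdist R) s' (F @` `[0%R, l]))%E.
  by rewrite Hs' lee_fin leNgt mulr_gt0.
apply: (@hausdorff_measure_image_ge R _ (@hdist R) (@hdist_ge0 R) F l s' c1 delta) => //.
move=> s t; rewrite !in_itv /= => /andP[s0 sl] /andP[t0 tl].
wlog st : s t s0 sl t0 tl / s <= t.
  move=> H; have [/H|/ltW ts] := leP s t; first exact.
  by rewrite hdistC distrC; exact: H.
rewrite distrC hdistC (ger0_norm (_ : 0 <= t - s)) ?subr_ge0 // => dd.
have low := lower _ _ s0 st tl dd.
have [d0|d0] := eqVneq (hdist (F t) (F s)) 0.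
  apply: le_trans (powR_ge0 _ _); apply: le_trans low _.
  by rewrite d0 powR0 // mulf_neq0 // gt_eqF.
apply: le_trans low _; apply: ger_powR; last exact: ltW.
by rewrite lt_neqAle eq_sym d0 hdist_ge0 /= (le_trans dd).
Qed.

End limit_dimension.

(** * Construction from the given curve *)

Section from_alpha.
Context {R : realType}.
Variables (lam lam' eps l : R) (alpha : R -> heis R) (m : R).
Hypotheses (hlam : 0 < lam) (hlam' : 0 < lam') (heps : 0 < eps).
Hypotheses (hlam'lam : lam' < lam) (hl : 0 < l).
Hypothesis alpha_smooth : smooth_on `[0, l] alpha.
Hypothesis alpha_uvs : unit_vertical_speed `[0, l] alpha.
Hypothesis alpha_vert : vertical_curve lam `[0, l] alpha.
Hypotheses (hm : 0 < m) (alpha_slope : slope_at_least m `[0, l] alpha).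

Let x t := xc (alpha t).
Let y t := yc (alpha t).
Let z t := zc (alpha t).
Let da := derive_within `[0, l] alpha.
Let dx t := xc (da t).
Let dy t := yc (da t).

Lemma heis_eta (p : heis R) : (xc p, yc p, zc p) = p.
Proof. by rewrite /xc /yc /zc -!surjective_pairing. Qed.

Lemma alpha_wderiv : {in `[0, l], forall t,
  [/\ wderiv l x t (dx t), wderiv l y t (dy t) & wderiv l z t (zc (da t))]}.
Proof.
move=> t tI; apply/(wderiv_heis l alpha t).
by rewrite /dx /dy heis_eta; exact: (smooth_wsmooth alpha_smooth).1.
Qed.

Lemma alpha_wsmooth : [/\ wsmooth l x, wsmooth l y, wsmooth l z & wsmooth l dx /\ wsmooth l dy].
Proof.
have [_ /wsmooth_heis [? ? ?]] := smooth_wsmooth alpha_smooth.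
have das : smooth_on `[0, l] da.
  by move=> n t tI; rewrite /da -iterSr; exact: alpha_smooth.
by have [_ /wsmooth_heis [? ? ?]] := smooth_wsmooth das.
Qed.

Lemma alpha_velocity t : t \in `[0, l] ->
  left_velocity `[0, l] alpha t =
  (dx t, dy t, zc (da t) - 2^-1 * (x t * dy t - y t * dx t)).
Proof.
move=> tI; have [Dx Dy Dz] := alpha_wderiv tI.
suff H : wderiv l (fun u => hmul (hinv (alpha t)) (alpha u)) t
    ((dx t, dy t, zc (da t) - 2^-1 * (x t * dy t - y t * dx t)) : heis R).
  by have [_] := wderiv_derivable hl tI H.
have C (a : R) : wderiv l (fun=> a) t (0 : R) by exact: wderiv_cst.
apply/wderiv_heis; split.
- have : wderiv l (fun u => xc (hinv (alpha t)) + x u) t (0 + dx t) by exact: wderivD.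
  by rewrite add0r.
- have : wderiv l (fun u => yc (hinv (alpha t)) + y u) t (0 + dy t) by exact: wderivD.
  by rewrite add0r.
- have : wderiv l (fun u => zc (hinv (alpha t)) + z u +
     2^-1 * (xc (hinv (alpha t)) * y u - yc (hinv (alpha t)) * x u)) t
     (0 + zc (da t) + 2^-1 * (xc (hinv (alpha t)) * dy t - yc (hinv (alpha t)) * dx t)).
    apply: wderivD; first exact: wderivD.
    by apply: wderivZ; apply: wderivD; [exact: wderivZ|apply: wderivN; exact: wderivZ].
  have -> : (fun u => zc (hinv (alpha t)) + z u +
     2^-1 * (xc (hinv (alpha t)) * y u - yc (hinv (alpha t)) * x u)) =
    (fun u => zc (hmul (hinv (alpha t)) (alpha u))).
    by apply/funext => u; rewrite /hmul /zc /= [_ * yc (hinv _)]mulrC.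
  congr wderiv; rewrite /hinv /xc /yc /=.
  by rewrite /x /y /xc /yc; ring.
Qed.

(** Positive orientation removes the absolute value in the unit-speed condition; the given curve
    thus has the form required of stage 0, with speed 1. *)
Lemma alpha_zderiv t : t \in `[0, l] ->
  wderiv l z t (1 + 2^-1 * (x t * dy t - y t * dx t)).
Proof.
move=> tI; have [_ _ Dz] := alpha_wderiv tI.
have E : zc (da t) = 1 + 2^-1 * (x t * dy t - y t * dx t).
  have := alpha_uvs tI; have := alpha_slope.1 _ tI.
  rewrite alpha_velocity // /zc /= => h; rewrite gtr0_norm // => h2; lra.
by rewrite -E.
Qed.

Lemma alpha_planar_speed t : t \in `[0, l] -> `|dx t| <= m^-1 /\ `|dy t| <= m^-1.
Proof.
move=> tI; have := alpha_uvs tI; have := alpha_slope.1 _ tI; have := alpha_slope.2 _ tI.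
rewrite alpha_velocity // /xc /yc /zc /= => h p; rewrite gtr0_norm // => E.
rewrite E in h.
have {}h : Num.sqrt (dx t ^+ 2 + dy t ^+ 2) <= m^-1 by rewrite -[m^-1]mulr1 ler_pdivlMl.
by split; apply: le_trans h; rewrite -sqrtr_sqr ler_sqrt ?addr_ge0 ?sqr_ge0 // ?lerDl ?lerDr sqr_ge0.
Qed.

(** Solves (2c)^-1 - 3/2 = 8 lam' + 1: the term 8 lam' answers the constant 8 of [scale_planar], and
    the 1 leaves room for positivity. *)
Let c := (16 * lam' + 5)^-1.

Let c0 : 0 < c. Proof. by rewrite invr_gt0; move: hlam'; lra. Qed.
Let c5 : c <= 5^-1.
Proof. by rewrite lef_pV2 ?posrE; move: hlam'; lra. Qed.
Let cE : (2 * c)^-1 - 3 / 2 = 8 * lam' + 1.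
Proof. by rewrite /c; field; rewrite gt_eqF //; move: hlam'; lra. Qed.

(** W0 may be taken arbitrarily large among the multiples of 2 pi / l. It is made large enough to
    exceed [Wmin] and to make the planar speed bound m^-1 of the given curve small beside the first
    helix. *)
Lemma alpha_wiggle (sg Wmin : R) (N : nat) : (200 <= N)%N -> sg = 1 \/ sg = -1 ->
  exists D W0, [/\ Wmin <= W0,
      [/\ wx D = x, wy D = y & wz D = z], wiggle_scale D l m^-1 c N%:R,
      (forall n, [/\ rad D n ^+ 2 = 2 * c * (1 - sg * c) ^+ n / (W0 * (N%:R ^+ 2) ^+ n),
         wfreq D n = W0 * (N%:R ^+ 2) ^+ n & speed D n = (1 - sg * c) ^+ n]) &
      (forall n, [/\ stage D n 0 = alpha 0, stage D n l = alpha l & smooth_on `[0, l] (stage D n)])].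
Proof.
move=> N200 sgE.
have [xs ys zs [dxs dys]] := alpha_wsmooth.
have N0 : 0 < N%:R :> R by rewrite ltr0n; apply: leq_trans N200.
pose X := m^-1 ^+ 2 * (N%:R ^+ 2 / (32 * c)).
pose Y := `|Wmin| + X.
have X0 : 0 <= X by rewrite mulr_ge0 ?sqr_ge0 // divr_ge0 ?sqr_ge0 // mulr_ge0 // ltW.
have Y0 : 0 <= Y by rewrite addr_ge0.
pose M := (Num.truncn (Y * l / (2 * pi))).+1.
have pi0 : 0 < 2 * pi :> R by rewrite mulr_gt0 ?pi_gt0.
have MP : Y * l / (2 * pi) < M%:R by exact: truncnS_gt.
pose W0 := 2 * pi * M%:R / l.
have WY : Y <= W0.
  by move: MP; rewrite ltr_pdivrMr // => MP; rewrite /W0 ler_pdivlMr // [2 * pi * _]mulrC ltW.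
have q200 : 200 <= N%:R :> R by rewrite ler_nat.
have LW : m^-1 ^+ 2 <= 32 * c / N%:R ^+ 2 * W0.
  have : X <= W0 by apply: le_trans WY; rewrite lerDr.
  have k0 : 0 < 32 * c / N%:R ^+ 2 by rewrite divr_gt0 ?mulr_gt0 ?exprn_gt0.
  move=> /(ler_wpM2l (ltW k0)); congr (_ <= _).
  by rewrite /X; field; rewrite ?gt_eqF // exprn_gt0.
have dxL : {in `[0, l], forall t, `|dx t| <= m^-1} by move=> t /alpha_planar_speed [].
have dyL : {in `[0, l], forall t, `|dy t| <= m^-1} by move=> t /alpha_planar_speed [].
have xP : {in `[0, l], forall t, wderiv l x t (dx t)} by move=> t /alpha_wderiv [].
have yP : {in `[0, l], forall t, wderiv l y t (dy t)} by move=> t /alpha_wderiv [].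
have [D [DE ws fo en pr]] := @wiggle_exists R l x y z dx dy hl xP yP alpha_zderiv dxs dys
  m^-1 c N%:R W0 sg M N dxL dyL c0 c5 q200 erefl sgE isT erefl LW.
exists D, W0; split; [|exact: DE|exact: ws|exact: fo|].
  by apply: le_trans WY; apply: le_trans (ler_norm _) _; rewrite lerDl.
move=> n; have [e1 e2] := en n; have [Dx Dy Dz] := DE; split.
- by rewrite e1 /x /y /z heis_eta.
- by rewrite e2 /x /y /z heis_eta.
by apply: wsmooth_smooth => //; apply: wsmooth_stage => //; rewrite ?Dx ?Dy ?Dz.
Qed.

Lemma alpha_vdisp_ge (s t : R) : 0 <= s -> s <= t -> t <= l ->
  lam * ((x t - x s) ^+ 2 + (y t - y s) ^+ 2) <= `|vdisp (alpha s) (alpha t)|.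
Proof.
move=> s0 st tl; have [_ /vertical_setP H] := alpha_vert.
apply: H; [exists s => //|exists t => //]; rewrite /= in_itv /=.
- by rewrite s0 (le_trans st).
- by rewrite tl (le_trans s0).
Qed.

Lemma stage0E (D : wiggle R) t : [/\ wx D = x, wy D = y & wz D = z] -> stage D 0 t = alpha t.
Proof.
by move=> [Dx Dy Dz]; rewrite /stage /fx /fy /fz !big_ord0 !addr0 Dx Dy Dz heis_eta.
Qed.

(** The given curve is stage 0 of any wiggle built from it, so the stage estimates apply to it. A
    vanishing vertical displacement would, by verticality, force two points to coincide, against
    injectivity; hence its sign is constant. *)
Lemma alpha_linear_lower : exists2 kap : R, 0 < kap & forall s t : R, 0 <= s -> s <= t -> t <= l ->
  lam * ((x t - x s) ^+ 2 + (y t - y s) ^+ 2) <= vdisp (alpha s) (alpha t) /\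
  kap * (t - s) <= vdisp (alpha s) (alpha t).
Proof.
have [D [W0 [_ DE ws fo en]]] := @alpha_wiggle 1 0 200 isT (or_introl erefl).
have S0 := stage0E _ DE.
have sp0 : speed D 0 = 1 by rewrite /speed big_ord0 subr0.
have ta (s t : R) : 0 <= s -> s <= t -> t <= l ->
    `|vdisp (alpha s) (alpha t) - 1 * (t - s)| <= Lk D m^-1 0 ^+ 2 * (t - s) ^+ 2.
  by move=> s0 st tl; have := vdisp_taylor ws s0 st tl 0; rewrite !S0 sp0.
have li (s t : R) : 0 <= s -> s <= t -> t <= l ->
    `|xc (alpha t) - xc (alpha s)| <= Lk D m^-1 0 * (t - s) /\
    `|yc (alpha t) - yc (alpha s)| <= Lk D m^-1 0 * (t - s).
  move=> s0 st tl; have := f_lip ws s0 st tl 0.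
  by case: DE => Dx Dy _; rewrite /fx /fy !big_ord0 !addr0 Dx Dy.
have cont s : {within `[0, l], continuous (fun u => vdisp (alpha s) (alpha u))}.
  apply: (@wderiv_continuous R l _ (fun u => zc (da u) - 2^-1 * (x s * dy u - y s * dx u))).
  move=> u uI; have [Dx Dy Dz] := alpha_wderiv uI.
  suff : wderiv l (fun u => z u - z s - 2^-1 * (x s * y u - y s * x u)) u
     (zc (da u) - 0 - 2^-1 * (x s * dy u - y s * dx u)).
    rewrite subr0; congr wderiv; apply/funext => v.
    by rewrite /vdisp /x /y /z; ring.
  apply: wderivD; first by apply: wderivD => //; apply: wderivN; exact: wderiv_cst.
  apply: wderivN; apply: wderivZ; apply: wderivD; first exact: wderivZ.
  by apply: wderivN; exact: wderivZ.
have n0 (s t : R) : 0 <= s -> s < t -> t <= l -> vdisp (alpha s) (alpha t) != 0.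
  move=> s0 st tl; apply/eqP => v0.
  have := alpha_vdisp_ge s0 (ltW st) tl; rewrite v0 normr0 pmulr_rle0 // => h.
  have h1 := sqr_ge0 (x t - x s); have h2 := sqr_ge0 (y t - y s).
  have ex : x t = x s.
    by apply/eqP; rewrite -subr_eq0 -sqrf_eq0; apply/eqP; lra.
  have ey : y t = y s.
    by apply/eqP; rewrite -subr_eq0 -sqrf_eq0; apply/eqP; lra.
  have ez : z t = z s.
    move: v0; rewrite /vdisp -/(x t) -/(y t) -/(x s) -/(y s) ex ey subrr mulr0 subr0.
    by move=> /eqP; rewrite subr_eq0 => /eqP.
  have E : alpha s = alpha t.
    by rewrite -(heis_eta (alpha s)) -(heis_eta (alpha t)) -/(x t) -/(y t) -/(z t) ex ey ez.
  have [[_ inj] _] := alpha_vert.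
  have := inj s t _ _ E; rewrite !inE /= !in_itv /= s0 tl (ltW (lt_le_trans st tl)) (ltW (le_lt_trans s0 st)).
  by move=> /(_ isT isT) est; move: st; rewrite est ltxx.
have pos (s t : R) : 0 <= s -> s < t -> t <= l -> 0 < vdisp (alpha s) (alpha t).
  exact: (@vdisp_gt0_of_neq0 R alpha l 1 (Lk D m^-1 0) ltr01 ta cont n0).
have ve (s t : R) : 0 <= s -> s <= t -> t <= l ->
    lam * ((x t - x s) ^+ 2 + (y t - y s) ^+ 2) <= vdisp (alpha s) (alpha t).
  move=> s0; rewrite le_eqVlt => /predU1P[<- _|st tl].
    by rewrite !subrr expr0n /= addr0 mulr0 /vdisp !subrr mulr0 subr0.
  by have := alpha_vdisp_ge s0 (ltW st) tl; rewrite gtr0_norm // pos.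
have [kap kap0 kapP] := @vdisp_linear_lower R alpha l 1 (Lk D m^-1 0) lam hl ltr01
  (Lk_ge0 ws 0) hlam ta li (fun s t s0 st tl => ve s t s0 (ltW st) tl) pos.
by exists kap => // s t s0 st tl; split; [exact: ve|exact: kapP].
Qed.

(** The order of choices matters: c depends on lam' alone, kap on the given curve, q = N on kap and
    the gap lam - lam', and W0 last, on all of these and on eps. *)
Lemma good_family_exists (sg : R) : sg = 1 \/ sg = -1 ->
  exists D q W0 kap, good_family alpha D l m^-1 c q W0 sg lam' kap (eps / 2).
Proof.
move=> sgE; have [kap kap0 kapP] := alpha_linear_lower.
have ll : 0 < lam - lam' by rewrite subr_gt0.
pose Z := 114 + 64 * lam' * (1 + 2 * lam' / (lam - lam')).
have Z0 : 0 < Z by rewrite ltr_pwDl // !mulr_ge0 ?addr_ge0 ?divr_ge0 ?mulr_ge0 // ltW.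
pose sig := (lam - lam') / (2 * lam).
have sig0 : 0 < sig by rewrite divr_gt0 // mulr_gt0.
pose N := (Num.truncn (c * Z / (kap * sig)) + 200)%N.
have N200 : (200 <= N)%N by rewrite leq_addl.
have NP : c * Z / (kap * sig) <= N%:R.
  apply: ltW; apply: lt_le_trans (truncnS_gt _) _; rewrite ler_nat /N -addn1 leq_add2l //.
have N0 : 0 < N%:R :> R by rewrite ltr0n; apply: leq_trans N200.
pose e2 := eps / 2.
have e20 : 0 < e2 by rewrite divr_gt0.
(* The squared distance to a stage is at most 2 * 16 r^2 + 4 (12 r l / m + 25 r^2), with r =
   [rad D 0]; for r <= 1 this is at most r T. *)
pose T := 132 + 48 * m^-1 * l.
have T0 : 0 < T by rewrite ltr_pwDl // !mulr_ge0 ?invr_ge0 // ltW.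
pose rho := Num.min 1 (e2 ^+ 2 / T).
have rho0 : 0 < rho by rewrite lt_min ltr01 divr_gt0 // exprn_gt0.
have rho1 : rho <= 1 by rewrite ge_min lexx.
have rhoT : rho * T <= e2 ^+ 2 by rewrite -ler_pdivlMr // ge_min lexx orbT.
(* As r_0^2 = 2c / W0, this lower bound for W0 gives r_0 <= rho. *)
have [D [W0 [Wm DE ws fo en]]] := @alpha_wiggle sg (1 + 2 * c / rho ^+ 2) N N200 sgE.
have S0 := stage0E _ DE.
have W00 : 0 < W0.
  by apply: lt_le_trans Wm; rewrite ltr_pwDl // divr_ge0 ?sqr_ge0 // mulr_ge0 // ltW.
have [Dx Dy Dz] := DE.
have ve (s t : R) : 0 <= s -> s <= t -> t <= l ->
  lam * ((wx D t - wx D s) ^+ 2 + (wy D t - wy D s) ^+ 2) <= vdisp (stage D 0 s) (stage D 0 t).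
  by move=> s0 st tl; rewrite Dx Dy !S0; exact: (kapP s t s0 st tl).1.
have li (s t : R) : 0 <= s -> s <= t -> t <= l ->
  kap * (t - s) <= vdisp (stage D 0 s) (stage D 0 t).
  by move=> s0 st tl; rewrite !S0; exact: (kapP s t s0 st tl).2.
have cl : 8 * lam' + 1 <= (2 * c)^-1 - 3 / 2 by rewrite cE.
have ql : c / (N%:R * kap) * Z <= sig.
  move: NP; rewrite ler_pdivrMr ?(mulr_gt0 kap0 sig0) // => NP.
  rewrite mulrAC ler_pdivrMr ?(mulr_gt0 N0 kap0) //.
  by apply: le_trans NP _; rewrite le_eqVlt; apply/orP; left; apply/eqP; ring.
have r00 := ws_rad ws 0.
have rr : rad D 0 <= rho.
  rewrite -ler_sqr ?nnegrE ?(ltW r00) ?(ltW rho0) //.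
  have [-> _ _] := fo 0%N; rewrite !expr0 !mulr1 ler_pdivrMr // [rho ^+ 2 * _]mulrC -ler_pdivrMr ?exprn_gt0 //.
  by apply: le_trans Wm; rewrite lerDr.
exists D, N%:R, W0, (kap / 2); split.
- exact: ws.
- by rewrite divr_gt0.
- exact: W00.
- by rewrite cE; move: hlam'; lra.
- move=> n s t s0 st tl.
  exact: (stage_vertical ws hlam hlam' hlam'lam kap0 ve li cl ql s0 st tl n).
- move=> n s t s0 st tl.
  exact: (stage_pos ws hlam hlam' hlam'lam kap0 li cl ql s0 (ltW st) tl n st).
- move=> n s t s0 st tl h.
  exact: (stage_pos_large ws hlam hlam' hlam'lam kap0 li ql s0 st tl n h).
- exact: fo.
- by move=> n; have [? ? ?] := en n.
- move=> n t; rewrite in_itv /= => /andP[t0 tl].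
  apply: hdist_le; first exact: ltW.
  have V := vdisp_tail0 ws (lexx 0) t0 tl n; rewrite subr0 !S0 in V.
  have [e0 _ _] := en n; rewrite e0 in V.
  have [f1 f2] := f_tail ws 0 t (leq0n n).
  have [l1 l2] := f_lip ws (lexx 0) t0 tl 0.
  have L0 : Lk D m^-1 0 = m^-1 by rewrite /Lk big_ord0 addr0.
  have fx0 u : fx D 0 u = xc (alpha u) by rewrite /fx big_ord0 addr0 Dx.
  have fy0 u : fy D 0 u = yc (alpha u) by rewrite /fy big_ord0 addr0 Dy.
  have fxn : fx D n 0 = xc (alpha 0) by rewrite -e0.
  have fyn : fy D n 0 = yc (alpha 0) by rewrite -e0.
  rewrite !fx0 fxn in f1; rewrite !fy0 fyn in f2.
  rewrite !fx0 L0 subr0 in l1; rewrite !fy0 L0 subr0 in l2; rewrite L0 in V.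
  set A := alpha t in f1 f2 l1 l2 V *; set p := alpha 0 in f1 f2 l1 l2 V.
  set r := rad D 0 in r00 rr V f1 f2 *; have rn := ws_rad ws n.
  set G := stage D n t in V *.
  have GX : fx D n t = xc G by [].
  have GY : fy D n t = yc G by [].
  rewrite GX in f1; rewrite GY in f2.
  have mt : m^-1 * t <= m^-1 * l by rewrite ler_wpM2l // invr_ge0 ltW.
  have ml : 0 <= m^-1 * l by rewrite mulr_ge0 ?invr_ge0 // ltW.
  have {}f1 : `|xc A - xc G| <= 4 * r.
    rewrite distrC; have -> : xc G - xc A = xc G - xc p - (xc A - xc p) by ring.
    lra.
  have {}f2 : `|yc A - yc G| <= 4 * r.
    rewrite distrC; have -> : yc G - yc A = yc G - yc p - (yc A - yc p) by ring.
    lra.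
  have r4 : 0 <= 4 * r by rewrite mulr_ge0 // ltW.
  have sq (a : R) : `|a| <= 4 * r -> a ^+ 2 <= 16 * r ^+ 2.
    move=> ha; have -> : 16 * r ^+ 2 = (4 * r) ^+ 2 by ring.
    by rewrite -[a ^+ 2]real_normK ?num_real // ler_sqr ?nnegrE.
  have s1 := sq _ f1; have s2 := sq _ f2.
  have C := cross_le (le_trans l1 mt) (le_trans l2 mt) f1 f2.
  have vd : vdisp G A = - (vdisp p G - vdisp p A) -
    2^-1 * ((xc A - xc p) * (yc A - yc G) - (yc A - yc p) * (xc A - xc G)).
    by rewrite /vdisp; field.
  have vb : `|vdisp G A| <= 12 * (r * (m^-1 * l)) + 25 * r ^+ 2.
    rewrite vd; apply: le_trans (ler_normB _ _) _; rewrite normrN normrM.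
    rewrite (ger0_norm (_ : 0 <= 2^-1 :> R)) //.
    have : r * (m^-1 * t) <= r * (m^-1 * l) by rewrite ler_wpM2l // ltW.
    lra.
  apply: le_trans rhoT; apply: (@le_trans _ _ (r * T)); last by rewrite ler_wpM2r // ltW.
  have : r * r <= r * 1 by rewrite ler_wpM2l ?(ltW r00) // (le_trans rr).
  move: s1 s2 vb; rewrite /T !expr2; lra.
- by move=> n; have [? ? ?] := en n.
Qed.

End from_alpha.

(** * Reparametrization, properties of the limit curve, and conclusion *)

Lemma image_rescale (R : realType) (T : Type) (l : R) (F : R -> T) : 0 < l ->
  (fun u => F (l * u)) @` `[0, 1] = F @` `[0, l].
Proof.
move=> l0; apply/seteqP; split=> _ [u uI <-]; move: uI; rewrite /= in_itv /= => /andP[u0 u1].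
  by exists (l * u) => //; rewrite /= in_itv /= (mulr_ge0 (ltW l0) u0) /= ler_piMr // ltW.
exists (l^-1 * u); last by rewrite mulVKf // gt_eqF.
by rewrite /= in_itv /= mulr_ge0 ?invr_ge0 ?(ltW l0) //= ler_pdivrMl // mulr1.
Qed.

Lemma vertical_curve_rescale (R : realType) (lam l : R) (F : R -> heis R) : 0 < l ->
  vertical_curve lam `[0, l] F -> vertical_curve lam `[0, 1] (fun u => F (l * u)).
Proof.
move=> l0 [[Fc Fi] Fv]; split; last by rewrite image_rescale.
have sub u : u \in `[0, 1] -> l * u \in `[0, l].
  rewrite !in_itv /= => /andP[u0 u1].
  by rewrite mulr_ge0 ?(ltW l0) //= ler_piMr // ltW.
split; last first.
  move=> s t; rewrite !inE => sI tI E.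
  by apply: (mulfI (_ : l != 0)); rewrite ?gt_eqF //; apply: Fi => //; rewrite inE; exact: sub.
apply/subspace_continuousP => u uI; apply/cvgrPdist_le => e e0.
move/subspace_continuousP : Fc => /(_ _ (sub _ uI)) /cvgrPdist_le /(_ _ e0) [d /= d0 dH].
exists (d / l) => /=; first by rewrite divr_gt0.
move=> v /= uv vI; apply: dH; last exact: sub.
rewrite /= -mulrBr normrM (gtr0_norm l0) mulrC -ltr_pdivlMr //.
Qed.

Section limit_properties.
Context {R : realType}.
Variables (alpha : R -> heis R) (D : wiggle R) (l L c q W0 sg lam' kap eps : R).
Hypothesis gf : good_family alpha D l L c q W0 sg lam' kap eps.
Hypotheses (lam'0 : 0 < lam') (eps0 : 0 < eps).

Let ws := gf_ws gf.
Let l0 := ws_l ws.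

Lemma limit_curve_exists : exists F : R -> heis R,
  [/\ vertical_curve lam' `[0, l] F, F 0 = alpha 0 /\ F l = alpha l,
      {in `[0, l], forall t, hdist (alpha t) (F t) <= eps} &
      {in `[0, l], forall t, [/\ fx D n t @[n --> \oo] --> xc (F t),
        fy D n t @[n --> \oo] --> yc (F t) & fz D n t @[n --> \oo] --> zc (F t)]}].
Proof.
have [F [Fc FP Fe]] := limit_curve ws; exists F; split => //.
- apply: (vertical_curve_of_vdisp Fc).
  + by move=> s t s0 st tl; exact: (limit_vertical gf FP s0 st tl).
  + by move=> s t s0 st tl; exact: (limit_pos gf FP s0 (ltW st) tl st).
- have en n := gf_end gf n; split.
  + rewrite Fe ?(en 0%N).1 //; first by rewrite in_itv /= lexx ltW.
    by move=> n; rewrite !(en _).1.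
  + rewrite Fe ?(en 0%N).2 //; first by rewrite in_itv /= lexx ltW.
    by move=> n; rewrite !(en _).2.
- move=> t tI; have [X Y Z] := FP t tI.
  (* The fourth power of the distance is polynomial in the coordinates, so the bound passes to the
     limit without any continuity of roots. *)
  rewrite -(@ler_pXn2r _ 4) ?nnegrE ?hdist_ge0 ?(ltW eps0) //.
  rewrite hdist4.
  have C : ((xc (alpha t) - fx D n t) ^+ 2 + (yc (alpha t) - fy D n t) ^+ 2) ^+ 2 +
      16 * vdisp (stage D n t) (alpha t) ^+ 2 @[n --> \oo] -->
    ((xc (alpha t) - xc (F t)) ^+ 2 + (yc (alpha t) - yc (F t)) ^+ 2) ^+ 2 +
      16 * vdisp (F t) (alpha t) ^+ 2.
    have S : (xc (alpha t) - fx D n t) ^+ 2 + (yc (alpha t) - fy D n t) ^+ 2 @[n --> \oo] -->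
      (xc (alpha t) - xc (F t)) ^+ 2 + (yc (alpha t) - yc (F t)) ^+ 2.
      have h1 : xc (alpha t) - fx D n t @[n --> \oo] --> xc (alpha t) - xc (F t).
        by apply: cvgB => //; exact: cvg_cst.
      have h2 : yc (alpha t) - fy D n t @[n --> \oo] --> yc (alpha t) - yc (F t).
        by apply: cvgB => //; exact: cvg_cst.
      by apply: cvgD; apply: cvgM.
    have V : vdisp (stage D n t) (alpha t) @[n --> \oo] --> vdisp (F t) (alpha t).
      rewrite /vdisp; apply: cvgB; first by apply: cvgB => //; exact: cvg_cst.
      by apply: cvgM; [exact: cvg_cst|apply: cvgB; apply: cvgM => //; exact: cvg_cst].
    by apply: cvgD; [exact: cvgM|apply: cvgM; [exact: cvg_cst|exact: cvgM]].
  apply: (ler_cvg_to C (cvg_cst (eps ^+ 4))); exists 0%N => // n _.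
  have := gf_close gf n tI.
  by rewrite -(@ler_pXn2r _ 4) ?nnegrE ?hdist_ge0 ?(ltW eps0) // hdist4.
Qed.

End limit_properties.

Theorem proposition5p5 (R : realType) (lam lam' eps l : R)
    (alpha : R -> heis R) (m : R)
    (hlam : 0 < lam) (hlam' : 0 < lam') (heps : 0 < eps)
    (hlam'lam : lam' < lam) (hl : 0 < l)
    (alpha_smooth : smooth_on `[0, l] alpha)
    (alpha_uvs : unit_vertical_speed `[0, l] alpha)
    (alpha_vert : vertical_curve lam `[0, l] alpha)
    (hm : 0 < m) (alpha_slope : slope_at_least m `[0, l] alpha) :
  (exists gamma1 gamma2 : R -> heis R,
    [/\ smooth_on `[0, l] gamma1 /\ smooth_on `[0, l] gamma2,
        vertical_curve lam' `[0, l] gamma1 /\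
          vertical_curve lam' `[0, l] gamma2,
        connects 0 l gamma1 (alpha 0) (alpha l) /\
          connects 0 l gamma2 (alpha 0) (alpha l),
        (H2hat (gamma1 @` `[0%R, l]) < eps%:E)%E /\
          ((eps^-1)%:E < H2hat (gamma2 @` `[0%R, l]))%E
      & (hausdorff_dist (@hdist R) (alpha @` `[0%R, l]) (gamma1 @` `[0%R, l])
            < eps%:E)%E /\
        (hausdorff_dist (@hdist R) (alpha @` `[0%R, l]) (gamma2 @` `[0%R, l])
            < eps%:E)%E]) /\
  (exists tau1 tau2 : R -> heis R,
    [/\ vertical_curve lam' `[0, 1] tau1 /\ vertical_curve lam' `[0, 1] tau2,
        connects 0 1 tau1 (alpha 0) (alpha l) /\
          connects 0 1 tau2 (alpha 0) (alpha l),
        (hausdorff_dist (@hdist R) (alpha @` `[0%R, l]) (tau1 @` `[0%R, 1%R])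
            < eps%:E)%E /\
        (hausdorff_dist (@hdist R) (alpha @` `[0%R, l]) (tau2 @` `[0%R, 1%R])
            < eps%:E)%E
      & (hausdorff_dim (@hdist R) (tau1 @` `[0%R, 1%R]) < 2%:E)%E /\
        (2%:E < hausdorff_dim (@hdist R) (tau2 @` `[0%R, 1%R]))%E]).
Proof.
have [D1 [q1 [W1 [k1 gf1]]]] := good_family_exists hlam hlam' heps hlam'lam hl
  alpha_smooth alpha_uvs alpha_vert hm alpha_slope (or_introl (erefl (1 : R))).
have [D2 [q2 [W2 [k2 gf2]]]] := good_family_exists hlam hlam' heps hlam'lam hl
  alpha_smooth alpha_uvs alpha_vert hm alpha_slope (or_intror (erefl (-1 : R))).
set c := (16 * lam' + 5)^-1 in gf1 gf2.
have c0 : 0 < c := ws_c (gf_ws gf1).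
have c5 : c <= 5^-1 := gf_c_le gf1.
have e20 : 0 < eps / 2 by rewrite divr_gt0.
have haus (g : R -> heis R) : {in `[0, l], forall t, hdist (alpha t) (g t) <= eps / 2} ->
    (hausdorff_dist (@hdist R) (alpha @` `[0%R, l]) (g @` `[0%R, l]) < eps%:E)%E.
  move=> H; apply: le_lt_trans (hausdorff_dist_image_le (e := eps / 2) _) _; first exact: H.
  by rewrite gt_max !lte_fin heps andbT; lra.
split.
  have c1 : 0 <= 1 - c < 1 by apply/andP; split; lra.
  have c2 : 0 <= (1 + c)^-1 < 1.
    rewrite invr_ge0 invf_lt1; last by lra.
    by apply/andP; split; lra.
  (* The thresholds invert the bounds 2 (1 - c)^n l for the first curve and (1 + c)^n l / 2 for the
     second. *)
  have e1 : 0 < eps / (2 * l) by rewrite divr_gt0 // mulr_gt0.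
  have e2 : 0 < eps * l / 2 by rewrite divr_gt0 // mulr_gt0.
  have [n1 n1P] := expr_lt_ex c1 e1; have [n2 n2P] := expr_lt_ex c2 e2.
  exists (stage D1 n1), (stage D2 n2); split.
  - by split; [exact: (gf_smooth gf1 (n:=n1))|exact: (gf_smooth gf2 (n:=n2))].
  - by split; [exact: (stage_vertical_curve gf1 n1)|exact: (stage_vertical_curve gf2 n2)].
  - by split; [exact: (gf_end gf1 n1)|exact: (gf_end gf2 n2)].
  - split.
      apply: le_lt_trans (stage_H2hat_le gf1 n1) _.
      have [_ _ ->] := gf_formula gf1 n1; rewrite lte_fin mul1r.
      move: n1P; rewrite ltr_pdivlMr ?mulr_gt0 //; lra.
    apply: lt_le_trans (stage_H2hat_ge gf2 hlam' n2).
    have [_ _ ->] := gf_formula gf2 n2; rewrite lte_fin mulN1r opprK.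
    have p0 : 0 < (1 + c) ^+ n2 by rewrite exprn_gt0 //; lra.
    rewrite exprVn -[_^-1]div1r ltr_pdivrMr // in n2P.
    by rewrite -div1r ltr_pdivrMr //; lra.
  - by split; apply: haus => t tI; [exact: (gf_close gf1 n1 tI)|exact: (gf_close gf2 n2 tI)].
have [F1 [F1v [F10 F1l] F1c F1P]] := limit_curve_exists gf1 e20.
have [F2 [F2v [F20 F2l] F2c F2P]] := limit_curve_exists gf2 e20.
exists (fun u => F1 (l * u)), (fun u => F2 (l * u)); rewrite !image_rescale //; split.
- by split; exact: vertical_curve_rescale.
- by rewrite /connects !mulr0 !mulr1.
- by split; exact: haus.
- by split; [exact: (limit_dim_lt2 gf1 F1P)|exact: (limit_dim_gt2 gf2 F2P)].
Qed.
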